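(* Let $\omega,\varepsilon_0,\mu_0>0$, let $\mathcal{K}=\mathcal{K}_{w_1,\ldots,w_n;x_0}\subset\mathbb{R}^3$ be a convex polyhedral cone with $n\ge 3$ edges and apex $x_0\in\mathbb{R}^3$, let $r_0>0$, and let $\mathcal{K}^{r_0}_{x_0}=\mathcal{K}\cap B_{r_0}(x_0)$. Let $\alpha\in(0,1)$ and let $\mathbf{F}_1,\mathbf{F}_2\in C^\alpha(\overline{\mathcal{K}^{r_0}_{x_0}})^3$ be $\mathbb{C}^3$-valued functions. Suppose there exists a pair $(\mathbf{E},\mathbf{H})\in H(\mathrm{curl},\mathcal{K}^{r_0}_{x_0})\times H(\mathrm{curl},\mathcal{K}^{r_0}_{x_0})$ satisfying $$\nabla\wedge\mathbf{E}-\mathrm{i}\omega\mu_0\mathbf{H}=\mathbf{F}_1\quad\text{in }\mathcal{K}^{r_0}_{x_0},$$ $$\nabla\wedge\mathbf{H}+\mathrm{i}\omega\varepsilon_0\mathbf{E}=\mathbf{F}_2\quad\text{in }\mathcal{K}^{r_0}_{x_0},$$ $$\nu\wedge\mathbf{E}=\nu\wedge\mathbf{H}=0\quad\text{on }\partial\mathcal{K}^{r_0}_{x_0}\setminus\partial B_{r_0}(x_0).$$ Then $$\mathbf{F}_1(x_0)=\mathbf{F}_2(x_0)=0.$$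
   Context: Convex polyhedral cone: let $w_1,\ldots,w_n\in\mathbb{S}^2=\{x\in\mathbb{R}^3: |x|=1\}$, $n\ge3$, be unit vectors any three of which are linearly independent, and let $x_0\in\mathbb{R}^3$. Put $$\mathcal{K}_{w_1,\ldots,w_n;x_0}:=\Big\{x_0+\sum_{j=1}^n c_jw_j:\ c_j>0,\ j=1,\ldots,n\Big\}.$$ It is assumed that this set is strictly convex (it is convex and fits into a spherical cone with apex $x_0$ of opening angle less than $\pi$) and that none of the $w_j$ is redundant. It is then called a convex polyhedral cone with $n$ edges, with apex $x_0$ and edge directions $w_j$. $B_{r}(x_0)$ is the open ball of radius $r$ centred at $x_0$. Notation: $\wedge$ is the vector (cross) product and $\nabla\wedge$ is the curl; $H(\mathrm{curl},D)$ is the space of $L^2(D;\mathbb{C}^3)$ fields with curl in $L^2(D;\mathbb{C}^3)$; $\nu$ is the exterior unit normal; tangential boundary conditions are in the sense of traces; $C^\alpha$ denotes Hölder continuous functions with exponent $\alpha$; $\mathrm{i}=\sqrt{-1}$. *)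

(* Defs.v *)
From HB Require Import structures.
From mathcomp Require Import all_boot all_order all_algebra.
From mathcomp Require Import all_classical all_reals all_analysis.
From mathcomp Require Import complex.

Set Implicit Arguments.
Unset Strict Implicit.
Unset Printing Implicit Defensive.

Import Order.TTheory GRing.Theory Num.Theory.
Import numFieldNormedType.Exports.

Local Open Scope classical_set_scope.
Local Open Scope ring_scope.
Local Open Scope complex_scope.

(* The library norm `|v| on 'rV[R]_3 is the max norm; it gives the usual
   topology, but lengths, balls and angles need the Euclidean one. *)
Definition dot (R : realType) (u v : 'rV[R]_3) : R := \sum_k u 0 k * v 0 k.

Definition enorm (R : realType) (v : 'rV[R]_3) : R := Num.sqrt (dot v v).

Definition eball (R : realType) (x0 : 'rV[R]_3) (r : R) : set 'rV[R]_3 :=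
  [set x | enorm (x - x0) < r].

Definition boundary (T : topologicalType) (A : set T) : set T :=
  closure A `\` interior A.

(* The cone with apex [x0] spanned by those directions [w j] for which [J j];
   the cone of the whole family is the case [J = predT]. *)
Definition open_cone (R : realType) (n : nat) (J : pred 'I_n)
    (w : 'I_n -> 'rV[R]_3) (x0 : 'rV[R]_3) : set 'rV[R]_3 :=
  [set x | exists2 c : 'I_n -> R, (forall j, J j -> 0 < c j) &
           x = x0 + \sum_(j | J j) c j *: w j].

(* [beta] is the full opening angle. *)
Definition spherical_cone (R : realType) (x0 d : 'rV[R]_3) (beta : R) :
    set 'rV[R]_3 :=
  [set x | enorm (x - x0) * cos (beta / 2) <= dot (x - x0) d].

Definition strictly_convex_cone (R : realType) (x0 : 'rV[R]_3)
    (K : set 'rV[R]_3) : Prop :=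
  convex_set (K : set (convex_lmodType 'rV[R]_3)) /\
  exists (d : 'rV[R]_3) (beta : R),
    [/\ enorm d = 1, 0 < beta < pi & K `<=` spherical_cone x0 d beta].

(* [w j] is redundant when deleting it from the family leaves the cone
   unchanged. *)
Definition convex_polyhedral_cone (R : realType) (n : nat)
    (w : 'I_n -> 'rV[R]_3) (x0 : 'rV[R]_3) : Prop :=
  [/\ (3 <= n)%N,
      forall j, enorm (w j) = 1,
      forall s : 'I_3 -> 'I_n, injective s -> row_free (\matrix_a w (s a)),
      strictly_convex_cone x0 (open_cone predT w x0) &
      forall j, open_cone (predC1 j) w x0 <> open_cone predT w x0].

Definition truncated_cone (R : realType) (n : nat)
    (w : 'I_n -> 'rV[R]_3) (x0 : 'rV[R]_3) (r : R) : set 'rV[R]_3 :=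
  open_cone predT w x0 `&` eball x0 r.

(* The library has Lebesgue measure on R and product measures, but no
   measurable structure on 'rV[R]_3: integrals over subsets of 'rV[R]_3 are
   taken in coordinates on R * R * R, with the product Borel structure. *)
Definition coord3 (R : realType) :=
  (measurableTypeR R * measurableTypeR R * measurableTypeR R)%type.

Definition vec3 (R : realType) (p : coord3 R) : 'rV[R]_3 :=
  \row_(k < 3) [:: (p.1.1 : R); (p.1.2 : R); (p.2 : R)]`_k.

Definition lebesgue3 (R : realType) : {measure set (coord3 R) -> \bar R} :=
  ((@lebesgue_measure R \x @lebesgue_measure R) \x @lebesgue_measure R)%E.

Definition ae_in (R : realType) (D : set 'rV[R]_3) (P : 'rV[R]_3 -> Prop) :
    Prop :=
  {ae @lebesgue3 R, forall p, D (vec3 p) -> P (vec3 p)}.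

Definition cintegral (R : realType) (D : set 'rV[R]_3)
    (f : 'rV[R]_3 -> R[i]) : R[i] :=
  \int[@lebesgue3 R]_(p in @vec3 R @^-1` D) complex.Re (f (vec3 p)) +i*
  \int[@lebesgue3 R]_(p in @vec3 R @^-1` D) complex.Im (f (vec3 p)).

(* Fields on D are total functions of which only the values on D matter. *)
Definition cfield (R : realType) : Type := 'rV[R]_3 -> 'rV[R[i]]_3.

Definition cnorm (R : realType) (z : 'rV[R[i]]_3) : R :=
  Num.sqrt (\sum_k Normc.normc (z 0 k) ^+ 2).

Definition hoelder_on (R : realType) (alpha : R) (A : set 'rV[R]_3)
    (F : cfield R) : Prop :=
  exists C : R, forall x y, A x -> A y ->
    cnorm (F x - F y) <= C * (enorm (x - y) `^ alpha).

Definition L2_field (R : realType) (D : set 'rV[R]_3) (u : cfield R) : Prop :=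
  (forall k, measurable_fun (@vec3 R @^-1` D)
               (fun p => complex.Re (u (vec3 p) 0 k)) /\
             measurable_fun (@vec3 R @^-1` D)
               (fun p => complex.Im (u (vec3 p) 0 k))) /\
  (\int[@lebesgue3 R]_(p in @vec3 R @^-1` D)
     (cnorm (u (vec3 p)) ^+ 2)%:E < +oo)%E.

Definition partial (R : realType) (k : 'I_3) (f : 'rV[R]_3 -> R) :
    'rV[R]_3 -> R :=
  fun x => 'D_(delta_mx 0 k) f x.

(* C^infinity: all iterated partial derivatives exist and are continuous. *)
Definition smooth (R : realType) (f : 'rV[R]_3 -> R) : Prop :=
  forall s : seq 'I_3,
    continuous (foldr (@partial R) f s) /\
    forall (k : 'I_3) x, derivable (foldr (@partial R) f s) x (delta_mx 0 k).

Definition supp (R : realType) (phi : 'rV[R]_3 -> 'rV[R]_3) : set 'rV[R]_3 :=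
  closure [set x | phi x != 0].

(* Real-valued test fields suffice to test complex-valued distributions: the
   pairings below are complex and extend C-linearly. *)
Definition test_field (R : realType) (phi : 'rV[R]_3 -> 'rV[R]_3) : Prop :=
  (forall k, smooth (fun x => phi x 0 k)) /\ compact (supp phi).

(* Index arithmetic in 'I_3 is modulo 3, so that component k is
   d_(k+1) phi_(k+2) - d_(k+2) phi_(k+1). *)
Definition curl_smooth (R : realType) (phi : 'rV[R]_3 -> 'rV[R]_3) :
    'rV[R]_3 -> 'rV[R]_3 :=
  fun x => \row_(k < 3)
    (partial (k + 1) (fun y => phi y 0 (k + 2%:R)) x -
     partial (k + 2%:R) (fun y => phi y 0 (k + 1)) x).

Definition cdot (R : realType) (z : 'rV[R[i]]_3) (v : 'rV[R]_3) : R[i] :=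
  \sum_k z 0 k * (v 0 k)%:C.

Definition weak_curl (R : realType) (D : set 'rV[R]_3) (u v : cfield R) :
    Prop :=
  L2_field D v /\
  forall phi, test_field phi -> supp phi `<=` D ->
    cintegral D (fun x => cdot (v x) (phi x)) =
    cintegral D (fun x => cdot (u x) (curl_smooth phi x)).

Definition Hcurl (R : realType) (D : set 'rV[R]_3) (u : cfield R) : Prop :=
  L2_field D u /\ exists v, weak_curl D u v.

(* The distributional curl on D of [u] in H(curl, D); as a field it is a choice
   of representative, unique up to null sets. *)
Definition curl (R : realType) (D : set 'rV[R]_3) (u : cfield R) : cfield R :=
  xget (fun=> 0) [set v | weak_curl D u v].

(* The tangential trace nu /\ u of [u] in H(curl, D), as the functional on test
   fields given by Green's formula
     int_(dD) (nu /\ u) . phi = int_D (curl u . phi - u . curl phi),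
   nu being the exterior unit normal of D. *)
Definition tangential_trace (R : realType) (D : set 'rV[R]_3) (u : cfield R)
    (phi : 'rV[R]_3 -> 'rV[R]_3) : R[i] :=
  cintegral D (fun x => cdot (curl D u x) (phi x) - cdot (u x) (curl_smooth phi x)).

(* nu /\ u = 0 on a relatively open part [G] of the boundary of D: the trace
   vanishes on all test fields supported away from the rest of the boundary. *)
Definition tangential_trace_zero (R : realType) (D G : set 'rV[R]_3)
    (u : cfield R) : Prop :=
  forall phi, test_field phi -> supp phi `&` (boundary D `\` G) = set0 ->
    tangential_trace D u phi = 0.

(* Main.v *)
(* Pair the system with constant multiples of exp(rho . (x - x0)), where rho = s a + i t b,
   a = a0 - eta w1, b = w1 /\ a0, and t is chosen so that rho . rho equals
   - omega^2 eps0 mu0: the exponential is then a component of exact solutions of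
   the homogeneous system.  As both tangential traces vanish on the lateral
   faces, only the sources and the cut-off near the sphere contribute, the latter
   exponentially little since a . (x - x0) <= - d |x - x0| on the cone.  Hoelder
   continuity replaces F2 by F2(x0) up to O(s^(-2-alpha)), so the product of the
   linear form F2(x0) . (rho /\ (a /\ b)) with the Laplace transform of the cone
   at rho is O(s^(-2-alpha)).  For w1 an edge and a0 exposing it, small eta makes
   the transform at least of order s^(-3): the exponential decays slowly only
   along w1, where the cone coincides with the simplicial cone spanned by w1 and
   its two adjacent edges, and translating that cone along its edges turns its
   transform into an integral over a small parallelepiped, where the wave is
   close to 1.  Hence - sqrt(1 + eta^2) F2(x0) . b + i F2(x0) . a = 0
   for all small eta, and three values of eta give F2(x0) = 0.  Exchanging the
   roles of E and H gives F1(x0) = 0. *)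

From HB Require Import structures.
Require Import Defs.
From mathcomp Require Import all_boot all_order all_algebra.
From mathcomp Require Import all_classical all_reals all_analysis.
From mathcomp Require Import complex measurable_realfun ring lra.
Import Order.TTheory GRing.Theory Num.Theory.
Import numFieldNormedType.Exports.
Import Normc.
Local Open Scope classical_set_scope.
Local Open Scope ring_scope.
Local Open Scope complex_scope.
Set Implicit Arguments.
Unset Strict Implicit.
Unset Printing Implicit Defensive.

(** * Lebesgue measure on R^3 *)

(** The obstacle is the lower bound on the transform, an oscillatory integral that could be small
    through cancellation. The tilt serves here: [a0] alone gives no decay along w1, while with the
    tilt the factor 1 - exp(-k eta) produced by a translation along w1 is of order eta. The part of
    the cone outside the simplicial one decays at a rate delta independent of eta, so after
    multiplication by that factor it is small against the integral over the parallelepiped. Since b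
    is orthogonal to w1, the factor carries no phase. The exponents follow from counting one power
    of s. The second equation is tested with rho /\ (a /\ b), of order s, the first only with the
    constant a /\ b. The moments of both fields then cancel, and F1 enters through its boundedness
    alone, at order s^(-3), which alpha < 1 absorbs into s^(-2-alpha). Dividing by the lower bound
    leaves O(s^(1-alpha)) for a quantity that equals the final relation times a multiple of s, up to
    O(1). *)

Section Measure3.
Context {R : realType}.
Local Notation mu3 := (@lebesgue3 R).
Local Notation leb := (@lebesgue_measure R).
Implicit Types (x v : 'rV[R]_3) (p : coord3 R) (U : set 'rV[R]_3).

Lemma vec3_0 p : vec3 p 0 0 = p.1.1. Proof. by rewrite mxE. Qed.
Lemma vec3_1 p : vec3 p 0 1 = p.1.2. Proof. by rewrite mxE. Qed.
Lemma vec3_2 p : vec3 p 0 2%:R = p.2. Proof. by rewrite mxE. Qed.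

Lemma ord3P (P : 'I_3 -> Prop) : P 0 -> P 1 -> P 2%:R -> forall k, P k.
Proof.
move=> P0 P1 P2 [[|[|[|//]]] i].
- by rewrite (_ : Ordinal i = 0) //; apply: val_inj.
- by rewrite (_ : Ordinal i = 1) //; apply: val_inj.
- by rewrite (_ : Ordinal i = 2%:R) //; apply: val_inj.
Qed.

Lemma sum3E (V : nmodType) (F : 'I_3 -> V) : \sum_k F k = F 0 + F 1 + F 2%:R.
Proof.
rewrite !big_ord_recl big_ord0 addr0 addrA.
by congr (F _ + F _ + F _); apply: val_inj.
Qed.

Definition coords x : coord3 R := (x 0 0, x 0 1, x 0 2%:R).

Definition box (c : coord3 R) (e : R) : set (coord3 R) :=
  (`]c.1.1 - e, c.1.1 + e[ `*` `]c.1.2 - e, c.1.2 + e[) `*` `]c.2 - e, c.2 + e[.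

Lemma measurable_box c e : measurable (box c e).
Proof. by do 2![apply: measurableX => //]. Qed.

(** The sigma-algebra on [coord3 R] is a product, not generated by the open sets of row vectors. An
    open set is the countable union of the rational cubes that it contains, enumerated through
    [unpickle]. *)
Lemma open_measurable_vec3 U : open U -> measurable (@vec3 R @^-1` U).
Proof.
move=> oU.
pose I := (rat * rat * rat * rat)%type.
pose b (i : I) := box (ratr i.1.1.1, ratr i.1.1.2, ratr i.1.2) (ratr i.2).
pose f (i : I) := if `[< b i `<=` @vec3 R @^-1` U >] then b i else set0.
rewrite (_ : _ @^-1` U = \bigcup_n (if unpickle n is Some i then f i else set0)).
  apply: bigcup_measurable => n _; case: unpickle => // i.
  by rewrite /f; case: ifP => // _; exact: measurable_box.
apply/seteqP; split=> [p Up|p [n _]]; last first.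
  by case: unpickle => // i; rewrite /f; case: asboolP => // + bp; apply.
suff [i bi] : exists i, f i p.
  by exists (pickle i); [by []|rewrite pickleK].
have /nbhs_ballP [e /= e0 be] : nbhs (vec3 p) U by exact: open_nbhs_nbhs.
(* Centre and points of the cube each deviate by less than [d] per coordinate, hence [d < e / 2]. *)
have [d] : exists q, ratr q \in `]0, e / 2[ by apply: rat_in_itvoo; rewrite divr_gt0.
rewrite in_itv => /= /andP[d0 de].
have Q (r : R) : exists q, ratr q \in `]r - ratr d, r + ratr d[.
  by apply: rat_in_itvoo; rewrite ltrD2l gtrN.
have [q1] := Q p.1.1; have [q2] := Q p.1.2; have [q3] := Q p.2.
rewrite !in_itv /= => /andP[? ?] /andP[? ?] /andP[? ?].
exists (q1, q2, q3, d); rewrite /f asboolT; last first.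
  move=> z; rewrite /b /box /= => -[[]]; rewrite /= !in_itv /=.
  move=> /andP[? ?] /andP[? ?] /andP[? ?]; apply: be.
  rewrite mx_norm_ball /ball_ /= [`|_|]mx_normrE.
  apply/bigmax_ltP; split=> // -[i j] _ /=; rewrite ord1 {i}.
  move: j; apply: ord3P; rewrite !mxE /= ltr_norml; lra.
rewrite /b /box /=; do !split; rewrite /= in_itv /=; lra.
Qed.

Lemma continuous_measurable_vec3 (f : 'rV[R]_3 -> R) (D : set (coord3 R)) :
  continuous f -> measurable_fun D (f \o @vec3 R).
Proof.
move=> /continuousP cf; apply: (@measurable_funS _ _ _ _ setT) => //.
apply: (measurability _ (RGenOInfty.measurableE R)).
move=> /= _ [_ [a ->]] <-; apply: measurableI => //.
by rewrite comp_preimage; apply: open_measurable_vec3; apply: cf; exact: interval_open.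
Qed.

Definition shift3 v p : coord3 R :=
  (p.1.1 + v 0 0, p.1.2 + v 0 1, p.2 + v 0 2%:R).

Lemma vec3_shift3 v p : vec3 (shift3 v p) = vec3 p + v.
Proof.
by apply/rowP; apply: ord3P; rewrite !mxE.
Qed.

Lemma measurable_shift (c : R) :
  measurable_fun setT ((fun r => r + c) : measurableTypeR R -> measurableTypeR R).
Proof. exact: measurable_funD. Qed.

Lemma measurable_shift3 v : measurable_fun setT (shift3 v).
Proof.
apply/measurable_fun_pair => /=.
  apply/measurable_fun_pair => /=.
    apply: (measurableT_comp (measurable_shift (v 0 0))).
    exact: measurableT_comp.
  apply: (measurableT_comp (measurable_shift (v 0 1))).
  exact: measurableT_comp.
exact: (measurableT_comp (measurable_shift (v 0 2%:R))).
Qed.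

Lemma shift_preimage_itv (c a b : R) :
  (fun r => r + c) @^-1` `]a, b]%classic = `](a - c), (b - c)]%classic.
Proof.
apply/seteqP; split=> r /=; rewrite !in_itv /= => /andP[? ?]; lra.
Qed.

Lemma lebesgue_measure_shift (c : R) (A : set R) : measurable A ->
  leb ((fun r => r + c) @^-1` A) = leb A.
Proof.
move=> mA; pose f : measurableTypeR R -> measurableTypeR R := fun r => r + c.
have mf : measurable_fun setT f by exact: measurable_shift.
pose fm : {mfun _ >-> _} := HB.pack f (isMeasurableFun.Build _ _ _ _ _ mf).
apply/esym.
apply: (@lebesgue_measure_unique R (pushforward leb fm)) => //.
move=> _ [[a b]] _ <-; transitivity (leb `](a - c), (b - c)]%classic); last first.
  by congr (leb _); rewrite -shift_preimage_itv.
rewrite [LHS]lebesgue_measure_itv [RHS]lebesgue_measure_itv /= !lte_fin ltrD2r.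
by case: ifP => // _; rewrite -!EFinB; congr EFin; lra.
Qed.

Lemma sigma_finite_lebesgue_prod :
  sigma_finite [set: measurableTypeR R * measurableTypeR R] (leb \x leb)%E.
Proof.
exists (fun n => `]- n%:R, n%:R[%classic `*` `]- n%:R, n%:R[%classic).
  apply/esym/seteqP; split=> // -[x y] _.
  exists (Num.bound (`|x| + `|y|)) => //=; rewrite !in_itv /=.
  have := archi_boundP (addr_ge0 (normr_ge0 x) (normr_ge0 y)).
  rewrite -!ltr_norml; have := normr_ge0 x; have := normr_ge0 y.
  move=> *; split; lra.
move=> n; split; first exact: measurableX.
rewrite product_measure1E // [X in (X * _)%E]lebesgue_measure_itv.
rewrite [X in (_ * X)%E]lebesgue_measure_itv /=.
by case: ifP => _; rewrite ?mul0e -?EFinB -?EFinM ltry.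
Qed.

(* The library's canonical instance on products of measures is the one for
   subprobabilities; this one is needed for Tonelli's theorem. *)
Definition lebesgue2 :
    {sigma_finite_measure set (measurableTypeR R * measurableTypeR R)%type
       -> \bar R} :=
  HB.pack (leb \x leb)%E
    (Measure_isSigmaFinite.Build _ _ _ (leb \x leb)%E sigma_finite_lebesgue_prod).

(** Product measures are determined by rectangles, on which the claim reduces to one-dimensional
    translations. Uniqueness is used twice: for the first two coordinates, then for their product
    with the third. *)
Lemma lebesgue3_shift v (A : set (coord3 R)) : measurable A ->
  mu3 (shift3 v @^-1` A) = mu3 A.
Proof.
move=> mA.
pose f2 (q : measurableTypeR R * measurableTypeR R) :
  measurableTypeR R * measurableTypeR R := (q.1 + v 0 0, q.2 + v 0 1).
have mf2 : measurable_fun setT f2.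
  apply/measurable_fun_pair => /=.
    exact: (measurableT_comp (measurable_shift (v 0 0))).
  exact: (measurableT_comp (measurable_shift (v 0 1))).
pose fm2 : {mfun _ >-> _} := HB.pack f2 (isMeasurableFun.Build _ _ _ _ _ mf2).
have H2 B : measurable B -> (leb \x leb)%E (f2 @^-1` B) = (leb \x leb)%E B.
  move=> mB; apply/esym.
  apply: (@product_measure_unique _ _ _ _ R leb leb
    (pushforward (leb \x leb)%E fm2)) => // A1 A2 mA1 mA2.
  transitivity ((leb \x leb)%E (((fun r => r + v 0 0) @^-1` A1) `*`
    ((fun r => r + v 0 1) @^-1` A2))); first by [].
  rewrite product_measure1E//; last 2 first.
  - by rewrite -[X in measurable X]setTI; apply: (measurable_shift _) => //.
  - by rewrite -[X in measurable X]setTI; apply: (measurable_shift _) => //.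
  by congr (_ * _)%E; exact: lebesgue_measure_shift.
pose f3 : {mfun _ >-> _} :=
  HB.pack (shift3 v) (isMeasurableFun.Build _ _ _ _ _ (measurable_shift3 v)).
suff H A1 A2 : measurable A1 -> measurable A2 ->
    pushforward mu3 f3 (A1 `*` A2) = ((leb \x leb)%E A1 * leb A2)%E.
  exact: (esym (@product_measure_unique _ _ _ _ R lebesgue2 leb
    (pushforward mu3 f3) H A mA)).
move=> mA1 mA2.
have E : mu3 ((f2 @^-1` A1) `*` ((fun r => r + v 0 2%:R) @^-1` A2)) =
    ((leb \x leb)%E (f2 @^-1` A1) * leb ((fun r => (r + v 0 2%:R)%R) @^-1` A2))%E.
  apply: product_measure1E.
    by rewrite -[X in measurable X]setTI; exact: (mf2 measurableT A1 mA1).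
  by rewrite -[X in measurable X]setTI; apply: (measurable_shift _).
transitivity (mu3 ((f2 @^-1` A1) `*` ((fun r => r + v 0 2%:R) @^-1` A2))).
  by [].
by rewrite E; congr (_ * _)%E; [exact: H2|exact: lebesgue_measure_shift].
Qed.

Lemma lebesgue3_box c e : 0 < e -> mu3 (box c e) = ((2 * e) ^+ 3)%:E.
Proof.
move=> e0.
pose I r : set (measurableTypeR R) := `]r - e, r + e[%classic.
have mI r : measurable (I r) by exact: measurable_itv.
have E1 r : leb (I r) = (2 * e)%:E.
  rewrite lebesgue_measure_itv /= lte_fin.
  have -> : r - e < r + e by lra.
  by rewrite -EFinB; congr EFin; ring.
have E2 : (leb \x leb)%E (I c.1.1 `*` I c.1.2) = (leb (I c.1.1) * leb (I c.1.2))%E.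
  exact: product_measure1E.
have E3 : mu3 (box c e) = ((leb \x leb)%E (I c.1.1 `*` I c.1.2) * leb (I c.2))%E.
  by apply: product_measure1E => //; apply: measurableX.
by rewrite E3 E2 !E1 -!EFinM; congr EFin; ring.
Qed.

End Measure3.

(** * Integrals of decaying exponentials *)

Section ExponentialIntegral.
Context {R : realType}.
Local Notation mu3 := (@lebesgue3 R).
Local Notation leb := (@lebesgue_measure R).
Implicit Types (x v : 'rV[R]_3) (p : coord3 R) (U : set 'rV[R]_3).

Lemma measurable_expR_abs (l : R) :
  measurable_fun setT ((fun r => expR (- (l * `|r|))) : measurableTypeR R -> R).
Proof.
apply: continuous_measurable_fun => r; apply: continuous_comp.
  by apply: continuousN; apply: continuousM; [exact: cvg_cst|exact: norm_continuous].
exact: continuous_expR.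
Qed.

(** Up to the factor [l], the integrand is at most the exponential density plus its reflection, each
    of total mass 1. *)
Lemma integral_expR_abs (l : R) : 0 < l ->
  (\int[leb]_r (expR (- (l * `|r|)))%:E <= (2 / l)%:E)%E.
Proof.
move=> l0; have l0' := ltW l0.
pose g (r : measurableTypeR R) : R := exponential_pdf l r.
have mg : measurable_fun setT g by exact: measurable_exponential_pdf.
have mN : measurable_fun setT (-%R : measurableTypeR R -> measurableTypeR R).
  exact: measurable_funN.
have mgN : measurable_fun setT (fun r : measurableTypeR R => g (- (r : R))) by exact: measurableT_comp mg mN.
have gN : (\int[leb]_r (g (- (r : R))%R)%:E = 1)%E.
  rewrite -(integral_exponential_pdf l0).
  transitivity (\int[pushforward leb (-%R : measurableTypeR R -> measurableTypeR R)]_r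
    (g r)%:E)%E.
    rewrite ge0_integral_pushforward //.
      exact/measurable_EFinP.
    by move=> y _; rewrite lee_fin exponential_pdf_ge0.
  by apply: eq_measure_integral => A mA _; exact: lebesgue_measureN.
have H : (\int[leb]_r ((l^-1)%:E * ((g r)%:E + (g (- (r : R))%R)%:E)) = (2 / l)%:E)%E.
  rewrite ge0_integralZl //; last 3 first.
  - by apply: emeasurable_funD; apply/measurable_EFinP.
  - by move=> r _; rewrite -EFinD lee_fin addr_ge0 // exponential_pdf_ge0.
  - by rewrite lee_fin invr_ge0.
  rewrite ge0_integralD //; last 4 first.
  - by move=> r _; rewrite lee_fin exponential_pdf_ge0.
  - exact/measurable_EFinP.
  - by move=> r _; rewrite lee_fin exponential_pdf_ge0.
  - exact/measurable_EFinP.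
  rewrite gN integral_exponential_pdf // -EFinD -EFinM; congr EFin; ring.
rewrite -H; apply: ge0_le_integral => //.
- by apply/measurable_EFinP; exact: measurable_expR_abs.
- apply: measurable_funeM; apply: emeasurable_funD; exact/measurable_EFinP.
move=> r _; rewrite -EFinD -EFinM lee_fin ler_pdivlMl //.
have gE (t : R) : 0 <= t -> g t = l * expR (- (l * t)).
  by move=> t0; rewrite /g exponential_pdfE // mulNr.
have [r0|r0] := leP 0 (r : R).
  by rewrite (gE r) // ger0_norm // lerDl exponential_pdf_ge0.
rewrite (gE (- (r : R))); last by rewrite oppr_ge0 ltW.
rewrite ltr0_norm //.
by rewrite lerDr exponential_pdf_ge0.
Qed.

(** This norm is preferred for decay estimates because [expR (- (l * l1 v))] factors over the
    coordinates. *)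
Definition l1 v : R := `|v 0 0| + `|v 0 1| + `|v 0 2%:R|.

Lemma l1_continuous : continuous l1.
Proof.
have H (k : 'I_3) : continuous (fun v : 'rV[R]_3 => `|v 0 k|).
  move=> v; apply: continuous_comp; last exact: norm_continuous.
  exact: coord_continuous.
by move=> v; exact: (cvgD (cvgD (H 0 v) (H 1 v)) (H 2%:R v)).
Qed.

(** Tonelli gives the cube of the one-dimensional bound [2 / l]. With [l] proportional to [s], this
    is the origin of the order [s ^- 3] of all moments. *)
Lemma integral_exp_l1 (l : R) x : 0 < l ->
  (\int[mu3]_p (expR (- (l * l1 (vec3 p - x))))%:E <= (8 / l ^+ 3)%:E)%E.
Proof.
move=> l0.
pose e (r : measurableTypeR R) := (expR (- (l * `|r : R|)))%:E.
have e0 r : (0 <= e r)%E by rewrite lee_fin expR_ge0.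
have me : measurable_fun setT e.
  by apply/measurable_EFinP; exact: measurable_expR_abs.
have me1 (d : measure_display) (T : measurableType d) (f : T -> measurableTypeR R) :
    measurable_fun setT f -> measurable_fun setT (e \o f).
  by move=> mf; exact: measurableT_comp.
pose c := (\int[leb]_r e r)%E.
have c0 : (0 <= c)%E by exact: integral_ge0.
have cl : (c <= (2 / l)%:E)%E by exact: integral_expR_abs.
pose f2 (q : measurableTypeR R * measurableTypeR R) := (e q.1 * e q.2)%E.
have f20 q : (0 <= f2 q)%E by rewrite mule_ge0.
have mf2 : measurable_fun setT f2 by apply: emeasurable_funM; exact: me1.
have i2 : (\int[lebesgue2]_q f2 q = c * c)%E.
  transitivity (\int[leb]_a \int[leb]_b f2 (a, b))%E.
    exact: (@fubini_tonelli1 _ _ _ _ R leb leb).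
  rewrite -ge0_integralZr //; apply: eq_integral => a _.
  by rewrite -ge0_integralZl.
pose f3 (p : coord3 R) := (f2 p.1 * e p.2)%E.
have f30 p : (0 <= f3 p)%E by rewrite mule_ge0.
have mf3 : measurable_fun setT f3.
  by apply: emeasurable_funM; [exact: measurableT_comp|exact: me1].
have i3 : (\int[mu3]_p f3 p = c * c * c)%E.
  transitivity (\int[lebesgue2]_q \int[leb]_b f3 (q, b))%E.
    exact: (@fubini_tonelli1 _ _ _ _ R lebesgue2 leb).
  rewrite -i2 -ge0_integralZr //; apply: eq_integral => q _.
  by rewrite -ge0_integralZl.
have f3E p : (expR (- (l * l1 (vec3 p))))%:E = f3 p.
  rewrite /f3 /f2 /e -!EFinM -!expRD /l1 vec3_0 vec3_1 vec3_2.
  by congr (EFin (expR _)); ring.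
apply: (@le_trans _ _ (\int[mu3]_p f3 p)%E); last first.
  rewrite i3 (_ : 8 / l ^+ 3 = (2 / l) * (2 / l) * (2 / l)); last first.
    by field; rewrite gt_eqF.
  by rewrite !EFinM; apply: lee_pmul => //; [exact: mule_ge0|apply: lee_pmul].
have mS : measurable_fun setT (shift3 (- x)) by exact: measurable_shift3.
have -> : (\int[mu3]_p f3 p = \int[pushforward mu3 (shift3 (- x))]_p f3 p)%E.
  by apply: eq_measure_integral => A mA _; apply/esym/lebesgue3_shift.
rewrite ge0_integral_pushforward //.
by rewrite le_eqVlt; apply/orP; left; apply/eqP/eq_integral => p _ /=; rewrite -f3E vec3_shift3.
Qed.



End ExponentialIntegral.

Lemma ord3_12 : 1 + 2%:R = 0 :> 'I_3. Proof. by apply/eqP. Qed.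
Lemma ord3_11 : 1 + 1 = 2%:R :> 'I_3. Proof. by apply/eqP. Qed.
Lemma ord3_21 : 2%:R + 1 = 0 :> 'I_3. Proof. by apply/eqP. Qed.
Lemma ord3_22 : 2%:R + 2%:R = 1 :> 'I_3. Proof. by apply/eqP. Qed.

(** * Vector algebra in R^3 *)

Section Vec.
Context {R : realType}.
Implicit Types u v x y : 'rV[R]_3.

Lemma dotE u v : dot u v = u 0 0 * v 0 0 + u 0 1 * v 0 1 + u 0 2%:R * v 0 2%:R.
Proof. by rewrite /dot sum3E. Qed.

Lemma dotC u v : dot u v = dot v u.
Proof. by rewrite !dotE; ring. Qed.

Lemma dotDr u v x : dot u (v + x) = dot u v + dot u x.
Proof. by rewrite !dotE !mxE; ring. Qed.

Lemma dotDl u v x : dot (v + x) u = dot v u + dot x u.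
Proof. by rewrite !dotE !mxE; ring. Qed.

Lemma dotZr u v a : dot u (a *: v) = a * dot u v.
Proof. by rewrite !dotE !mxE; ring. Qed.

Lemma dotZl u v a : dot (a *: v) u = a * dot v u.
Proof. by rewrite !dotE !mxE; ring. Qed.

Lemma dotNr u v : dot u (- v) = - dot u v.
Proof. by rewrite !dotE !mxE; ring. Qed.

Lemma dotNl u v : dot (- v) u = - dot v u.
Proof. by rewrite !dotE !mxE; ring. Qed.

Lemma dot0r u : dot u 0 = 0. Proof. by rewrite !dotE !mxE; ring. Qed.

Lemma dot0l u : dot 0 u = 0. Proof. by rewrite !dotE !mxE; ring. Qed.

Lemma dot_sumr (I : Type) (r : seq I) (P : pred I) (F : I -> 'rV[R]_3) u :
  dot u (\sum_(i <- r | P i) F i) = \sum_(i <- r | P i) dot u (F i).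
Proof. by apply: big_morph; [exact: dotDr|exact: dot0r]. Qed.

Lemma dot_ge0 u : 0 <= dot u u.
Proof. by rewrite dotE -!expr2 !addr_ge0 ?sqr_ge0. Qed.

Lemma dot_eq0 u : dot u u = 0 -> u = 0.
Proof.
move=> /eqP; rewrite /dot psumr_eq0 => [/allP u0|k _]; last by rewrite -expr2 sqr_ge0.
apply/rowP => k; have := u0 k (mem_index_enum k).
by rewrite -expr2 sqrf_eq0 mxE => /eqP.
Qed.

Definition cross u v : 'rV[R]_3 :=
  \row_k (u 0 (k + 1) * v 0 (k + 2%:R) - u 0 (k + 2%:R) * v 0 (k + 1)).

Lemma cross0 u v : cross u v 0 0 = u 0 1 * v 0 2%:R - u 0 2%:R * v 0 1.
Proof. by rewrite mxE !add0r. Qed.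

Lemma cross1 u v : cross u v 0 1 = u 0 2%:R * v 0 0 - u 0 0 * v 0 2%:R.
Proof. by rewrite mxE ord3_12 ord3_11. Qed.

Lemma cross2 u v : cross u v 0 2%:R = u 0 0 * v 0 1 - u 0 1 * v 0 0.
Proof. by rewrite mxE ord3_21 ord3_22. Qed.

Lemma dot_cross u v : dot (cross u v) (cross u v) = dot u u * dot v v - dot u v ^+ 2.
Proof. by rewrite !dotE cross0 cross1 cross2; ring. Qed.

Lemma dot_crossl u v : dot u (cross u v) = 0.
Proof. by rewrite !dotE cross0 cross1 cross2; ring. Qed.

Lemma dot_crossr u v : dot v (cross u v) = 0.
Proof. by rewrite !dotE cross0 cross1 cross2; ring. Qed.

(** Cauchy-Schwarz, from Lagrange's identity [dot_cross] and the nonnegativity of a squared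
    length. *)
Lemma dot_le_enorm u v : dot u v <= enorm u * enorm v.
Proof.
apply: le_trans (ler_norm _) _.
rewrite -sqrtr_sqr /enorm -sqrtrM ?dot_ge0 // ler_wsqrtr // -subr_ge0.
by rewrite -dot_cross dot_ge0.
Qed.

Lemma sqr_enorm u : enorm u ^+ 2 = dot u u.
Proof. by rewrite sqr_sqrtr // dot_ge0. Qed.

Lemma enorm_ge0 u : 0 <= enorm u. Proof. exact: sqrtr_ge0. Qed.

Lemma l1_ge0 u : 0 <= l1 u. Proof. by rewrite !addr_ge0. Qed.

Lemma l1D u v : l1 (u + v) <= l1 u + l1 v.
Proof.
rewrite /l1 !mxE.
have := ler_normD (u 0 0) (v 0 0); have := ler_normD (u 0 1) (v 0 1).
have := ler_normD (u 0 2%:R) (v 0 2%:R); lra.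
Qed.

Lemma l1Z a u : l1 (a *: u) = `|a| * l1 u.
Proof. by rewrite /l1 !mxE !normrM !mulrDr. Qed.

Lemma l1_0 : l1 (0 : 'rV[R]_3) = 0.
Proof. by rewrite /l1 !mxE normr0 !addr0. Qed.

Lemma abs_coord_le_l1 u k : `|u 0 k| <= l1 u.
Proof.
rewrite /l1; have := normr_ge0 (u 0 0); have := normr_ge0 (u 0 1).
have := normr_ge0 (u 0 2%:R); by move: k; apply: ord3P; lra.
Qed.

Lemma abs_dot_le_l1 u v : `|dot u v| <= l1 u * l1 v.
Proof.
rewrite dotE; apply: le_trans (ler_normD _ _) _.
have H k : `|u 0 k * v 0 k| <= `|u 0 k| * l1 v.
  by rewrite normrM ler_wpM2l // abs_coord_le_l1.
have := ler_normD (u 0 0 * v 0 0) (u 0 1 * v 0 1).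
have := H 0; have := H 1; have := H 2%:R.
by rewrite [l1 u]/l1 !mulrDl; lra.
Qed.

Lemma enorm_le_l1 u : enorm u <= l1 u.
Proof.
rewrite -(@ler_pXn2r _ 2) ?nnegrE ?enorm_ge0 ?l1_ge0 // sqr_enorm expr2.
exact: le_trans (ler_norm _) (abs_dot_le_l1 u u).
Qed.

Lemma dot_continuous u : continuous (dot u).
Proof.
have H k : continuous (fun v : 'rV[R]_3 => u 0 k * v 0 k).
  by move=> v; apply: continuousM; [exact: cst_continuous|exact: coord_continuous].
rewrite (_ : dot u = fun v => u 0 0 * v 0 0 + u 0 1 * v 0 1 + u 0 2%:R * v 0 2%:R).
  by move=> v; exact: (cvgD (cvgD (H 0 v) (H 1 v)) (H 2%:R v)).
by apply/funext => v; rewrite dotE.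
Qed.

(** The matrix with rows a, c /\ a, c is a right inverse of its transpose, hence also a left
    inverse, and the latter is the expansion. *)
Lemma orthonormal_frame (a c v : 'rV[R]_3) : dot a a = 1 -> dot c c = 1 -> dot a c = 0 ->
  v = dot a v *: a + dot (cross c a) v *: cross c a + dot c v *: c.
Proof.
move=> aa cc ac; set b := cross c a.
have bb : dot b b = 1 by rewrite dot_cross aa cc dotC ac; ring.
have ba : dot b a = 0 by rewrite dotC dot_crossr.
have bc : dot b c = 0 by rewrite dotC dot_crossl.
pose F (k : 'I_3) := [:: a; b; c]`_k.
pose Q : 'M[R]_3 := \matrix_k F k.
have QQ : Q *m Q^T = 1%:M.
  apply/matrixP => i j; rewrite !mxE.
  transitivity (dot (F i) (F j)).
    by apply: eq_bigr => k _; rewrite !mxE.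
  move: i j; apply: ord3P; apply: ord3P; rewrite /F /= ?aa ?bb ?cc ?ba ?bc ?ac //=.
  - by rewrite dotC ba.
  - by rewrite dotC ac.
  - by rewrite dotC bc.
have QTQ := mulmx1C QQ.
rewrite -{1}[v]mulmx1 -QTQ mulmxA.
have E : v *m Q^T = \row_k dot (F k) v.
  apply/rowP => k; rewrite !mxE dotC; apply: eq_bigr => l _; by rewrite !mxE.
rewrite E mulmx_sum_row sum3E !mxE !rowK /F /=.
by [].
Qed.

End Vec.

(** * Edge frames of a polyhedral cone *)

Section Farkas.
Context {R : realType}.

(* Bartl's induction on the number of generators. *)
Lemma farkas (I : eqType) (s : seq I) (v : I -> 'rV[R]_3) (g : 'rV[R]_3) :
  uniq s ->
  (forall x, (forall i, i \in s -> dot (v i) x <= 0) -> dot g x <= 0) ->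
  exists2 c : I -> R, (forall i, 0 <= c i) & g = \sum_(i <- s) c i *: v i.
Proof.
elim: s v g => [|i s IHs] v g /=.
  move=> _ /(_ g) H; exists (fun=> 0) => //; rewrite big_nil.
  by apply: dot_eq0; apply/eqP; rewrite eq_le dot_ge0 andbT; apply: H.
move=> /andP[nis us] H.
have [H'|/existsNP[x /not_implyP[sx /negP]]] :=
    pselect (forall x, (forall i, i \in s -> dot (v i) x <= 0) -> dot g x <= 0).
  have [c c0 gE] := IHs v g us H'.
  exists (fun j => if j == i then 0 else c j) => [j|]; first by case: ifP.
  rewrite big_cons eqxx scale0r add0r gE !big_seq; apply: eq_bigr => j js.
  by case: eqP => // ji; rewrite -ji js in nis.
rewrite -ltNge => gx.
have vx : 0 < dot (v i) x.
  rewrite ltNge; apply/negP => vx; move: gx; rewrite ltNge H // => j.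
  by rewrite inE => /orP[/eqP->|/sx].
(* With [v i] pairing to 1 with [x'], subtracting multiples of [v i] makes the other generators and
   [g] orthogonal to [x']. The induction hypothesis applies to them, and the signs on [x'] make the
   coefficient of [v i] nonnegative. *)
pose x' := (dot (v i) x)^-1 *: x.
have vx' : dot (v i) x' = 1 by rewrite dotZr mulVf // gt_eqF.
have sx' j : j \in s -> dot (v j) x' <= 0.
  by move=> /sx ?; rewrite dotZr mulr_ge0_le0 // invr_ge0 ltW.
have gx' : 0 < dot g x' by rewrite dotZr mulr_gt0 // invr_gt0.
pose v' j := v j - dot (v j) x' *: v i.
have [||c c0 gE] := IHs v' (g - dot g x' *: v i) => //.
  move=> y ys; have := H (y - dot (v i) y *: x').
  rewrite [dot g _]dotDr dotNr dotZr dotDl dotNl dotZl => h.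
  suff : dot g y - dot (v i) y * dot g x' <= 0 by lra.
  apply: h => j; rewrite dotDr dotNr dotZr inE => /orP[/eqP->|js].
    by rewrite vx' mulr1 subrr.
  by have := ys _ js; rewrite /v' dotDl dotNl dotZl mulrC.
exists (fun j => if j == i then dot g x' - \sum_(j <- s) c j * dot (v j) x' else c j).
  move=> j; case: ifP => // _; rewrite subr_ge0.
  apply: le_trans (ltW gx'); rewrite big_seq; apply: sumr_le0 => k ks.
  by rewrite mulr_ge0_le0 // sx'.
rewrite big_cons eqxx -[LHS](subrK (dot g x' *: v i)) gE.
rewrite scalerBl addrC -addrA; congr (_ + _).
rewrite addrC scaler_suml -sumrB !big_seq; apply: eq_bigr => j js.
rewrite ifF; last by apply/eqP => ji; rewrite -ji js in nis.
by rewrite /v' scalerBr scalerA.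
Qed.

End Farkas.

Section Small.
Context {R : realType}.

Lemma lin_limit_ge0 (a b : R) : (forall e, 0 < e -> 0 <= a + e * b) -> 0 <= a.
Proof.
move=> H; rewrite leNgt; apply/negP => a0.
have b1 : 0 < `|b| + 1 by rewrite ltr_wpDl.
have := H (- a / 2 / (`|b| + 1)); rewrite !divr_gt0 ?oppr_gt0 // => /(_ isT).
have : - a / 2 / (`|b| + 1) * b <= - a / 2.
  rewrite -mulrA ger_pMr ?divr_gt0 ?oppr_gt0 // mulrC ler_pdivrMr // mul1r.
  by have := ler_norm b; lra.
lra.
Qed.

Lemma small_pos (a b : R) : 0 < a -> exists2 e0, 0 < e0 &
  forall e, 0 < e <= e0 -> 0 < a - e * b.
Proof.
move=> a0; have b1 : 0 < `|b| + 1 by rewrite ltr_wpDl.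
exists (a / 2 / (`|b| + 1)); first by rewrite !divr_gt0.
move=> e /andP[e0]; rewrite ler_pdivlMr // => He.
have : e * b <= e * (`|b| + 1) by rewrite ler_pM2l //; have := ler_norm b; lra.
lra.
Qed.

Lemma fin_lower_bound (I : finType) (P : pred I) (f : I -> R) :
  (forall i, P i -> 0 < f i) -> exists2 e, 0 < e & forall i, P i -> e <= f i.
Proof.
(* The default 1 keeps the bound positive when no index satisfies [P]. *)
move=> f0; exists (\big[Order.min/1]_(i | P i) f i).
  by elim/big_ind : _ => // x y x0 y0; rewrite lt_min x0.
by move=> i Pi; exact: bigmin_le_cond.
Qed.

End Small.

Section Edge.
Context {R : realType}.
Implicit Types u v x y : 'rV[R]_3.

(* [a0] exposes the edge [w1] of the cone [K], [w2] and [w3] are the edges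
   adjacent to [w1], and [n1], [n2], [n3] is the basis dual to [w1], [w2], [w3]. *)
Record edge_frame (K : set 'rV[R]_3) (a0 w1 w2 w3 n1 n2 n3 : 'rV[R]_3)
    (eta0 delta : R) : Prop := EdgeFrame {
  ef_a0 : dot a0 a0 = 1;
  ef_w1 : dot w1 w1 = 1;
  ef_a0w1 : dot a0 w1 = 0;
  ef_span : forall v, v = dot n1 v *: w1 + dot n2 v *: w2 + dot n3 v *: w3;
  ef_dual : forall a b c, let v := a *: w1 + b *: w2 + c *: w3 in
    [/\ dot n1 v = a, dot n2 v = b & dot n3 v = c];
  ef_sub : forall y, 0 < dot n1 y -> 0 < dot n2 y -> 0 < dot n3 y -> K y;
  ef_pos : forall y, K y -> 0 < dot n2 y /\ 0 < dot n3 y;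
  ef_eta0 : 0 < eta0;
  ef_delta : 0 < delta;
  ef_out : forall eta y, 0 < eta < eta0 -> K y -> dot n1 y <= 0 ->
    dot (a0 - eta *: w1) y <= - (delta * l1 y);
  ef_in : forall eta, 0 < eta < eta0 -> exists2 d, 0 < d & forall y, K y ->
    dot (a0 - eta *: w1) y <= - (d * l1 y);
  ef_neg : forall eta, 0 < eta < eta0 ->
    dot (a0 - eta *: w1) w2 < 0 /\ dot (a0 - eta *: w1) w3 < 0;
  ef_open : open K }.

Context (n : nat) (w : 'I_n -> 'rV[R]_3) (x0 : 'rV[R]_3).

Definition cone0 : set 'rV[R]_3 :=
  [set y | exists2 c : 'I_n -> R, (forall j, 0 < c j) & y = \sum_j c j *: w j].

Lemma open_coneE x : open_cone predT w x0 x <-> cone0 (x - x0).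
Proof.
split=> [[c c0 ->]|[c c0 xE]]; exists c => //.
- by move=> j; exact: c0.
- by rewrite addrC addKr.
- by rewrite -xE addrC subrK.
Qed.

Hypothesis cp : convex_polyhedral_cone w x0.

Lemma n_ge3 : (3 <= n)%N. Proof. by case: cp. Qed.

Lemma unit_edge j : dot (w j) (w j) = 1.
Proof. by case: cp => _ H _ _ _; rewrite -sqr_enorm H expr1n. Qed.

(** The axis of the enclosing spherical cone works, as half of its opening angle is less than a
    right angle. An edge only bounds the open cone, so the inclusion is used at [w j + e *: S] and
    [e] tends to 0. *)
Lemma exists_pos_direction : exists d, forall j, 0 < dot d (w j).
Proof.
case: cp => _ _ _ [_ [d [b [d1 /andP[b0 bpi] Kd]]]] _.
have k0 : 0 < cos (b / 2).
  by apply: cos_gt0_pihalf; apply/andP; split; have := pi_gt0 R; lra.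
exists d => j; apply: (@lt_le_trans _ _ (cos (b / 2))) => //.
rewrite -subr_ge0.
pose S := \sum_i w i.
apply: (@lin_limit_ge0 _ _ (dot d S - cos (b / 2) * dot S (w j))) => e e0.
have : open_cone predT w x0 (x0 + (w j + e *: S)).
  apply/open_coneE; rewrite addrC addKr.
  exists (fun i => (i == j)%:R + e) => [i|]; first by rewrite ltr_wpDl.
  transitivity (\sum_i ((i == j)%:R *: w i + e *: w i)).
    rewrite big_split /= -scaler_sumr (bigD1 j) //= eqxx scale1r big1 ?addr0 //.
    by move=> i /negPf ->; rewrite scale0r.
  by apply: eq_bigr => i _; rewrite scalerDl.
move=> /Kd; rewrite /spherical_cone /= addrC addKr.
rewrite dotC !dotDr !dotZr => H.
(* Cauchy-Schwarz bounds the norm from below by a function affine in [e], the form that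
   [lin_limit_ge0] requires. *)
have := dot_le_enorm (w j + e *: S) (w j).
rewrite [enorm (w j)](_ : _ = 1); last by rewrite /enorm unit_edge sqrtr1.
rewrite mulr1 dotDl dotZl unit_edge => H'.
have : (1 + e * dot S (w j)) * cos (b / 2) <= enorm (w j + e *: S) * cos (b / 2).
  by rewrite ler_pM2r.
lra.
Qed.

Lemma independent (j k l : 'I_n) (a b c : R) : j != k -> j != l -> k != l ->
  a *: w j + b *: w k + c *: w l = 0 -> [/\ a = 0, b = 0 & c = 0].
Proof.
move=> jk jl kl E.
case: cp => _ _ H _ _.
pose s' (i : 'I_3) := nth j [:: j; k; l] i.
have s'i : injective s'.
  move=> x y; rewrite /s'; move: x y; apply: ord3P; apply: ord3P => //= E';
    by move: jk jl kl; rewrite E' ?eqxx.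
have /row_free_inj inj := H s' s'i.
pose r : 'rV[R]_3 := \row_i nth 0 [:: a; b; c] i.
have : r *m \matrix_i w (s' i) = 0 *m \matrix_i w (s' i).
  rewrite mul0mx mulmx_sum_row sum3E !mxE !rowK /s' /=.
  by rewrite -[RHS]E.
move=> /inj /rowP rE.
by split; [have := rE 0|have := rE 1|have := rE 2%:R]; rewrite !mxE.
Qed.

(** If no vector separated [w j] from the other edges, Farkas would make [w j] a nonnegative
    combination of them, hence redundant. A separating vector is then corrected along [d], which is
    positive on all edges, until it is orthogonal to [w j]; this only lowers its values on the
    others. *)
Lemma exposed j : exists2 a, dot a a = 1 &
  dot a (w j) = 0 /\ forall i, i != j -> dot a (w i) < 0.
Proof.
have [d d0] := exists_pos_direction.
have [x sx jx] : exists2 x, (forall i, i != j -> dot (w i) x <= 0) & 0 < dot (w j) x.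
  apply: contrapT => /forall2NP H.
  have [||c c0 wj] := @farkas R _ (enum (predC1 j)) w (w j).
  - exact: enum_uniq.
  - move=> x sx; have [H'|/negP] := H x; last by rewrite -leNgt.
    by exfalso; apply: H' => i ij; apply: sx; rewrite mem_enum.
  case: cp => _ _ _ _ /(_ j); apply; apply/seteqP; split=> y [b b0 ->].
    (* The full open cone needs a positive coefficient at [w j]: a small multiple [e] of the
       relation for [w j] is traded against the other coefficients, which have to stay positive. *)
    have [e e0 He] : exists2 e, 0 < e & forall i, i != j -> 0 < b i - e * c i.
      have [e1 e10 He1] := @fin_lower_bound R _ (predC1 j) b b0.
      have [e2 e20 He2] := @fin_lower_bound R _ predT (fun i => (c i + 1)^-1)
        (fun i _ => ltac:(by rewrite invr_gt0 ltr_wpDl)).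
      exists (e1 * e2) => [|i ij]; first exact: mulr_gt0.
      rewrite subr_gt0; apply: lt_le_trans (He1 i ij).
      rewrite -mulrA gtr_pMr //.
      have c1 : 0 < c i + 1 by rewrite ltr_wpDl.
      apply: (@le_lt_trans _ _ ((c i + 1)^-1 * c i)).
        by rewrite ler_wpM2r // He2.
      by rewrite mulrC ltr_pdivrMr // mul1r ltrDl.
    exists (fun i => if i == j then e else b i - e * c i) => [i _|].
      by case: eqP => // /eqP; exact: He.
    congr (_ + _); rewrite [RHS](bigD1 j) //= eqxx {1}wj scaler_sumr big_enum /=.
    rewrite -big_split /=; apply: eq_bigr => i /negPf ->.
    by rewrite scalerA -scalerDl addrC subrK.
  exists (fun i => b i + b j * c i) => [i _|].
    by rewrite ltr_wpDr ?b0 // mulr_ge0 // ltW // b0.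
  congr (_ + _); rewrite [LHS](bigD1 j) //= {1}wj scaler_sumr big_enum /=.
  rewrite -big_split /=; apply: eq_bigr => i _.
  by rewrite scalerA -scalerDl addrC.
pose a := x - (dot (w j) x / dot d (w j)) *: d.
have aj : dot a (w j) = 0.
  by rewrite dotDl dotNl dotZl mulfVK ?gt_eqF // dotC subrr.
have ai i : i != j -> dot a (w i) < 0.
  move=> /sx xi; rewrite dotDl dotNl dotZl dotC.
  have : 0 < dot (w j) x / dot d (w j) * dot d (w i).
    by apply: mulr_gt0 => //; exact: divr_gt0.
  lra.
have n3 := n_ge3.
have [i ij] : exists i, i != j.
  have i0 : (0 < n)%N by apply: leq_trans n3.
  have i1 : (1 < n)%N by apply: leq_trans n3.
  have [E|] := eqVneq (Ordinal i0) j; last by exists (Ordinal i0).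
  by exists (Ordinal i1); rewrite -E.
have aa : 0 < dot a a.
  rewrite lt_neqAle dot_ge0 andbT eq_sym; apply/eqP => /dot_eq0 a0.
  by have := ai _ ij; rewrite a0 dot0l ltxx.
have ea : 0 < enorm a by rewrite sqrtr_gt0.
exists ((enorm a)^-1 *: a).
  by rewrite dotZl dotZr -sqr_enorm; field; rewrite gt_eqF.
split=> [|k kj]; first by rewrite dotZl aj mulr0.
by rewrite dotZl pmulr_rlt0 ?invr_gt0 // ai.
Qed.

End Edge.

Section EdgeExists.
Context {R : realType} (n : nat) (w : 'I_n -> 'rV[R]_3) (x0 : 'rV[R]_3).
Hypothesis cp : convex_polyhedral_cone w x0.
Implicit Types u v x y : 'rV[R]_3.

Section FromAdjacent.
Variables (j1 j2 j3 : 'I_n) (a0 n1 n2 n3 : 'rV[R]_3).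
Hypothesis aa : dot a0 a0 = 1.
Hypothesis aj1 : dot a0 (w j1) = 0.
Hypothesis aneg : forall i, i != j1 -> dot a0 (w i) < 0.
Hypothesis j21 : j2 != j1.
Hypothesis j31 : j3 != j1.
Hypothesis span : forall v,
  v = dot n1 v *: w j1 + dot n2 v *: w j2 + dot n3 v *: w j3.
Hypothesis dual : forall a b c, let v := a *: w j1 + b *: w j2 + c *: w j3 in
    [/\ dot n1 v = a, dot n2 v = b & dot n3 v = c].
Hypothesis n2w : forall i, i != j1 -> 0 <= dot n2 (w i).
Hypothesis n3w : forall i, i != j1 -> 0 <= dot n3 (w i).

(** A displacement is absorbed by the three frame edges alone. This yields both the inclusion of the
    simplicial cone and the openness of the whole cone. *)
Lemma sum_change (c : 'I_n -> R) (z : 'rV[R]_3) :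
  \sum_j c j *: w j + z =
  \sum_j (c j + (j == j1)%:R * dot n1 z + (j == j2)%:R * dot n2 z +
          (j == j3)%:R * dot n3 z) *: w j.
Proof.
have S k (a : R) : \sum_j ((j == k)%:R * a) *: w j = a *: w k.
  rewrite (bigD1 k) //= eqxx mul1r big1 ?addr0 // => i /negPf ->.
  by rewrite mul0r scale0r.
under [RHS]eq_bigr do rewrite !scalerDl.
by rewrite !big_split /= !S -!addrA; congr (_ + _); rewrite addrA -span.
Qed.

(** What matters is that [delta] does not depend on the tilt. Where [dot n1 y <= 0], the coefficient
    along [w j1] is controlled by the other ones, on which [a0] is strictly negative; so [a0] itself
    already decays there, and a small tilt costs at most half of the rate. *)
Lemma frame_of_adjacent : exists eta0 delta,
  edge_frame (cone0 w) a0 (w j1) (w j2) (w j3) n1 n2 n3 eta0 delta.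
Proof.
have [d1 d10 Hd1] := @fin_lower_bound R _ (predC1 j1) (fun i => - dot a0 (w i))
  (fun i ij => ltac:(by rewrite oppr_gt0; exact: aneg)).
pose L := 1 + \sum_i l1 (w i).
have Lw i : l1 (w i) <= L.
  rewrite /L (bigD1 i) //= addrA addrAC lerDr addr_ge0 // sumr_ge0 // => k _.
  exact: l1_ge0.
have L0 : 0 < L by rewrite ltr_wpDr // sumr_ge0 // => k _; exact: l1_ge0.
pose W := L * L.
have wW i : `|dot (w j1) (w i)| <= W.
  apply: le_trans (abs_dot_le_l1 _ _) _.
  by rewrite ler_pM ?l1_ge0.
have W0 : 0 < W by rewrite mulr_gt0.
pose M := \sum_i `|dot n1 (w i)|.
have Mn i : `|dot n1 (w i)| <= M.
  by rewrite /M (bigD1 i) //= lerDl sumr_ge0.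
have M0 : 0 <= M by rewrite sumr_ge0.
have l1sum (c : 'I_n -> R) : (forall i, 0 < c i) ->
    l1 (\sum_i c i *: w i) <= L * \sum_i c i.
  move=> c0; rewrite mulr_sumr; elim/big_ind2 : _ => [|x1 x2 y1 y2 h1 h2|i _].
  - by rewrite l1_0.
  - exact: le_trans (l1D _ _) (lerD h1 h2).
  - by rewrite l1Z gtr0_norm // mulrC ler_wpM2r // ltW.
(* With [S'] the sum of the coefficients off [w j1]: [dot a0 y] is at most [- d1 * S'], while [l1 y]
   is at most [L * (1 + M) * S']. *)
pose delta0 := d1 / (L * (1 + M)).
have LM0 : 0 < L * (1 + M) by rewrite mulr_gt0 // ltr_wpDr.
have delta00 : 0 < delta0 by rewrite divr_gt0.
have out0 y : cone0 w y -> dot n1 y <= 0 -> dot a0 y <= - (delta0 * l1 y).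
  move=> [c c0 ->]; set S' := \sum_(i | i != j1) c i.
  have S'0 : 0 <= S' by rewrite sumr_ge0 // => i _; rewrite ltW.
  have sumc : \sum_i c i = c j1 + S' by rewrite (bigD1 j1).
  rewrite dot_sumr (bigD1 j1) //= dotZr.
  have -> : dot n1 (w j1) = 1.
    by have [] := dual 1 0 0; rewrite scale1r !scale0r !addr0.
  move=> h.
  have cj1 : c j1 <= M * S'.
    suff : - (M * S') <= \sum_(i | i != j1) dot n1 (c i *: w i) by lra.
    rewrite mulr_sumr -sumrN; apply: ler_sum => i _.
    rewrite dotZr [M * _]mulrC -mulrN (ler_pM2l (c0 i)).
    by have := Mn i; rewrite ler_norml => /andP[].
  have a0y : dot a0 (\sum_i c i *: w i) <= - (d1 * S').
    rewrite dot_sumr (bigD1 j1) //= dotZr aj1 mulr0 add0r mulr_sumr -sumrN.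
    apply: ler_sum => i ij; rewrite dotZr [d1 * _]mulrC -mulrN.
    by rewrite (ler_pM2l (c0 i)) lerNr Hd1.
  apply: le_trans a0y _; rewrite lerN2 /delta0 mulrAC ler_pdivrMr //.
  rewrite -mulrA ler_pM2l //; apply: le_trans (l1sum _ c0) _.
  by rewrite sumc mulrCA ler_pM2l // mulrDr mulr1; lra.
(* Below [eta1] the tilted direction keeps half of [d1] on every edge but [w j1]; below [eta2] it
   keeps half of [delta0] where [dot n1 y <= 0]. *)
pose eta1 := d1 / (2 * W); pose eta2 := delta0 / (2 * L).
have eta10 : 0 < eta1 by rewrite divr_gt0 // mulr_gt0.
have eta20 : 0 < eta2 by rewrite divr_gt0 // mulr_gt0.
have neg eta i : 0 < eta < Order.min eta1 eta2 -> i != j1 ->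
    dot (a0 - eta *: w j1) (w i) <= - (d1 / 2).
  rewrite lt_min => /andP[e0 /andP[e1 _]] ij.
  rewrite dotDl dotNl dotZl.
  have := Hd1 i ij => h1.
  have h2 : - (eta * dot (w j1) (w i)) <= eta * W.
    rewrite -mulrN ler_pM2l //.
    by have := wW i; rewrite ler_norml => /andP[]; lra.
  have h3 : eta * W <= d1 / 2.
    by move: e1; rewrite /eta1 ltr_pdivlMr ?mulr_gt0 //; lra.
  lra.
have neg1 eta : dot (a0 - eta *: w j1) (w j1) = - eta.
  by rewrite dotDl dotNl dotZl aj1 (unit_edge cp); ring.
exists (Order.min eta1 eta2), (delta0 / 2); split => //.
- exact: (unit_edge cp).
(* Membership requires positive coefficients on all edges, so [e *: S] is split off, with [e] small
   enough for the remainder to keep positive dual coordinates. *)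
- move=> y y1 y2 y3; pose S := \sum_i w i.
  have [f1 f10 Hf1] := small_pos (dot n1 S) y1.
  have [f2 f20 Hf2] := small_pos (dot n2 S) y2.
  have [f3 f30 Hf3] := small_pos (dot n3 S) y3.
  pose e := Order.min f1 (Order.min f2 f3).
  have e0 : 0 < e by rewrite !lt_min f10 f20 f30.
  have [e1 [e2 e3]] : e <= f1 /\ e <= f2 /\ e <= f3.
    by rewrite /e !ge_min !lexx !orbT.
  have yE : y = \sum_(i < n) e *: w i + (y - e *: S).
    by rewrite -scaler_sumr addrC subrK.
  rewrite yE sum_change; eexists; last by [].
  move=> i /=; rewrite !dotDr !dotNr !dotZr.
  have := Hf1 e; have := Hf2 e; have := Hf3 e.
  rewrite e0 e1 e2 e3 => /(_ isT) h3 /(_ isT) h2 /(_ isT) h1.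
  by rewrite -!addrA ltr_wpDr // !addr_ge0 // mulr_ge0 // ltW.
- have sumpos (k : 'rV[R]_3) (i0 : 'I_n) y : cone0 w y -> (forall i, 0 <= dot k (w i)) ->
     0 < dot k (w i0) -> 0 < dot k y.
    move=> [c c0 ->] k0 ki0; rewrite dot_sumr (bigD1 i0) //= dotZr.
    rewrite ltr_wpDr ?mulr_gt0 // sumr_ge0 // => i _.
    by rewrite dotZr mulr_ge0 // ltW.
  have [_ n21 n31] := dual 1 0 0; rewrite scale1r !scale0r !addr0 in n21 n31.
  have [_ n22 _] := dual 0 1 0; rewrite scale1r !scale0r add0r addr0 in n22.
  have [_ _ n33] := dual 0 0 1; rewrite scale1r !scale0r !add0r in n33.
  move=> y Ky; split.
    apply: (sumpos _ j2) => // [i|]; last by rewrite n22.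
    by have [->|ij] := eqVneq i j1; [rewrite n21|exact: n2w].
  apply: (sumpos _ j3) => // [i|]; last by rewrite n33.
  by have [->|ij] := eqVneq i j1; [rewrite n31|exact: n3w].
- by rewrite lt_min eta10.
- by rewrite divr_gt0.
- move=> eta y; rewrite lt_min => /andP[e0 /andP[_ e2]] Ky ny.
  have := out0 y Ky ny; rewrite dotDl dotNl dotZl => h1.
  have h2 : - (eta * dot (w j1) y) <= eta * (L * l1 y).
    rewrite -mulrN ler_pM2l //.
    have := abs_dot_le_l1 (w j1) y; rewrite ler_norml => /andP[h _].
    have : l1 (w j1) * l1 y <= L * l1 y by rewrite ler_wpM2r // l1_ge0.
    lra.
  have h3 : eta * (L * l1 y) <= delta0 / 2 * l1 y.
    rewrite mulrA ler_wpM2r ?l1_ge0 //.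
    by move: e2; rewrite /eta2 ltr_pdivlMr ?mulr_gt0 //; lra.
  lra.
- move=> eta He; have e0 : 0 < eta by case/andP: He.
  pose d' := Order.min eta (d1 / 2).
  have d'0 : 0 < d' by rewrite lt_min e0 divr_gt0.
  exists (d' / L) => [|y [c c0 ->]]; first exact: divr_gt0.
  apply: (@le_trans _ _ (- (d' * \sum_i c i))); last first.
    by rewrite lerN2 mulrAC ler_pdivrMr // -mulrA ler_pM2l // mulrC l1sum.
  rewrite dot_sumr mulr_sumr -sumrN; apply: ler_sum => i _.
  rewrite dotZr [d' * _]mulrC -mulrN (ler_pM2l (c0 i)).
  have [->|ij] := eqVneq i j1; first by rewrite neg1 lerN2 ge_min lexx.
  by apply: le_trans (neg _ _ He ij) _; rewrite lerN2 ge_min lexx orbT.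
- move=> eta He; have H i (ij : i != j1) : dot (a0 - eta *: w j1) (w i) < 0.
    by apply: le_lt_trans (neg _ _ He ij) _; rewrite oppr_lt0 divr_gt0.
  by split; exact: H.
rewrite openE => y [c c0 yE]; rewrite /interior.
have Hn k (b : R) : 0 < b -> \forall z \near y, - b < dot k (z - y).
  move=> b0.
  have : {for y, continuous (fun z : 'rV[R]_3 => dot k z - dot k y)}.
    by apply: continuousB; [exact: dot_continuous|exact: cst_continuous].
  move=> /cvgrPdist_lt /(_ b b0); apply: filterS => z.
  rewrite subrr sub0r normrN ltr_norml => /andP[h _].
  by rewrite dotDr dotNr.
(* The halves cover the case [j2 = j3] in the distinction below, where both displacements fall on
   one coefficient. *)
have := Hn n1 _ (c0 j1); have := Hn n2 (c j2 / 2) _; have := Hn n3 (c j3 / 2) _.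
move=> h3 h2 h1; near=> z.
have -> : z = \sum_i c i *: w i + (z - y) by rewrite -yE addrC subrK.
rewrite sum_change; eexists; last by [].
move=> i /=.
have z1 : - c j1 < dot n1 (z - y) by near: z.
have z2 : - (c j2 / 2) < dot n2 (z - y) by near: z; apply: h2; rewrite divr_gt0.
have z3 : - (c j3 / 2) < dot n3 (z - y) by near: z; apply: h3; rewrite divr_gt0.
have ci := c0 i.
have [i1|i1] := eqVneq i j1.
  by rewrite i1 ![j1 == _]eq_sym (negPf j21) (negPf j31) mul1r !mul0r; lra.
rewrite mul0r.
have [i2|i2] := eqVneq i j2; have [i3|i3] := eqVneq i j3;
  rewrite ?mul0r ?mul1r; rewrite -?i2 -?i3 in z2 z3; lra.
Unshelve. all: by end_near.
Qed.

End FromAdjacent.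
(** Projecting along [w1] to the plane of [a0] and [b] turns the other edges into planar vectors in
    an open half-plane, with slopes [m i]. The two edges adjacent to [w1] are those of extreme
    slope. Equal slopes would make two edges and [w1] dependent, so the extremes differ. *)
Lemma edge_frame_exists : exists a0 w1 w2 w3 n1 n2 n3 eta0 delta,
  edge_frame (cone0 w) a0 w1 w2 w3 n1 n2 n3 eta0 delta.
Proof.
have n3 := n_ge3 cp.
pose o k (kn : (k < 3)%N) : 'I_n := Ordinal (leq_trans kn n3).
pose j1 := o 0%N isT; pose k1 := o 1%N isT; pose k2 := o 2%N isT.
have k1j : k1 != j1 by []. have k2j : k2 != j1 by []. have k12 : k1 != k2 by [].
have [a0 aa [aj1 aneg]] := exposed cp j1.
pose w1 := w j1; have ww : dot w1 w1 = 1 := unit_edge cp j1.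
pose b := cross w1 a0.
have frame := orthonormal_frame _ aa ww aj1; rewrite -/b in frame.
have ba : dot b a0 = 0 by rewrite dotC dot_crossr.
have bw1 : dot b w1 = 0 by rewrite dotC dot_crossl.
pose p i := - dot a0 (w i); pose q i := dot b (w i); pose m i := q i / p i.
have p0 i : i != j1 -> 0 < p i by move=> /aneg; rewrite /p oppr_gt0.
have m_neq i k : i != j1 -> k != j1 -> i != k -> m i != m k.
  move=> ij kj ik; apply/negP => /eqP; rewrite /m => mE.
  have {}mE : p k * q i - p i * q k = 0.
    have pi0 := gt_eqF (p0 _ ij); have pk0 := gt_eqF (p0 _ kj).
    have -> : q i = q k / p k * p i by rewrite -mE divfK ?pi0.
    by field; rewrite pk0.
  pose u := p k *: w i - p i *: w k.
  have uE : u = dot w1 u *: w1.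
    rewrite [LHS]frame {1 2}/u !dotDr !dotNr !dotZr -/(q i) -/(q k) mE scale0r addr0.
    rewrite (_ : p k * _ - _ = 0) ?scale0r ?add0r //.
    by rewrite /p; ring.
  have [||||] := @independent R n w x0 cp i k j1 (p k) (- p i) (- dot w1 u) => //.
    by rewrite (scaleNr (p i)) (scaleNr (dot w1 u)); apply/eqP; rewrite subr_eq0; apply/eqP; exact: uE.
  by move=> pk0 _ _; have := p0 _ kj; rewrite pk0 ltxx.
have [j2 [j21 m2]] : exists j2, j2 != j1 /\ forall i, i != j1 -> m i <= m j2.
  pose j2 := [arg max_(i > k1 | i != j1) m i]%O.
  by exists j2; rewrite /j2; case: arg_maxP.
have [j3 [j31 m3]] : exists j3, j3 != j1 /\ forall i, i != j1 -> m j3 <= m i.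
  pose j3 := [arg min_(i < k1 | i != j1) m i]%O.
  by exists j3; rewrite /j3; case: arg_minP.
have m23 : m j3 < m j2.
  have := m_neq _ _ k1j k2j k12.
  have := m2 _ k1j; have := m2 _ k2j; have := m3 _ k1j; have := m3 _ k2j.
  by move=> h1 h2 h3 h4 /eqP h5; rewrite ltNge; apply/negP => h6; apply: h5; lra.
pose p2 := p j2; pose q2 := q j2; pose p3 := p j3; pose q3 := q j3.
have p20 : 0 < p2 by exact: p0. have p30 : 0 < p3 by exact: p0.
pose De := q2 * p3 - p2 * q3.
have De0 : 0 < De.
  move: m23; rewrite /m -/p2 -/p3 -/q2 -/q3 ltr_pdivrMr // mulrAC ltr_pdivlMr //.
  by rewrite /De; lra.
have Dn : De != 0 by rewrite gt_eqF.
(* Cramer's rule in that plane, with determinant [De]; [n1] then corrects [w1] for the components of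
   the adjacent edges along it. Nonnegativity of [n2] and [n3'] on all edges is the extremality of
   the slopes. *)
pose n2 := De^-1 *: (p3 *: b + q3 *: a0).
pose n3' := - De^-1 *: (p2 *: b + q2 *: a0).
pose n1 := w1 - dot w1 (w j2) *: n2 - dot w1 (w j3) *: n3'.
have dn2 v : dot n2 v = De^-1 * (p3 * dot b v + q3 * dot a0 v).
  by rewrite dotZl dotDl !dotZl.
have dn3 v : dot n3' v = - De^-1 * (p2 * dot b v + q2 * dot a0 v).
  by rewrite dotZl dotDl !dotZl.
have dn1 v : dot n1 v = dot w1 v - dot w1 (w j2) * dot n2 v - dot w1 (w j3) * dot n3' v.
  by rewrite !dotDl !dotNl !dotZl.
have a2 : dot a0 (w j2) = - p2 by rewrite /p2 /p opprK.
have a3 : dot a0 (w j3) = - p3 by rewrite /p3 /p opprK.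
have b2 : dot b (w j2) = q2 by []. have b3 : dot b (w j3) = q3 by [].
have sub i : i != j1 -> m i <= m j2 /\ m j3 <= m i by move=> ij; split; auto.
have [||||eta0 [delta F]] := @frame_of_adjacent j1 j2 j3 a0 n1 n2 n3' aa aj1 aneg j21 j31.
- move=> v; apply/eqP; rewrite -subr_eq0; apply/eqP.
  set u := v - _.
  have au : dot a0 u = 0.
    rewrite /u dotDr dotNr !dotDr !dotZr aj1 a2 a3 dn2 dn3.
    by rewrite /De; field.
  have bu : dot b u = 0.
    rewrite /u dotDr dotNr !dotDr !dotZr bw1 b2 b3 dn2 dn3.
    by rewrite /De; field.
  have wu : dot w1 u = 0.
    by rewrite /u dotDr dotNr !dotDr !dotZr -/w1 ww dn1; ring.
  by rewrite [LHS]frame au bu wu !scale0r !addr0.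
- move=> c1 c2 c3 v.
  have v2 : dot n2 v = c2.
    rewrite dn2 /v !dotDr !dotZr -/w1 bw1 aj1 a2 a3 b2 b3.
    by rewrite /De; field.
  have v3 : dot n3' v = c3.
    rewrite dn3 /v !dotDr !dotZr -/w1 bw1 aj1 a2 a3 b2 b3.
    by rewrite /De; field.
  split=> //; rewrite dn1 v2 v3 /v !dotDr !dotZr -/w1 ww; ring.
- move=> i ij; rewrite dn2; apply: mulr_ge0; first by rewrite invr_ge0 ltW.
  have [_] := sub i ij; rewrite /m ler_pdivrMr ?p0 // mulrAC ler_pdivlMr ?p0 //.
  have aE : dot a0 (w i) = - p i by rewrite /p opprK.
  by rewrite -/p3 -/q3 aE -/(q i); lra.
- move=> i ij; rewrite dn3 mulNr -mulrN; apply: mulr_ge0; first by rewrite invr_ge0 ltW.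
  have [+ _] := sub i ij; rewrite /m ler_pdivrMr ?p0 // mulrAC ler_pdivlMr ?p0 //.
  have aE : dot a0 (w i) = - p i by rewrite /p opprK.
  by rewrite -/p2 -/q2 aE -/(q i); lra.
by exists a0, w1, (w j2), (w j3), n1, n2, n3', eta0, delta.
Qed.

End EdgeExists.

(** * Smooth cut-off functions *)

Section Smooth1.
Context {R : realType}.

Lemma is_derive_conv (f g : R -> R) (x v df dg : R) :
  is_derive x v f df -> f =1 g -> df = dg -> is_derive x v g dg.
Proof. by move=> H /funext <- <-. Qed.

(* Membership in a class of functions closed under derivation: this gives
   derivatives of all orders without handling iterated derivatives. *)
Definition smooth1 (g : R -> R) := exists2 S : set (R -> R), S g &
  forall h, S h -> exists2 h', S h' & forall x : R, is_derive x (1 : R) h (h' x).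

Lemma smooth1_derive g : smooth1 g ->
  exists2 g', smooth1 g' & forall x : R, is_derive x (1 : R) g (g' x).
Proof.
by move=> [S Sg HS]; have [g' Sg' dg'] := HS _ Sg; exists g' => //; exists S.
Qed.

Lemma smooth1_expR : smooth1 expR.
Proof.
by exists [set expR] => // h ->; exists expR => // x; exact: is_derive_expR.
Qed.

Lemma smooth1_cos_sin : smooth1 cos /\ smooth1 sin.
Proof.
pose S : set (R -> R) := [set h | exists s : R * R, h = fun x => s.1 * cos x + s.2 * sin x].
have HS h : S h -> exists2 h', S h' & forall x : R, is_derive x (1 : R) h (h' x).
  move=> [[a b] ->]; exists (fun x => b * cos x + (- a) * sin x); first by exists (b, - a).
  move=> x /=.
  apply: (is_derive_conv (is_deriveD (is_deriveZ a (is_derive_cos x))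
    (is_deriveZ b (is_derive_sin x)))) => //.
  by rewrite /GRing.scale /=; ring.
split; exists S => //.
  by exists (1, 0); apply/funext => x /=; rewrite mul1r mul0r addr0.
by exists (0, 1); apply/funext => x /=; rewrite mul1r mul0r add0r.
Qed.

Lemma is_derive_sqr_bound (f : R -> R) (C : R) : f 0 = 0 ->
  (forall x, `|f x| <= C * x ^+ 2) -> is_derive (0 : R) (1 : R) f 0.
Proof.
move=> f0 fC.
have H : (fun h : R => h^-1 *: ((f \o shift (0 : R)) (h *: (1 : R)) - f 0)) @ (0 : R)^' --> (0 : R).
  apply/cvgrPdist_lt => e e0.
  have C1 : 0 < `|C| + 1 by rewrite ltr_wpDl.
  near=> h.
  have h0 : h != 0 by near: h; exact: nbhs_dnbhs_neq.
  rewrite sub0r normrN /= addr0 f0 subr0 /GRing.scale /= mulr1 normrM normfV.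
  rewrite mulrC ltr_pdivrMr ?normr_gt0 //.
  apply: le_lt_trans (fC h) _.
  rewrite -normr_gt0 in h0.
  have he : `|h| < e / (`|C| + 1).
    near: h; apply: dnbhs0_lt; exact: divr_gt0.
  rewrite ltr_pdivlMr // in he.
  rewrite -real_normK ?num_real // expr2 mulrA ltr_pM2r //.
  apply: le_lt_trans he; rewrite mulrC ler_wpM2l //.
  by have := ler_norm C; lra.
apply: DeriveDef; first by apply/cvg_ex; exists 0.
exact/cvg_lim.
Unshelve. all: by end_near. Qed.

(** The polynomial factor makes the family closed under differentiation, as [smooth1] demands;
    [p = 1] is the usual flat function exp(-1/x). *)
Definition flat (p : {poly R}) (x : R) : R :=
  if 0 < x then p.[x^-1] * expR (- x^-1) else 0.

(** For y = 1/x, the term of degree i+2 of the exponential series bounds y^i exp(-y) by (i+2)! x^2.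
    The two spare powers make the derivative at 0 vanish. *)
Lemma flat_bound p : exists C, forall x, `|flat p x| <= C * x ^+ 2.
Proof.
exists (\sum_(i < size p) `|p`_i| * (i.+2)`!%:R) => x; rewrite /flat.
have C0 : 0 <= \sum_(i < size p) `|p`_i| * (i.+2)`!%:R.
  by apply: sumr_ge0 => i _; rewrite mulr_ge0.
case: ifP => [x0|_]; last by rewrite normr0 mulr_ge0 // sqr_ge0.
rewrite horner_coef mulr_suml mulr_suml.
apply: le_trans (ler_norm_sum _ _ _) _; apply: ler_sum => i _.
have y0 : 0 < x^-1 by rewrite invr_gt0.
rewrite !normrM (gtr0_norm (expR_gt0 _)) normrX (gtr0_norm y0) -!mulrA.
rewrite ler_wpM2l // -ler_pdivrMr ?exprn_gt0 //.
rewrite -exprVn mulrAC -exprD addn2 expRN ler_pdivrMr ?expR_gt0 //.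
have := @expR_ge1Dxn R x^-1 i.+1 (ltW y0).
have f0 : (0 : R) < i.+2`!%:R by rewrite ltr0n fact_gt0.
move=> H; rewrite mulrC -ler_pdivrMr //; apply: le_trans H.
by rewrite lerDr.
Qed.

Lemma flat_derive (p : {poly R}) (x : R) :
  is_derive x (1 : R) (flat p) (flat ('X^2 * (p - p^`())) x).
Proof.
have [x0|x0|->] := ltrgt0P x.
- rewrite [flat _ x]/flat x0.
  have Dinv : is_derive x 1 (fun y : R => y^-1) (- x ^- 2).
    apply: (is_derive_conv (is_deriveV (lt0r_neq0 x0) (is_derive_id x 1))) => //.
    by rewrite /GRing.scale /= mulr1.
  apply: (@near_eq_is_derive _ _ _ (fun y : R => p.[y^-1] * expR (- y^-1))).
    by near=> y; rewrite /flat ifT //; near: y; exact: lt_nbhsr.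
  have D1 : is_derive x (1 : R) (horner p \o (fun y : R => y^-1)) (p^`().[x^-1] * (- x ^- 2)).
    by apply: is_derive1_comp; exact: is_derive_poly.
  have D2 : is_derive x (1 : R) (expR \o (fun y : R => - y^-1)) (expR (- x^-1) * (x ^- 2)).
    apply: is_derive1_comp.
    by apply: (is_derive_conv (is_deriveN Dinv)) => //; rewrite opprK.
  apply: (is_derive_conv (is_deriveM D1 D2)) => //.
  rewrite /GRing.scale /= !hornerE /= -exprVn; ring.
- rewrite [flat _ x]/flat ltNge (ltW x0) /=.
  apply: (@near_eq_is_derive _ _ _ (cst 0)).
  near=> y; rewrite /flat ifF //; apply/negP/negP; rewrite -leNgt ltW //.
  by near: y; exact: lt_nbhsl.
- have [C HC] := flat_bound p.
  rewrite [flat _ 0]/flat ltxx; apply: is_derive_sqr_bound HC.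
  by rewrite /flat ltxx.
Unshelve. all: by end_near. Qed.

Lemma smooth1_flat p : smooth1 (flat p).
Proof.
exists [set h | exists p, h = flat p]; first by exists p.
move=> _ [q ->]; exists (flat ('X^2 * (q - q^`()))); first by eexists.
exact: flat_derive.
Qed.

Definition flat1 : R -> R := flat 1.

Lemma flat1_ge0 x : 0 <= flat1 x.
Proof. by rewrite /flat1 /flat; case: ifP => // _; rewrite hornerC mul1r expR_ge0. Qed.

Lemma flat1_gt0 x : 0 < x -> 0 < flat1 x.
Proof. by move=> x0; rewrite /flat1 /flat x0 hornerC mul1r expR_gt0. Qed.

Lemma flat1_0 x : x <= 0 -> flat1 x = 0.
Proof. by move=> x0; rewrite /flat1 /flat ltNge x0. Qed.

Lemma flat1_le x y : x <= y -> flat1 x <= flat1 y.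
Proof.
move=> xy; have [x0|x0] := leP x 0; first by rewrite flat1_0 // flat1_ge0.
have y0 : 0 < y by exact: lt_le_trans xy.
rewrite /flat1 /flat x0 y0 !hornerC !mul1r ler_expR lerN2.
by rewrite lef_pV2 ?posrE.
Qed.

End Smooth1.

Section Smooth3.
Context {R : realType}.
Implicit Types (f g : 'rV[R]_3 -> R).

(** A formal class stable under [partial] and consisting of differentiable functions, so that one
    induction settles all the conditions in [smooth]. *)
Inductive elementary : ('rV[R]_3 -> R) -> Prop :=
| elem_cst c : elementary (fun=> c)
| elem_coord k : elementary (fun x => x 0 k)
| elem_add f g : elementary f -> elementary g -> elementary (fun x => f x + g x)
| elem_mul f g : elementary f -> elementary g -> elementary (fun x => f x * g x)
| elem_comp h f : smooth1 h -> elementary f -> elementary (fun x => h (f x)).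

Lemma smooth1_differentiable (h : R -> R) x : smooth1 h -> differentiable h x.
Proof.
by move=> /smooth1_derive[h' _ /(_ x)[dh _]]; apply/derivable1_diffP.
Qed.

Lemma elementary_differentiable f x : elementary f -> differentiable f x.
Proof.
elim=> [c|k|{}f g _ df _ dg|{}f g _ df _ dg|h {}f sh _ df].
- exact: differentiable_cst.
- exact: differentiable_coord.
- exact: (@differentiableD _ _ _ f g).
- exact: (@differentiableM _ _ f g).
- exact: (@differentiable_comp _ _ _ _ f h x df (smooth1_differentiable _ sh)).
Qed.

Lemma partial_cst k c x : partial k (fun=> c : R) x = 0.
Proof. exact: derive_cst. Qed.

Lemma partial_coord k l x : partial k (fun x : 'rV[R]_3 => x 0 l) x = (k == l)%:R.
Proof.
rewrite /partial.
have -> : 'D_(delta_mx 0 k) (fun x : 'rV[R]_3 => x 0 l) x =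
          'd (fun x : 'rV[R]_3 => x 0 l) x (delta_mx 0 k).
  by apply: deriveE; exact: differentiable_coord.
have @F : {linear 'rV[R]_3 -> R}.
  by exists (fun N : 'rV[R]_3 => N 0 l); do 2![eexists]; do ?[constructor];
     rewrite ?mxE// => ? *; rewrite ?mxE//; move=> ?; rewrite !mxE.
have -> : 'd (fun x : 'rV[R]_3 => x 0 l) x = F :> ('rV[R]_3 -> R).
  by apply: (@diff_lin _ _ _ F); exact: coord_continuous.
by rewrite /F /= mxE eqxx eq_sym.
Qed.

Lemma partialD k f g x : differentiable f x -> differentiable g x ->
  partial k (fun x => f x + g x) x = partial k f x + partial k g x.
Proof.
move=> df dg; transitivity ('D_(delta_mx 0 k) (f + g) x); first by [].
by apply: deriveD; exact: diff_derivable.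
Qed.

Lemma partialM k f g x : differentiable f x -> differentiable g x ->
  partial k (fun x => f x * g x) x = partial k f x * g x + f x * partial k g x.
Proof.
move=> df dg; transitivity ('D_(delta_mx 0 k) (f * g) x); first by [].
rewrite deriveM; [|exact: diff_derivable|exact: diff_derivable].
by rewrite /GRing.scale /= addrC [g x * _]mulrC.
Qed.

Lemma partial_comp k (h : R -> R) f (a : R) x : is_derive (f x) (1 : R) h a ->
  differentiable f x -> partial k (fun x => h (f x)) x = a * partial k f x.
Proof.
move=> [/derivable1_diffP dh <-] df; rewrite /partial.
have -> : 'D_(delta_mx 0 k) (fun x => h (f x)) x = 'd (h \o f) x (delta_mx 0 k).
  by apply: deriveE; exact: differentiable_comp.
by rewrite diff_comp //= diff1E // derive1E -(deriveE _ df) [RHS]mulrC.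
Qed.

Lemma elementary_partial f k : elementary f -> elementary (partial k f).
Proof.
elim=> [c|l|{}f g ef IHf eg IHg|{}f g ef IHf eg IHg|h {}f sh ef IHf].
- rewrite (_ : partial k _ = fun=> 0); first exact: elem_cst.
  by apply/funext => x; rewrite partial_cst.
- rewrite (_ : partial k _ = fun=> (k == l)%:R); first exact: elem_cst.
  by apply/funext => x; rewrite partial_coord.
- rewrite (_ : partial k _ = fun x => partial k f x + partial k g x).
    exact: elem_add.
  by apply/funext => x; rewrite partialD //; exact: elementary_differentiable.
- rewrite (_ : partial k _ = fun x => partial k f x * g x + f x * partial k g x).
    by apply: elem_add; apply: elem_mul.
  by apply/funext => x; rewrite partialM //; exact: elementary_differentiable.
- have [h' sh' dh] := smooth1_derive sh.
  rewrite (_ : partial k _ = fun x => h' (f x) * partial k f x).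
    by apply: elem_mul => //; exact: elem_comp.
  apply/funext => x; rewrite (partial_comp _ (dh _)) //.
  exact: elementary_differentiable.
Qed.

Lemma elementary_continuous f : elementary f -> continuous f.
Proof. by move=> ef x; apply/differentiable_continuous/elementary_differentiable. Qed.

Lemma elementary_smooth f : elementary f -> smooth f.
Proof.
move=> ef s; have es : elementary (foldr (@partial R) f s).
  by elim: s => //= k s IHs; exact: elementary_partial.
split; first exact: elementary_continuous.
by move=> k x; apply/diff_derivable/elementary_differentiable.
Qed.


Lemma elementary_affine (a : 'rV[R]_3) c : elementary (fun x => dot a x + c).
Proof.
rewrite (_ : (fun x => _) = fun x : 'rV[R]_3 =>
  a 0 0 * x 0 0 + a 0 1 * x 0 1 + a 0 2%:R * x 0 2%:R + c).
  by do ![apply: elem_add | apply: elem_mul | exact: elem_cst | exact: elem_coord].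
by apply/funext => x; rewrite dotE.
Qed.

Lemma partial_affine (a : 'rV[R]_3) c k x : partial k (fun x => dot a x + c) x = a 0 k.
Proof.
have E : (fun x => dot a x + c) = fun x : 'rV[R]_3 =>
  a 0 0 * x 0 0 + a 0 1 * x 0 1 + a 0 2%:R * x 0 2%:R + c.
  by apply/funext => y; rewrite dotE.
have D f : elementary f -> differentiable f x by exact: elementary_differentiable.
rewrite E !(partialD, partialM, partial_cst, partial_coord); last first.
all: try by apply: D; do ![apply: elem_add | apply: elem_mul | exact: elem_cst | exact: elem_coord].
by move: k; apply: ord3P; rewrite /=; ring.
Qed.

Lemma elementary_sqr_dist (x0 : 'rV[R]_3) : elementary (fun x => dot (x - x0) (x - x0)).
Proof.
rewrite (_ : (fun x => _) = fun x : 'rV[R]_3 =>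
  (x 0 0 + - x0 0 0) * (x 0 0 + - x0 0 0) + (x 0 1 + - x0 0 1) * (x 0 1 + - x0 0 1) +
  (x 0 2%:R + - x0 0 2%:R) * (x 0 2%:R + - x0 0 2%:R)).
  by do ![apply: elem_add | apply: elem_mul | exact: elem_cst | exact: elem_coord].
by apply/funext => x; rewrite dotE !mxE.
Qed.

(* [flat1 (flat1 1 - flat1 (t - 1))] equals [flat1 (flat1 1)] for [t <= 1] and
   vanishes for [2 <= t], so no division by a function is needed. *)
Definition plateau (t : R) : R :=
  (flat1 (flat1 1))^-1 * flat1 (flat1 1 + - flat1 (t + - 1)).

Lemma plateau_le1 t : plateau t <= 1.
Proof.
rewrite /plateau ler_pdivrMl ?flat1_gt0 // mulr1; apply: flat1_le.
by rewrite gerDl oppr_le0 flat1_ge0.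
Qed.

Lemma plateau_ge0 t : 0 <= plateau t.
Proof. by apply: mulr_ge0; rewrite ?invr_ge0; exact: flat1_ge0. Qed.

Lemma plateau1 t : t <= 1 -> plateau t = 1.
Proof.
move=> t1; rewrite /plateau (flat1_0 (x := t + - 1)) ?subr_le0 // oppr0 addr0.
by rewrite mulVf // gt_eqF // !flat1_gt0.
Qed.

Lemma plateau0 t : 2 <= t -> plateau t = 0.
Proof.
move=> t2; have h : flat1 1 <= flat1 (t + - 1) by apply: flat1_le; lra.
by rewrite /plateau (flat1_0 (x := flat1 1 + _)) ?mulr0 // subr_le0.
Qed.

(** The squared distance is polynomial, hence smooth at [x0] too. The argument of [plateau] is 1 at
    distance r/2 and reaches 2 before distance 3r/4. *)
Definition cutoff (x0 : 'rV[R]_3) (r : R) (x : 'rV[R]_3) : R :=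
  plateau (4 / r ^+ 2 * dot (x - x0) (x - x0)).

Lemma elementary_cutoff x0 r : elementary (cutoff x0 r).
Proof.
apply: elem_mul; first exact: elem_cst.
apply: (elem_comp (smooth1_flat 1)); apply: elem_add; first exact: elem_cst.
have -> : (fun x : 'rV[R]_3 => - flat1 (4 / r ^+ 2 * dot (x - x0) (x - x0) + - 1)) =
    fun x => -1 * flat1 (4 / r ^+ 2 * dot (x - x0) (x - x0) + - 1).
  by apply/funext => x; rewrite mulN1r.
apply: elem_mul; first exact: elem_cst.
apply: (elem_comp (smooth1_flat 1)); apply: elem_add; last exact: elem_cst.
by apply: elem_mul; [exact: elem_cst|exact: elementary_sqr_dist].
Qed.

Lemma cutoff_eq1 x0 r x : 0 < r -> enorm (x - x0) <= r / 2 -> cutoff x0 r x = 1.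
Proof.
move=> r0 H; apply: plateau1; rewrite mulrAC ler_pdivrMr ?exprn_gt0 // mul1r.
rewrite -sqr_enorm; have := enorm_ge0 (x - x0); nra.
Qed.

Lemma cutoff_eq0 x0 r x : 0 < r -> 3 / 4 * r <= enorm (x - x0) -> cutoff x0 r x = 0.
Proof.
move=> r0 H; apply: plateau0; rewrite mulrAC ler_pdivlMr ?exprn_gt0 //.
rewrite -sqr_enorm; have := enorm_ge0 (x - x0); nra.
Qed.

Lemma cutoff_le1 x0 r x : 0 <= cutoff x0 r x <= 1.
Proof. by rewrite plateau_ge0 plateau_le1. Qed.

Lemma eball_open x0 r : open (@eball R x0 r).
Proof.
have c : continuous (fun x : 'rV[R]_3 => dot (x - x0) (x - x0)).
  exact/elementary_continuous/elementary_sqr_dist.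
rewrite (_ : eball x0 r = (fun x : 'rV[R]_3 => enorm (x - x0)) @^-1` `]-oo, r[%classic).
  apply: open_comp; last exact: interval_open.
  move=> x _; apply: (@continuous_comp _ _ _
    (fun x : 'rV[R]_3 => dot (x - x0) (x - x0)) Num.sqrt); first exact: c.
  exact: sqrt_continuous.
by apply/seteqP; split=> x; rewrite /eball /= in_itv.
Qed.

Lemma partial_cutoff_eq0 x0 r x k : 0 < r -> enorm (x - x0) < r / 2 ->
  partial k (cutoff x0 r) x = 0.
Proof.
move=> r0 xr; rewrite /partial (@near_eq_derive _ _ _ _ (cst (1 : R))).
  exact: derive_cst.
have : nbhs x (eball x0 (r / 2)).
  by apply: open_nbhs_nbhs; split => //; exact: eball_open.
by apply: filterS => y yr; rewrite cutoff_eq1 // ltW.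
Qed.

End Smooth3.

(** * Complex-valued integrals *)

Section NormC.
Context {R : realType}.
Implicit Types z : R[i].

Lemma normc_Re z : `|complex.Re z| <= normc z.
Proof.
case: z => a b /=; rewrite -sqrtr_sqr ler_wsqrtr // lerDl sqr_ge0 //.
Qed.

Lemma normc_Im z : `|complex.Im z| <= normc z.
Proof.
case: z => a b /=; rewrite -sqrtr_sqr ler_wsqrtr // lerDr sqr_ge0 //.
Qed.

Lemma normc_leD z : normc z <= `|complex.Re z| + `|complex.Im z|.
Proof.
case: z => a b /=.
rewrite -[leRHS]ger0_norm ?addr_ge0 // -sqrtr_sqr ler_wsqrtr //.
rewrite sqrrD !real_normK ?num_real // lerD2r lerDl.
by rewrite mulrn_wge0 // mulr_ge0.
Qed.

Lemma normc_ge0 z : 0 <= normc z.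
Proof. exact: le_trans (normr_ge0 _) (normc_Re z). Qed.

Lemma normc_real (r : R) : normc r%:C = `|r|.
Proof. by rewrite /= expr0n addr0 sqrtr_sqr. Qed.

Lemma ReM z z' : complex.Re (z * z') =
  complex.Re z * complex.Re z' - complex.Im z * complex.Im z'.
Proof. by case: z => a b; case: z'. Qed.

Lemma ImM z z' : complex.Im (z * z') =
  complex.Re z * complex.Im z' + complex.Im z * complex.Re z'.
Proof. by case: z => a b; case: z'. Qed.

Lemma ReD z z' : complex.Re (z + z') = complex.Re z + complex.Re z'.
Proof. by case: z => a b; case: z'. Qed.

Lemma ImD z z' : complex.Im (z + z') = complex.Im z + complex.Im z'.
Proof. by case: z => a b; case: z'. Qed.

Lemma ReN z : complex.Re (- z) = - complex.Re z. Proof. by case: z. Qed.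
Lemma ImN z : complex.Im (- z) = - complex.Im z. Proof. by case: z. Qed.

Lemma complex_eq z z' : complex.Re z = complex.Re z' ->
  complex.Im z = complex.Im z' -> z = z'.
Proof. by case: z => a b; case: z' => c d /= -> ->. Qed.

End NormC.

Section CInt.
Context {R : realType}.
Local Notation mu3 := (@lebesgue3 R).
Implicit Types (A B : set (coord3 R)) (f g : coord3 R -> R[i]) (h : coord3 R -> R).

Definition cint A f : R[i] :=
  \int[mu3]_(p in A) complex.Re (f p) +i* \int[mu3]_(p in A) complex.Im (f p).

Definition cmeasurable A f :=
  measurable_fun A (fun p => complex.Re (f p)) /\
  measurable_fun A (fun p => complex.Im (f p)).

Definition cintegrable A f :=
  mu3.-integrable A (fun p => (complex.Re (f p))%:E) /\
  mu3.-integrable A (fun p => (complex.Im (f p))%:E).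

Lemma eq_cint A f g : (forall p, A p -> f p = g p) -> cint A f = cint A g.
Proof.
by move=> fg; congr (_ +i* _); apply: eq_Rintegral => p /set_mem /fg ->.
Qed.

Lemma eq_cintegrable A f g : measurable A -> (forall p, A p -> f p = g p) ->
  cintegrable A f -> cintegrable A g.
Proof.
move=> mA fg [If Jf]; split; [apply: eq_integrable If|apply: eq_integrable Jf] => //;
  by move=> p /set_mem /fg ->.
Qed.

Lemma cintegrable_measurable A f : cintegrable A f -> cmeasurable A f.
Proof.
by move=> [/measurable_int If /measurable_int Jf]; split; apply/measurable_EFinP.
Qed.

Lemma cintegrableD A f g : measurable A -> cintegrable A f -> cintegrable A g ->
  cintegrable A (fun p => f p + g p).
Proof.
move=> mA [f1 f2] [g1 g2]; split.
  by apply: eq_integrable (integrableD mA f1 g1) => // p _; rewrite ReD.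
by apply: eq_integrable (integrableD mA f2 g2) => // p _; rewrite ImD.
Qed.

Lemma cintD A f g : measurable A -> cintegrable A f -> cintegrable A g ->
  cint A (fun p => f p + g p) = cint A f + cint A g.
Proof.
move=> mA [f1 f2] [g1 g2]; apply: complex_eq; rewrite ?(ReD, ImD) /=.
  by rewrite -RintegralD //; apply: eq_Rintegral => p _; rewrite ReD.
by rewrite -RintegralD //; apply: eq_Rintegral => p _; rewrite ImD.
Qed.

Lemma integrable_lincomb A h h' (a b : R) : measurable A ->
  mu3.-integrable A (EFin \o h) -> mu3.-integrable A (EFin \o h') ->
  mu3.-integrable A (EFin \o (fun p => a * h p + b * h' p)).
Proof.
move=> mA Ih Ih'.
by apply: eq_integrable (integrableD mA (integrableZl mA a Ih) (integrableZl mA b Ih')).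
Qed.

Lemma Rintegral_lincomb A h h' (a b : R) : measurable A ->
  mu3.-integrable A (EFin \o h) -> mu3.-integrable A (EFin \o h') ->
  \int[mu3]_(p in A) (a * h p + b * h' p) =
  a * \int[mu3]_(p in A) h p + b * \int[mu3]_(p in A) h' p.
Proof.
move=> mA Ih Ih'; rewrite RintegralD //.
- by rewrite !RintegralZl.
- by apply: eq_integrable (integrableZl mA a Ih).
- by apply: eq_integrable (integrableZl mA b Ih').
Qed.

Lemma cintegrableZ A f (c : R[i]) : measurable A -> cintegrable A f ->
  cintegrable A (fun p => c * f p).
Proof.
move=> mA [f1 f2]; split.
  apply: eq_integrable (integrable_lincomb (complex.Re c) (- complex.Im c) mA f1 f2) => //.
  by move=> p _ /=; rewrite ReM mulNr.
apply: eq_integrable (integrable_lincomb (complex.Im c) (complex.Re c) mA f1 f2) => //.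
by move=> p _ /=; rewrite ImM addrC.
Qed.

Lemma cintZ A f (c : R[i]) : measurable A -> cintegrable A f ->
  cint A (fun p => c * f p) = c * cint A f.
Proof.
move=> mA [f1 f2]; apply: complex_eq; rewrite ?(ReM, ImM) /=.
  rewrite -mulNr -Rintegral_lincomb //; apply: eq_Rintegral => p _.
  by rewrite ReM mulNr.
rewrite addrC -Rintegral_lincomb //; apply: eq_Rintegral => p _.
by rewrite ImM addrC.
Qed.

Lemma cintegrableN A f : measurable A -> cintegrable A f ->
  cintegrable A (fun p => - f p).
Proof.
move=> mA If; apply: (@eq_cintegrable A (fun p => (-1) * f p)) => //.
  by move=> p _; rewrite mulN1r.
exact: cintegrableZ.
Qed.

Lemma cintegrableB A f g : measurable A -> cintegrable A f -> cintegrable A g ->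
  cintegrable A (fun p => f p - g p).
Proof. by move=> mA If Ig; apply: cintegrableD => //; exact: cintegrableN. Qed.

Lemma cintB A f g : measurable A -> cintegrable A f -> cintegrable A g ->
  cint A (fun p => f p - g p) = cint A f - cint A g.
Proof.
move=> mA If Ig; rewrite cintD //; last exact: cintegrableN.
congr (_ + _); rewrite -mulN1r -cintZ //.
by apply: eq_cint => p _; rewrite mulN1r.
Qed.

Lemma cintegrable_le A f h : measurable A -> cmeasurable A f ->
  (forall p, A p -> normc (f p) <= h p) -> mu3.-integrable A (EFin \o h) ->
  cintegrable A f.
Proof.
move=> mA [f1 f2] fh Ih; split; apply: le_integrable Ih => //.
- exact/measurable_EFinP.
- move=> p Ap /=; rewrite lee_fin.
  exact: le_trans (normc_Re _) (le_trans (fh p Ap) (ler_norm _)).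
- exact/measurable_EFinP.
- move=> p Ap /=; rewrite lee_fin.
  exact: le_trans (normc_Im _) (le_trans (fh p Ap) (ler_norm _)).
Qed.

Lemma le_normr_Rintegral_ae A h h' : measurable A ->
  mu3.-integrable A (EFin \o h) -> mu3.-integrable A (EFin \o h') ->
  (forall p, A p -> 0 <= h' p) ->
  {ae mu3, forall p, A p -> `|h p| <= h' p} ->
  `|\int[mu3]_(p in A) h p| <= \int[mu3]_(p in A) h' p.
Proof.
move=> mA Ih Ih' h'0 hh.
apply: le_trans (le_normr_Rintegral mA Ih) _.
have Inh := integrable_norm Ih.
have /measurable_EFinP mnh := measurable_int _ Inh.
have /measurable_EFinP mh' := measurable_int _ Ih'.
rewrite /Rintegral fine_le //; [exact: integrable_fin_num|exact: integrable_fin_num|].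
apply: ae_ge0_le_integral => //; try exact/measurable_EFinP.
Qed.

(** The factor 2 comes from bounding real and imaginary parts separately; only orders of magnitude
    matter later. *)
Lemma cint_le_ae A f h : measurable A -> cintegrable A f ->
  mu3.-integrable A (EFin \o h) -> (forall p, A p -> 0 <= h p) ->
  {ae mu3, forall p, A p -> normc (f p) <= h p} ->
  normc (cint A f) <= 2 * \int[mu3]_(p in A) h p.
Proof.
move=> mA [f1 f2] Ih h0 fh; apply: le_trans (normc_leD _) _ => /=.
rewrite mulr_natl mulr2n lerD // le_normr_Rintegral_ae //.
  by apply: filterS fh => p H Ap; exact: le_trans (normc_Re _) (H Ap).
by apply: filterS fh => p H Ap; exact: le_trans (normc_Im _) (H Ap).
Qed.

Lemma cint_le A f h : measurable A -> cintegrable A f ->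
  mu3.-integrable A (EFin \o h) ->
  (forall p, A p -> normc (f p) <= h p) ->
  normc (cint A f) <= 2 * \int[mu3]_(p in A) h p.
Proof.
move=> mA If Ih fh; apply: cint_le_ae => //.
  by move=> p Ap; exact: le_trans (normc_ge0 _) (fh p Ap).
exact: aeW.
Qed.

Lemma cintegrableS A B f : measurable A -> measurable B -> A `<=` B ->
  cintegrable B f -> cintegrable A f.
Proof. by move=> mA mB AB [f1 f2]; split; [move: f1|move: f2]; apply: integrableS. Qed.

Lemma cint_setD A B f : measurable A -> measurable B -> A `<=` B ->
  cintegrable B f -> cint B f = cint A f + cint (B `\` A) f.
Proof.
move=> mA mB AB [f1 f2].
have E : B = A `|` (B `\` A) by rewrite setDUK.
have mD : measurable (B `\` A) by exact: measurableD.
have AD : [disjoint A & B `\` A] by apply/disj_setPS => p [? []].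
by apply: complex_eq; rewrite ?(ReD, ImD) /= {1}E Rintegral_setU // -E.
Qed.

Lemma Rintegral_shift (v : 'rV[R]_3) A h : measurable A ->
  measurable_fun setT h -> mu3.-integrable A (EFin \o h) ->
  \int[mu3]_(p in shift3 v @^-1` A) h (shift3 v p) = \int[mu3]_(p in A) h p.
Proof.
move=> mA mh Ih.
have mS : measurable_fun setT (shift3 v) by exact: measurable_shift3.
have E B (k : coord3 R -> \bar R) : measurable B ->
  (\int[pushforward mu3 (shift3 v)]_(p in B) k p = \int[mu3]_(p in B) k p)%E.
  by move=> mB; apply: eq_measure_integral => C mC _; exact: lebesgue3_shift.
have mEh : measurable_fun setT (EFin \o h) by apply/measurable_EFinP.
congr fine; rewrite -[RHS](E A (EFin \o h) mA).
rewrite (integral_pushforward mS mEh _ mA) //.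
apply/integrableP; split.
  apply: (@measurable_funS _ _ _ _ setT) => //; exact: (measurableT_comp mEh mS).
have /integrableP[_] := Ih; rewrite -(E A (fun p => `|(EFin \o h) p|%E) mA).
rewrite (ge0_integral_pushforward mS) //.
by apply: measurableT_comp => //; exact: measurable_funTS.
Qed.

Lemma cint_shift (v : 'rV[R]_3) A f : measurable A -> cmeasurable setT f ->
  cintegrable A f ->
  cint (shift3 v @^-1` A) (fun p => f (shift3 v p)) = cint A f.
Proof.
move=> mA [m1 m2] [f1 f2]; congr (_ +i* _).
  exact: (@Rintegral_shift v A (fun p => complex.Re (f p))).
exact: (@Rintegral_shift v A (fun p => complex.Im (f p))).
Qed.

End CInt.

(** * Boundedness and integrability on bounded domains *)

Section Bounded.
Context {R : realType}.
Local Notation mu3 := (@lebesgue3 R).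
Variables (x0 : 'rV[R]_3) (r0 : R).
Hypothesis r00 : 0 < r0.

(** Stands in for the closed ball: as a product of segments it is compact by [rV_compact]. *)
Definition cube : set 'rV[R]_3 :=
  [set x | forall k, `[x0 0 k - r0, x0 0 k + r0]%classic (x ord0 k)].

Lemma cube_compact : compact cube.
Proof. apply: (@rV_compact _ _ (fun k : 'I_3 => `[x0 0 k - r0, x0 0 k + r0]%classic)) => k; exact: segment_compact. Qed.

Lemma eball_cube x : enorm (x - x0) <= r0 -> cube x.
Proof.
move=> xr k /=; rewrite in_itv /=.
have := abs_coord_le_l1 (x - x0) k; rewrite !mxE => _.
have : `|(x - x0) 0 k| <= enorm (x - x0).
  rewrite -sqrtr_sqr ler_wsqrtr // /dot (bigD1 k) //= -expr2 lerDl.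
  by apply: sumr_ge0 => i _; rewrite -expr2 sqr_ge0.
rewrite !mxE => /le_trans /(_ xr); rewrite ler_norml => /andP[? ?]; lra.
Qed.

Lemma continuous_cube_bounded (f : 'rV[R]_3 -> R) : continuous f ->
  exists2 C, 0 <= C & forall x, cube x -> `|f x| <= C.
Proof.
move=> cf.
have cfK : compact (f @` cube).
  by apply: continuous_compact cube_compact; exact: continuous_subspaceT.
have [M [_ HM]] := compact_bounded cfK.
exists (`|M| + 1) => [|x Kx]; first by rewrite addr_ge0.
have MM : M < `|M| + 1 by have := ler_norm M; lra.
by apply: (HM _ MM); exists x.
Qed.

Lemma cube_closed_compact (A : set 'rV[R]_3) : closed A -> A `<=` cube -> compact A.
Proof. by move=> cA AK; apply: subclosed_compact cA cube_compact AK. Qed.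

End Bounded.

Section CContinuous.
Context {R : realType}.
Local Notation mu3 := (@lebesgue3 R).
Implicit Types (g : 'rV[R]_3 -> R[i]).

Definition ccontinuous g :=
  continuous (fun x => complex.Re (g x)) /\ continuous (fun x => complex.Im (g x)).

Lemma ccontinuous_cmeasurable g A : ccontinuous g ->
  cmeasurable A (fun p => g (vec3 p)).
Proof.
move=> [c1 c2]; split.
  exact: (continuous_measurable_vec3 (f := fun x => complex.Re (g x))).
exact: (continuous_measurable_vec3 (f := fun x => complex.Im (g x))).
Qed.

Lemma ccontinuousM g h : ccontinuous g -> ccontinuous h ->
  ccontinuous (fun x => g x * h x).
Proof.
move=> [g1 g2] [h1 h2]; split.
  rewrite (_ : (fun x => _) = fun x => complex.Re (g x) * complex.Re (h x) -
    complex.Im (g x) * complex.Im (h x)); last by apply/funext => x; rewrite ReM.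
  move=> x; exact: (continuousB (continuousM (g1 x) (h1 x)) (continuousM (g2 x) (h2 x))).
rewrite (_ : (fun x => _) = fun x => complex.Re (g x) * complex.Im (h x) +
  complex.Im (g x) * complex.Re (h x)); last by apply/funext => x; rewrite ImM.
move=> x; exact: (continuousD (continuousM (g1 x) (h2 x)) (continuousM (g2 x) (h1 x))).
Qed.

Lemma ccontinuous_real (h : 'rV[R]_3 -> R) : continuous h -> ccontinuous (fun x => (h x)%:C).
Proof. by move=> ch; split=> //= x; exact: cst_continuous. Qed.

Lemma cmeasurableM A (f h : coord3 R -> R[i]) : cmeasurable A f -> cmeasurable A h ->
  cmeasurable A (fun p => f p * h p).
Proof.
move=> [f1 f2] [h1 h2]; split.
  rewrite (_ : (fun p => _) = fun p => complex.Re (f p) * complex.Re (h p) -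
    complex.Im (f p) * complex.Im (h p)); last by apply/funext => x; rewrite ReM.
  by apply: measurable_funB; exact: measurable_funM.
rewrite (_ : (fun p => _) = fun p => complex.Re (f p) * complex.Im (h p) +
  complex.Im (f p) * complex.Re (h p)); last by apply/funext => x; rewrite ImM.
by apply: measurable_funD; exact: measurable_funM.
Qed.

Lemma cintegrableM A (f h : coord3 R -> R[i]) (C : R) : measurable A ->
  cintegrable A f -> cmeasurable A h -> (forall p, A p -> normc (h p) <= C) ->
  cintegrable A (fun p => f p * h p).
Proof.
move=> mA If mh hC; have [f1 f2] := If.
have n1 := integrable_norm f1; have n2 := integrable_norm f2.
apply: (cintegrable_le mA _ _ (integrable_lincomb C C mA n1 n2)).
  by apply: cmeasurableM => //; exact: cintegrable_measurable.
move=> p Ap /=; rewrite normcM -mulrDr mulrC.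
have C0 : 0 <= C by exact: le_trans (normc_ge0 _) (hC p Ap).
by apply: ler_pM; rewrite ?normc_ge0 ?hC // normc_leD.
Qed.

End CContinuous.

(** * Testing the trace condition with cut-off waves *)

Section Domain.
Context {R : realType}.
Local Notation mu3 := (@lebesgue3 R).
Variables (x0 : 'rV[R]_3) (r0 : R) (D : set 'rV[R]_3).
Hypothesis r00 : 0 < r0.
Hypothesis oD : open D.
Hypothesis DB : D `<=` eball x0 r0.
Local Notation D' := (@vec3 R @^-1` D).

Lemma measurable_domain : measurable D'.
Proof. exact: open_measurable_vec3. Qed.

Lemma domain_cube : D `<=` cube x0 r0.
Proof. by move=> x /DB xr; apply: eball_cube => //; exact: ltW. Qed.

Lemma domain_finite : (mu3 D' < +oo)%E.
Proof.
apply: (@le_lt_trans _ _ (mu3 (box (coords x0) (2 * r0)))); last first.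
  by rewrite lebesgue3_box ?mulr_gt0 // ltry.
apply: le_measure; rewrite ?inE.
- exact: measurable_domain.
- exact: measurable_box.
have H (a t : R) : a - r0 <= t -> t <= a + r0 -> a - 2 * r0 < t < a + 2 * r0.
  by have := r00; move=> *; apply/andP; split; lra.
move=> p /domain_cube Kp.
have := Kp 0; have := Kp 1; have := Kp 2%:R; rewrite /= !in_itv /=.
rewrite vec3_0 vec3_1 vec3_2 => /andP[? ?] /andP[? ?] /andP[? ?].
by rewrite /box /coords /=; do !split; rewrite /= in_itv /=; apply: H.
Qed.

Lemma integrable_cst_domain (c : R) : mu3.-integrable D' (EFin \o (fun=> c)).
Proof.
apply: measurable_bounded_integrable => //.
- exact: measurable_domain.
- exact: domain_finite.
by exists `|c|; split => // x /ltW cx p _ /=.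
Qed.

Lemma cintegrable_mulc (f : coord3 R -> R[i]) (g : 'rV[R]_3 -> R[i]) :
  cintegrable D' f -> ccontinuous g -> cintegrable D' (fun p => f p * g (vec3 p)).
Proof.
move=> If cg; have [c1 c2] := cg.
have [C1 C10 H1] := continuous_cube_bounded x0 r0 c1.
have [C2 C20 H2] := continuous_cube_bounded x0 r0 c2.
apply: (@cintegrableM _ _ _ _ (C1 + C2)) => //.
- exact: measurable_domain.
- exact: ccontinuous_cmeasurable.
move=> p /domain_cube Kp; apply: le_trans (normc_leD _) _.
by apply: lerD; [exact: H1|exact: H2].
Qed.

Lemma sqr_normc (z : R[i]) : normc z ^+ 2 = complex.Re z ^+ 2 + complex.Im z ^+ 2.
Proof. by case: z => a b /=; rewrite sqr_sqrtr // addr_ge0 // sqr_ge0. Qed.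

Lemma sqr_cnorm (z : 'rV[R[i]]_3) : cnorm z ^+ 2 = \sum_k normc (z 0 k) ^+ 2.
Proof. by rewrite /cnorm sqr_sqrtr // sumr_ge0 // => k _; exact: sqr_ge0. Qed.

Lemma normc_le_cnorm (z : 'rV[R[i]]_3) k : normc (z 0 k) <= cnorm z.
Proof.
rewrite -[leLHS]ger0_norm ?normc_ge0 // -sqrtr_sqr ler_wsqrtr // (bigD1 k) //=.
by rewrite lerDl sumr_ge0 // => i _; exact: sqr_ge0.
Qed.

(** The domain has finite measure, and c <= 1 + c^2. *)
Lemma L2_cintegrable (u : cfield R) k : L2_field D u ->
  cintegrable D' (fun p => u (vec3 p) 0 k).
Proof.
move=> [mu ufin].
have mD := measurable_domain.
have I2 : mu3.-integrable D' (EFin \o (fun p => cnorm (u (vec3 p)) ^+ 2)).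
  apply/integrableP; split.
    apply/measurable_EFinP.
    rewrite (_ : (fun p => _) = fun p =>
      \sum_k (complex.Re (u (vec3 p) 0 k) ^+ 2 + complex.Im (u (vec3 p) 0 k) ^+ 2)).
      apply: measurable_sum => i; have [m1 m2] := mu i.
      by apply: measurable_funD; exact: measurable_funX.
    by apply/funext => p; rewrite sqr_cnorm; apply: eq_bigr => i _; rewrite sqr_normc.
  apply: le_lt_trans ufin; rewrite le_eqVlt; apply/orP; left; apply/eqP.
  by apply: eq_integral => p _ /=; rewrite ger0_norm // sqr_ge0.
have Ib := integrable_lincomb 1 1 mD (integrable_cst_domain 1) I2.
apply: (cintegrable_le mD _ _ Ib).
  by have [m1 m2] := mu k.
move=> p _ /=; rewrite !mul1r; apply: le_trans (normc_le_cnorm _ k) _.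
have c0 : 0 <= cnorm (u (vec3 p)) by exact: sqrtr_ge0.
move: (cnorm _) c0 => c c0; nra.
Qed.

End Domain.

Section Trace.
Context {R : realType}.
Local Notation mu3 := (@lebesgue3 R).
Variables (x0 : 'rV[R]_3) (r0 : R) (D : set 'rV[R]_3).
Hypothesis r00 : 0 < r0.
Hypothesis oD : open D.
Hypothesis DB : D `<=` eball x0 r0.
Local Notation D' := (@vec3 R @^-1` D).
Local Notation Gamma := (boundary D `\` boundary (eball x0 r0)).

Lemma closed_eball (r : R) : closed [set x : 'rV[R]_3 | enorm (x - x0) <= r].
Proof.
have c : continuous (fun x : 'rV[R]_3 => dot (x - x0) (x - x0)).
  exact/elementary_continuous/elementary_sqr_dist.
rewrite (_ : mkset _ = (fun x : 'rV[R]_3 => enorm (x - x0)) @^-1` `]-oo, r]%classic).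
  apply: closed_comp; last exact: interval_closed.
  move=> x _; apply: (@continuous_comp _ _ _
    (fun x : 'rV[R]_3 => dot (x - x0) (x - x0)) Num.sqrt); first exact: c.
  exact: sqrt_continuous.
by apply/seteqP; split=> x /=; rewrite in_itv.
Qed.

Definition cut_fun (e : 'rV[R]_3 -> R) x := cutoff x0 r0 x * e x.

Lemma supp_cut (e : 'rV[R]_3 -> R) l :
  supp (fun x => cut_fun e x *: delta_mx 0 l) `<=`
  [set x | enorm (x - x0) <= 3 / 4 * r0].
Proof.
rewrite ((closure_id _).1 (@closed_eball (3 / 4 * r0))).
apply: closure_subset => x /=; apply: contraNT; rewrite -ltNge => /ltW xr.
by rewrite /cut_fun cutoff_eq0 // mul0r scale0r.
Qed.

Lemma test_cut (e : 'rV[R]_3 -> R) l : elementary e ->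
  test_field (fun x => cut_fun e x *: delta_mx 0 l).
Proof.
move=> ee; split.
  move=> k; rewrite (_ : (fun x => _) = fun x => cut_fun e x * (k == l)%:R).
    apply: elementary_smooth; apply: elem_mul; last exact: elem_cst.
    by apply: elem_mul => //; exact: elementary_cutoff.
  by apply/funext => x; rewrite !mxE eqxx.
apply: (@cube_closed_compact _ x0 r0); first exact: closed_closure.
move=> x /supp_cut /= xr; apply: eball_cube => //.
by apply: le_trans xr _; rewrite ger_pMl // ler_pdivrMr ?mul1r // ler_nat.
Qed.

(** What [Gamma] leaves out of the boundary of [D] lies on the sphere, whereas the cut-off vanishes
    beyond distance [3 / 4 * r0]. *)
Lemma supp_cut_boundary (e : 'rV[R]_3 -> R) l :
  supp (fun x => cut_fun e x *: delta_mx 0 l) `&` (boundary D `\` Gamma) = set0.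
Proof.
apply/seteqP; split=> // x [/supp_cut /= xr [bx /not_andP[//|/contrapT [_ nx]]]].
apply: nx; apply: open_nbhs_nbhs; split; first exact: eball_open.
rewrite /eball /=; apply: le_lt_trans xr _.
by rewrite gtr_pMl // ltr_pdivrMr // mul1r ltr_nat.
Qed.

Lemma curl_scaled (h : 'rV[R]_3 -> R) (l : 'I_3) (z : 'rV[R[i]]_3) x :
  cdot z (curl_smooth (fun y => h y *: delta_mx 0 l) x) =
  z 0 (l + 1) * (partial (l + 2%:R) h x)%:C - z 0 (l + 2%:R) * (partial (l + 1) h x)%:C.
Proof.
have [dh dhE] : exists dh, forall k, partial k h x = dh k
  by exists (fun k => partial k h x).
have P k m : partial k (fun y => (h y *: delta_mx 0 l : 'rV[R]_3) 0 m) x =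
    (m == l)%:R * dh k.
  rewrite -dhE.
  rewrite (_ : (fun y => _) = fun y => if m == l then h y else 0).
    by case: (m == l); rewrite ?mul1r ?mul0r // partial_cst.
  apply/funext => y; rewrite !mxE eqxx /=.
  by case: (m == l); rewrite ?mulr1 ?mulr0.
rewrite /cdot sum3E /curl_smooth !mxE !P !dhE.
move: l {P}; apply: ord3P;
  rewrite ?add0r ?ord3_11 ?ord3_12 ?ord3_21 ?ord3_22 /=.
all: rewrite ?mul0r ?mul1r ?subr0 ?sub0r ?mulr0 ?add0r ?addr0.
all: rewrite ?rmorphN ?mulrN //.
by rewrite addrC.
Qed.

End Trace.

(** * Complex exponentials *)

Section Wave.
Context {R : realType}.
Implicit Types (a b x v : 'rV[R]_3).

(* exp((a + i b) . (x - x0)) *)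
Definition wave_re a b x0 x : R :=
  expR (dot a x + - dot a x0) * cos (dot b x + - dot b x0).
Definition wave_im a b x0 x : R :=
  expR (dot a x + - dot a x0) * sin (dot b x + - dot b x0).
Definition wave a b x0 x : R[i] := wave_re a b x0 x +i* wave_im a b x0 x.
Definition freq a b : 'I_3 -> R[i] := fun k => a 0 k +i* b 0 k.

Lemma elementary_wave_re a b x0 : elementary (wave_re a b x0).
Proof.
apply: elem_mul; first exact: (elem_comp smooth1_expR (elementary_affine _ _)).
exact: (elem_comp smooth1_cos_sin.1 (elementary_affine _ _)).
Qed.

Lemma elementary_wave_im a b x0 : elementary (wave_im a b x0).
Proof.
apply: elem_mul; first exact: (elem_comp smooth1_expR (elementary_affine _ _)).
exact: (elem_comp smooth1_cos_sin.2 (elementary_affine _ _)).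
Qed.

Lemma ccontinuous_wave a b x0 : ccontinuous (wave a b x0).
Proof.
split; [exact: elementary_continuous (elementary_wave_re a b x0)|].
exact: elementary_continuous (elementary_wave_im a b x0).
Qed.

Lemma partial_wave_re a b x0 k x : partial k (wave_re a b x0) x =
  a 0 k * wave_re a b x0 x - b 0 k * wave_im a b x0 x.
Proof.
have d1 := elementary_differentiable x (elementary_affine a (- dot a x0)).
have d2 := elementary_differentiable x (elementary_affine b (- dot b x0)).
have e1 := elementary_differentiable x
  (elem_comp smooth1_expR (elementary_affine a (- dot a x0))).
have e2 := elementary_differentiable x
  (elem_comp smooth1_cos_sin.1 (elementary_affine b (- dot b x0))).
rewrite (partialM k e1 e2) (partial_comp k (is_derive_expR _) d1).
rewrite (partial_comp k (is_derive_cos _) d2) !partial_affine /wave_re /wave_im.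
ring.
Qed.

Lemma partial_wave_im a b x0 k x : partial k (wave_im a b x0) x =
  a 0 k * wave_im a b x0 x + b 0 k * wave_re a b x0 x.
Proof.
have d1 := elementary_differentiable x (elementary_affine a (- dot a x0)).
have d2 := elementary_differentiable x (elementary_affine b (- dot b x0)).
have e1 := elementary_differentiable x
  (elem_comp smooth1_expR (elementary_affine a (- dot a x0))).
have e2 := elementary_differentiable x
  (elem_comp smooth1_cos_sin.2 (elementary_affine b (- dot b x0))).
rewrite (partialM k e1 e2) (partial_comp k (is_derive_expR _) d1).
rewrite (partial_comp k (is_derive_sin _) d2) !partial_affine /wave_re /wave_im.
ring.
Qed.

Lemma normc_wave a b x0 x : normc (wave a b x0 x) = expR (dot a (x - x0)).
Proof.
rewrite /wave /wave_re /wave_im /= dotDr dotNr.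
rewrite !exprMn -mulrDr cos2Dsin2 mulr1 sqrtr_sqr ger0_norm //.
Qed.

Lemma wave_shift a b x0 x v : wave a b x0 (x + v) = wave a b x0 x * wave a b 0 v.
Proof.
rewrite /wave /wave_re /wave_im !dot0r !dotDr !oppr0 !addr0.
have E (c : 'rV[R]_3) : dot c x + dot c v + - dot c x0 = (dot c x + - dot c x0) + dot c v.
  by rewrite addrAC.
rewrite !E expRD (cosD _ (dot b v)) (sinD _ (dot b v)).
by apply: complex_eq; rewrite ?(ReM, ImM) /=; ring.
Qed.

End Wave.

Section TraceMoment.
Context {R : realType}.
Local Notation mu3 := (@lebesgue3 R).
Variables (x0 : 'rV[R]_3) (r0 : R) (D : set 'rV[R]_3).
Hypothesis r00 : 0 < r0.
Hypothesis oD : open D.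
Hypothesis DB : D `<=` eball x0 r0.
Local Notation D' := (@vec3 R @^-1` D).
Local Notation Gamma := (boundary D `\` boundary (eball x0 r0)).
Local Notation cut := (cutoff x0 r0).

Variable u : cfield R.
Hypothesis Hu : Hcurl D u.
Hypothesis Tu : tangential_trace_zero D Gamma u.

Lemma curl_L2 : L2_field D (curl D u).
Proof.
have [_ [v Hv]] := Hu.
suff : weak_curl D u (curl D u) by case.
exact: (xgetI _ Hv).
Qed.

Let mD : measurable D' := measurable_domain oD.

Lemma Hcurl_cintegrable k : cintegrable D' (fun p => u (vec3 p) 0 k).
Proof. by have [L2u _] := Hu; exact: (L2_cintegrable r00 oD DB). Qed.

Lemma curl_cintegrable k : cintegrable D' (fun p => curl D u (vec3 p) 0 k).
Proof. exact: (L2_cintegrable r00 oD DB _ curl_L2). Qed.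

(** The derivatives [dg] are a parameter because [partial] acts on real functions, while the test
    functions of interest are complex. *)
Definition trace_integrand (l : 'I_3) (g : 'rV[R]_3 -> R[i])
    (dg : 'I_3 -> 'rV[R]_3 -> R[i]) (x : 'rV[R]_3) : R[i] :=
  curl D u x 0 l * g x -
  (u x 0 (l + 1) * dg (l + 2%:R) x - u x 0 (l + 2%:R) * dg (l + 1) x).

Lemma trace_real (e : 'rV[R]_3 -> R) l : elementary e ->
  cint D' (fun p => trace_integrand l (fun x => (cut_fun x0 r0 e x)%:C)
    (fun k x => (partial k (cut_fun x0 r0 e) x)%:C) (vec3 p)) = 0.
Proof.
move=> ee; have := Tu (@test_cut R x0 r0 r00 e l ee) (@supp_cut_boundary R x0 r0 D r00 e l).
rewrite /tangential_trace => <-; apply: eq_cint => p _.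
rewrite /trace_integrand curl_scaled; congr (_ - _).
rewrite /cdot (bigD1 l) //= big1 ?addr0 => [|k /negPf kl].
  by rewrite !mxE !eqxx mulr1.
by rewrite !mxE kl mulr0 mulr0.
Qed.

Lemma trace_integrand_cintegrable l g dg : ccontinuous g -> (forall k, ccontinuous (dg k)) ->
  cintegrable D' (fun p => trace_integrand l g dg (vec3 p)).
Proof.
move=> cg cdg; apply: cintegrableB => //.
  exact: (cintegrable_mulc oD DB (curl_cintegrable l) cg).
by apply: cintegrableB => //; apply: (cintegrable_mulc oD DB) => //;
  exact: Hcurl_cintegrable.
Qed.

Lemma trace_complex (e1 e2 : 'rV[R]_3 -> R) l : elementary e1 -> elementary e2 ->
  cint D' (fun p => trace_integrand l
    (fun x => cut_fun x0 r0 e1 x +i* cut_fun x0 r0 e2 x)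
    (fun k x => partial k (cut_fun x0 r0 e1) x +i* partial k (cut_fun x0 r0 e2) x)
    (vec3 p)) = 0.
Proof.
move=> ee1 ee2.
have ecut e : elementary e -> elementary (cut_fun x0 r0 e).
  by move=> ee; apply: elem_mul => //; exact: elementary_cutoff.
have I e : elementary e -> cintegrable D' (fun p => trace_integrand l
    (fun x => (cut_fun x0 r0 e x)%:C) (fun k x => (partial k (cut_fun x0 r0 e) x)%:C)
    (vec3 p)).
  move=> ee; apply: trace_integrand_cintegrable => [|k]; apply: ccontinuous_real;
    apply: elementary_continuous; [exact: ecut|].
  by apply: elementary_partial; exact: ecut.
transitivity (cint D' (fun p =>
  trace_integrand l (fun x => (cut_fun x0 r0 e1 x)%:C)
    (fun k x => (partial k (cut_fun x0 r0 e1) x)%:C) (vec3 p) +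
  'i%C * trace_integrand l (fun x => (cut_fun x0 r0 e2 x)%:C)
    (fun k x => (partial k (cut_fun x0 r0 e2) x)%:C) (vec3 p))).
  apply: eq_cint => p _; rewrite /trace_integrand.
  have E (s t : R) : s +i* t = s%:C + 'i%C * t%:C.
    by apply: complex_eq; rewrite ?(ReD, ImD, ReM, ImM) /=; ring.
  generalize (cut_fun x0 r0 e1 (vec3 p)) (cut_fun x0 r0 e2 (vec3 p))
    (partial (l + 1) (cut_fun x0 r0 e1) (vec3 p)) (partial (l + 1) (cut_fun x0 r0 e2) (vec3 p))
    (partial (l + 2%:R) (cut_fun x0 r0 e1) (vec3 p))
    (partial (l + 2%:R) (cut_fun x0 r0 e2) (vec3 p)) => c1 c2 p1 p2 q1 q2.
  by rewrite (E c1) (E p1) (E q1); ring.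
rewrite cintD //; [|exact: I|by apply: cintegrableZ => //; exact: I].
by rewrite cintZ // ?trace_real ?mulr0 ?addr0 //; exact: I.
Qed.

Variables (a b : 'rV[R]_3).
Local Notation psi := (wave a b x0).
Local Notation rho := (freq a b).

Definition moment (f : 'rV[R]_3 -> R[i]) : R[i] :=
  cint D' (fun p => f (vec3 p) * ((cut (vec3 p))%:C * psi (vec3 p))).

(** Collects the terms in which the derivative falls on the cut-off rather than on the wave. *)
Definition cutoff_defect (m1 m2 : 'I_3) : R[i] :=
  cint D' (fun p => (u (vec3 p) 0 m1 * (partial m2 cut (vec3 p))%:C -
     u (vec3 p) 0 m2 * (partial m1 cut (vec3 p))%:C) * psi (vec3 p)).

Lemma ccontinuous_cut_wave : ccontinuous (fun x => (cut x)%:C * psi x).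
Proof.
apply: ccontinuousM; last exact: ccontinuous_wave.
by apply/ccontinuous_real/elementary_continuous/elementary_cutoff.
Qed.

Lemma ccontinuous_dcut k : ccontinuous (fun x => (partial k cut x)%:C).
Proof.
by apply/ccontinuous_real/elementary_continuous/elementary_partial/elementary_cutoff.
Qed.

Lemma cutoff_defect_cintegrable m1 m2 : cintegrable D' (fun p =>
  (u (vec3 p) 0 m1 * (partial m2 cut (vec3 p))%:C -
   u (vec3 p) 0 m2 * (partial m1 cut (vec3 p))%:C) * psi (vec3 p)).
Proof.
apply: (@cintegrable_mulc _ x0 r0 D oD DB
  (fun p => u (vec3 p) 0 m1 * (partial m2 cut (vec3 p))%:C -
   u (vec3 p) 0 m2 * (partial m1 cut (vec3 p))%:C) psi); last first.
  exact: ccontinuous_wave.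
have I k m := @cintegrable_mulc _ x0 r0 D oD DB _ _ (Hcurl_cintegrable k)
   (ccontinuous_dcut m).
by apply: cintegrableB => //; exact: I.
Qed.

(** Derivatives of the wave are multiples of it by [rho], so the vanishing trace turns the curl into
    a cross product of moments with [rho]. The two real test fields are the real and imaginary parts
    of the cut-off wave. *)
Lemma trace_moment l : moment (fun x => curl D u x 0 l) =
  moment (fun x => u x 0 (l + 1)) * rho (l + 2%:R) -
  moment (fun x => u x 0 (l + 2%:R)) * rho (l + 1) + cutoff_defect (l + 1) (l + 2%:R).
Proof.
have I k := @cintegrable_mulc _ x0 r0 D oD DB _ _ (Hcurl_cintegrable k)
   ccontinuous_cut_wave.
have Ic := @cintegrable_mulc _ x0 r0 D oD DB _ _ (curl_cintegrable l)
   ccontinuous_cut_wave.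
have dr := @elementary_wave_re R a b x0; have di := @elementary_wave_im R a b x0.
apply/eqP; rewrite -subr_eq0 -(trace_complex l dr di).
apply/eqP/esym.
rewrite /moment /cutoff_defect.
rewrite ![cint _ _ * rho _]mulrC -!cintZ //.
have IZ k c : cintegrable D' (fun p => c *
  (u (vec3 p) 0 k * ((cut (vec3 p))%:C * psi (vec3 p)))).
  by apply: cintegrableZ => //; exact: I.
rewrite -cintB // -cintD //; [|exact: cintegrableB|exact: cutoff_defect_cintegrable].
rewrite -cintB //; last first.
  apply: cintegrableD => //; [exact: cintegrableB|exact: cutoff_defect_cintegrable].
apply: eq_cint => p _; rewrite /trace_integrand.
(* [l + 1] and [l + 2] are made opaque: deciding whether they are convertible
   is very expensive. *)
generalize (l + 1) (l + 2%:R) => m1 m2.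
have D0 := elementary_differentiable (vec3 p) (elementary_cutoff x0 r0).
have E k : partial k (cut_fun x0 r0 (wave_re a b x0)) (vec3 p) +i*
           partial k (cut_fun x0 r0 (wave_im a b x0)) (vec3 p) =
    (cut (vec3 p))%:C * psi (vec3 p) * rho k +
    (partial k cut (vec3 p))%:C * psi (vec3 p).
  rewrite (partialM k D0 (elementary_differentiable _ dr)).
  rewrite (partialM k D0 (elementary_differentiable _ di)).
  rewrite partial_wave_re partial_wave_im.
  by apply: complex_eq; rewrite ?(ReD, ImD, ReM, ImM) /=; ring.
rewrite (E m1) (E m2).
have -> : cut_fun x0 r0 (wave_re a b x0) (vec3 p) +i*
          cut_fun x0 r0 (wave_im a b x0) (vec3 p) = (cut (vec3 p))%:C * psi (vec3 p).
  by apply: complex_eq; rewrite ?(ReM, ImM) /= /cut_fun; ring.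
generalize (u (vec3 p) 0 m1) (u (vec3 p) 0 m2) (rho m1) (rho m2)
  (partial m1 cut (vec3 p)) (partial m2 cut (vec3 p)) (cut (vec3 p)) (psi (vec3 p))
  (curl D u (vec3 p) 0 l) => z1 z2 z3 z4 z5 z6 z7 z8 z9.
ring.
Qed.

End TraceMoment.

(** * The Laplace transform of the cone *)

Section Laplace.
Context {R : realType}.
Local Notation mu3 := (@lebesgue3 R).
Variables (x0 : 'rV[R]_3).
Implicit Types (A B : set 'rV[R]_3) (a b v : 'rV[R]_3).
Local Notation "A `'" := (@vec3 R @^-1` A) (at level 2, format "A `'").

Lemma exp_l1_integrable (A : set (coord3 R)) (d : R) : measurable A -> 0 < d ->
  mu3.-integrable A (EFin \o (fun p => expR (- (d * l1 (vec3 p - x0))))).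
Proof.
move=> mA d0.
have m : measurable_fun setT (fun p : coord3 R => expR (- (d * l1 (vec3 p - x0)))).
  apply: (continuous_measurable_vec3 (f := fun x => expR (- (d * l1 (x - x0))))).
  move=> x; apply: continuous_comp; last exact: continuous_expR.
  apply: continuousN; apply: continuousM; first exact: cst_continuous.
  apply: (@continuous_comp _ _ _ (fun x : 'rV[R]_3 => x - x0) (@l1 R)).
    by apply: continuousB; [exact: cvg_id|exact: cst_continuous].
  exact: l1_continuous.
apply: (@integrableS _ _ _ _ setT) => //; apply/integrableP; split.
  exact/measurable_EFinP.
apply: (@le_lt_trans _ _ (8 / d ^+ 3)%:E); last by rewrite ltry.
apply: le_trans (integral_exp_l1 x0 d0).
rewrite le_eqVlt; apply/orP; left; apply/eqP; apply: eq_integral => p _ /=.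
by rewrite ger0_norm // expR_ge0.
Qed.

Lemma Rintegral_exp_l1 (A : set (coord3 R)) (d : R) : measurable A -> 0 < d ->
  \int[mu3]_(p in A) expR (- (d * l1 (vec3 p - x0))) <= 8 / d ^+ 3.
Proof.
move=> mA d0; rewrite -lee_fin /Rintegral fineK; last first.
  apply: integrable_fin_num => //; exact: exp_l1_integrable.
apply: le_trans (integral_exp_l1 x0 d0).
apply: ge0_subset_integral => //.
have /integrableP[m _] := exp_l1_integrable (@measurableT _ _) d0.
exact: m.
Qed.

Lemma decaying_integral (A : set (coord3 R)) (f : coord3 R -> R[i]) (C d : R) :
  measurable A -> cmeasurable A f -> 0 < d -> 0 <= C ->
  (forall p, A p -> normc (f p) <= C * expR (- (d * l1 (vec3 p - x0)))) ->
  cintegrable A f /\ normc (cint A f) <= C * 16 / d ^+ 3.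
Proof.
move=> mA mf d0 C0 fC.
have I := exp_l1_integrable mA d0.
have IC : mu3.-integrable A
    (EFin \o (fun p => C * expR (- (d * l1 (vec3 p - x0))))).
  by apply: eq_integrable (integrableZl mA C I).
have If := cintegrable_le mA mf fC IC.
split => //; apply: le_trans (cint_le mA If IC fC) _.
rewrite RintegralZl //.
have -> : C * 16 / d ^+ 3 = 2 * (C * (8 / d ^+ 3)) by ring.
by rewrite ler_pM2l // ler_wpM2l // Rintegral_exp_l1.
Qed.

Variables (a b : 'rV[R]_3).
Local Notation psi := (wave a b x0).

Lemma wave_decay A d : measurable A`' -> 0 < d ->
  (forall x, A x -> dot a (x - x0) <= - (d * l1 (x - x0))) ->
  cintegrable A`' (fun p => psi (vec3 p)) /\
  normc (cint A`' (fun p => psi (vec3 p))) <= 16 / d ^+ 3.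
Proof.
move=> mA d0 H.
have := @decaying_integral A`' (fun p => psi (vec3 p)) 1 d mA.
rewrite mul1r; apply => //.
  exact/ccontinuous_cmeasurable/ccontinuous_wave.
by move=> p Ap; rewrite mul1r normc_wave ler_expR; exact: H.
Qed.

(** Translating by [v] multiplies the wave by the constant [wave a b 0 v], so this constant times
    the integral over [A] is the integral over the translate, which lies in [A]. *)
Lemma wave_difference A v : measurable A`' -> (forall x, A (x - v) -> A x) ->
  cintegrable A`' (fun p => psi (vec3 p)) ->
  (1 - wave a b 0 v) * cint A`' (fun p => psi (vec3 p)) =
  cint (A `\` [set x | A (x - v)])`' (fun p => psi (vec3 p)).
Proof.
move=> mA Av IA; set B := [set x | A (x - v)].
have cw : ccontinuous psi by exact: ccontinuous_wave.
have EB : B`' = shift3 (- v) @^-1` A`'.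
  by apply/seteqP; split=> p; rewrite /B /= vec3_shift3.
have mB : measurable B`'.
  by rewrite EB -[X in measurable X]setTI; apply: (measurable_shift3 (- v)).
have BA : B`' `<=` A`' by move=> p /Av.
have IB := cintegrableS mB mA BA IA.
have EA : shift3 v @^-1` B`' = A`'.
  by apply/seteqP; split=> p; rewrite /B /= vec3_shift3 addrK.
have ES : cint A`' (fun p => wave a b 0 v * psi (vec3 p)) =
    cint B`' (fun p => psi (vec3 p)).
  rewrite -(@cint_shift _ v _ _ mB (ccontinuous_cmeasurable _ cw) IB) EA.
  by apply: eq_cint => p _; rewrite vec3_shift3 wave_shift mulrC.
have := cint_setD mB mA BA IA; rewrite -ES cintZ // => E.
rewrite mulrBl mul1r {1}E; set J := cint (A`' `\` B`') _.
by rewrite addrAC subrr add0r.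
Qed.

Variables (w1 w2 w3 n1 n2 n3 : 'rV[R]_3).
Hypothesis span : forall v, v = dot n1 v *: w1 + dot n2 v *: w2 + dot n3 v *: w3.
Hypothesis dual : forall r s t : R, let v := r *: w1 + s *: w2 + t *: w3 in
    [/\ dot n1 v = r, dot n2 v = s & dot n3 v = t].

Definition coord_box (I1 I2 I3 : set R) : set 'rV[R]_3 :=
  [set x | [/\ I1 (dot n1 (x - x0)), I2 (dot n2 (x - x0)) & I3 (dot n3 (x - x0))]].

Lemma measurable_coord_box (I1 I2 I3 : set R) :
  measurable (I1 : set (measurableTypeR R)) ->
  measurable (I2 : set (measurableTypeR R)) ->
  measurable (I3 : set (measurableTypeR R)) -> measurable (coord_box I1 I2 I3)`'.
Proof.
move=> m1 m2 m3.
have m n : measurable_fun setT (fun p : coord3 R => dot n (vec3 p - x0)).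
  apply: (continuous_measurable_vec3 (f := fun x => dot n (x - x0))) => x.
  apply: (@continuous_comp _ _ _ (fun x : 'rV[R]_3 => x - x0) (dot n)).
    by apply: continuousB; [exact: cvg_id|exact: cst_continuous].
  exact: dot_continuous.
rewrite (_ : _`' = (fun p => dot n1 (vec3 p - x0)) @^-1` I1 `&`
  ((fun p => dot n2 (vec3 p - x0)) @^-1` I2 `&` (fun p => dot n3 (vec3 p - x0)) @^-1` I3)).
  apply: measurableI; last apply: measurableI.
  - by rewrite -[X in measurable X]setTI; apply: (m n1).
  - by rewrite -[X in measurable X]setTI; apply: (m n2).
  - by rewrite -[X in measurable X]setTI; apply: (m n3).
by apply/seteqP; split=> p /= []; [move=> ? ? ?|move=> ? []].
Qed.

Lemma dual1 h : [/\ dot n1 (h *: w1) = h, dot n2 (h *: w1) = 0 & dot n3 (h *: w1) = 0].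
Proof. by have := dual h 0 0; rewrite !scale0r !addr0. Qed.

Lemma dual2 h : [/\ dot n1 (h *: w2) = 0, dot n2 (h *: w2) = h & dot n3 (h *: w2) = 0].
Proof. by have := dual 0 h 0; rewrite !scale0r add0r addr0. Qed.

Lemma dual3 h : [/\ dot n1 (h *: w3) = 0, dot n2 (h *: w3) = 0 & dot n3 (h *: w3) = h].
Proof. by have := dual 0 0 h; rewrite !scale0r !add0r. Qed.

Local Notation pos := (`]0, +oo[%classic : set R).

(** [wave_difference] along each edge in turn cuts one half-line down to a segment. No division,
    linear change of variables or determinant of the edges is involved. *)
Lemma wave_parallelepiped h : 0 < h ->
  cintegrable (coord_box pos pos pos)`' (fun p => psi (vec3 p)) ->
  (1 - wave a b 0 (h *: w1)) * (1 - wave a b 0 (h *: w2)) *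
    (1 - wave a b 0 (h *: w3)) * cint (coord_box pos pos pos)`' (fun p => psi (vec3 p)) =
  cint (coord_box `]0, h] `]0, h] `]0, h])`' (fun p => psi (vec3 p)).
Proof.
move=> h0 I.
have mp : measurable (pos : set (measurableTypeR R)) by exact: measurable_itv.
have mh : measurable (`]0, h]%classic : set (measurableTypeR R)) by exact: measurable_itv.
have m0 := measurable_coord_box mp mp mp.
have m1 := measurable_coord_box mh mp mp.
have m2 := measurable_coord_box mh mh mp.
have hp : `]0, h]%classic `<=` pos.
  by move=> r /=; rewrite !in_itv /= andbT => /andP[].
have D (n : 'rV[R]_3) v x : dot n (x - v - x0) = dot n (x - x0) - dot n v.
  by rewrite addrAC dotDr dotNr.
have I1 : cintegrable (coord_box `]0, h] pos pos)`' (fun p => psi (vec3 p)).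
  by apply: (cintegrableS m1 m0 _ I) => p [/hp].
have I2 : cintegrable (coord_box `]0, h] `]0, h] pos)`' (fun p => psi (vec3 p)).
  by apply: (cintegrableS m2 m1 _ I1) => p [? /hp].
have [d11 d12 d13] := dual1 h; have [d21 d22 d23] := dual2 h.
have [d31 d32 d33] := dual3 h.
have E1 := @wave_difference (coord_box pos pos pos) (h *: w1) m0 _ I.
have E2 := @wave_difference (coord_box `]0, h] pos pos) (h *: w2) m1 _ I1.
have E3 := @wave_difference (coord_box `]0, h] `]0, h] pos) (h *: w3) m2 _ I2.
rewrite mulrAC -mulrA mulrACA mulrC.
transitivity ((1 - wave a b 0 (h *: w3)) * ((1 - wave a b 0 (h *: w2)) *
  ((1 - wave a b 0 (h *: w1)) * cint (coord_box pos pos pos)`' (fun p => psi (vec3 p))))).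
  ring.
rewrite E1; last first.
  by move=> x []; rewrite /coord_box /= !D d11 d12 d13 !subr0 /= !in_itv /= !andbT => *; split => //; lra.
rewrite (_ : coord_box pos pos pos `\` _ = coord_box `]0, h] pos pos); last first.
  apply/seteqP; split=> x.
    move=> [[+ + +] /not_and3P]; rewrite /coord_box /= !D d11 d12 d13 !subr0 /= !in_itv /= !andbT.
    move=> p1 p2 p3 H; split=> //; rewrite p1 /= leNgt; apply/negP => p4.
    by case: H => // /negP; rewrite -leNgt; lra.
  move=> []; rewrite /coord_box /= !D d11 d12 d13 !subr0 /= !in_itv /= !andbT => /andP[p1 p4] p2 p3.
  by split => // -[]; lra.
rewrite E2; last first.
  by move=> x []; rewrite /coord_box /= !D d21 d22 d23 !subr0 /= !in_itv /= !andbT => *; split => //; lra.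
rewrite (_ : coord_box `]0, h] pos pos `\` _ = coord_box `]0, h] `]0, h] pos); last first.
  apply/seteqP; split=> x.
    move=> [[+ + +] /not_and3P]; rewrite /coord_box /= !D d21 d22 d23 !subr0 /= !in_itv /= !andbT.
    move=> p1 p2 p3 H; split=> //; rewrite p2 /= leNgt; apply/negP => p4.
    by case: H => // /negP; rewrite -leNgt; lra.
  move=> []; rewrite /coord_box /= !D d21 d22 d23 !subr0 /= !in_itv /= !andbT => p1 /andP[p2 p4] p3.
  by split => // -[] _; lra.
rewrite E3; last first.
  by move=> x []; rewrite /coord_box /= !D d31 d32 d33 !subr0 /= !in_itv /= !andbT => *; split => //; lra.
rewrite (_ : coord_box `]0, h] `]0, h] pos `\` _ = coord_box `]0, h] `]0, h] `]0, h]) //.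
apply/seteqP; split=> x.
  move=> [[+ + +] /not_and3P]; rewrite /coord_box /= !D d31 d32 d33 !subr0 /= !in_itv /= !andbT.
  move=> p1 p2 p3 H; split=> //; rewrite p3 /= leNgt; apply/negP => p4.
  by case: H => // /negP; rewrite -leNgt; lra.
move=> []; rewrite /coord_box /= !D d31 d32 d33 !subr0 /= !in_itv /= !andbT => p1 p2 /andP[p3 p4].
by split => // -[] _ _; lra.
Qed.

End Laplace.

(** * Lower bounds for the transform *)

Section LowerBound.
Context {R : realType}.
Local Notation mu3 := (@lebesgue3 R).
Variables (x0 w1 w2 w3 n1 n2 n3 : 'rV[R]_3).
Local Notation "A `'" := (@vec3 R @^-1` A) (at level 2, format "A `'").
Hypothesis span : forall v, v = dot n1 v *: w1 + dot n2 v *: w2 + dot n3 v *: w3.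
Hypothesis dual : forall r s t : R, let v := r *: w1 + s *: w2 + t *: w3 in
    [/\ dot n1 v = r, dot n2 v = s & dot n3 v = t].
Local Notation pos := (`]0, +oo[%classic : set R).
Local Notation slab := (coord_box x0 n1 n2 n3).
Local Notation Q h := (slab `]0, h]%classic `]0, h]%classic `]0, h]%classic).

Lemma cos_near0 : exists2 e : R, 0 < e <= 1 / 4 & forall t, `|t| <= e -> 3 / 4 <= cos t.
Proof.
have : {for 0, continuous (@cos R)} by exact: continuous_cos.
move=> /cvgrPdist_lt /(_ (1 / 4)) [|e /= e0 He]; first by rewrite divr_gt0.
exists (Order.min (e / 2) (1 / 4)); first by rewrite lt_min !divr_gt0 //= ge_min lexx orbT.
move=> t; rewrite le_min => /andP[te _].
have := He t; rewrite /= sub0r normrN cos0 => H.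
have : `|1 - cos t| < 1 / 4 by apply: H; apply: le_lt_trans te _; lra.
by rewrite ltr_norml => /andP[? ?]; lra.
Qed.

Lemma parallelepiped_l1 h x : 0 < h -> Q h x ->
  l1 (x - x0) <= h * (l1 w1 + l1 w2 + l1 w3).
Proof.
move=> h0 [] /=; rewrite !in_itv /= => /andP[p1 q1] /andP[p2 q2] /andP[p3 q3].
rewrite [x - x0]span; apply: le_trans (l1D _ _) _; rewrite mulrDr lerD //.
  apply: le_trans (l1D _ _) _; rewrite mulrDr.
  by apply: lerD; rewrite l1Z gtr0_norm // ler_wpM2r // l1_ge0.
by rewrite l1Z gtr0_norm // ler_wpM2r // l1_ge0.
Qed.

(** A cube about the centre replaces the exact volume of the parallelepiped. With half-side h/(8N),
    each dual coordinate moves by at most 3h/8 from its central value h/2. *)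
Lemma parallelepiped_box : exists2 r : R, 0 < r & forall h, 0 < h ->
  exists c, box c (r * h) `<=` (Q h)`'.
Proof.
pose N := 1 + (l1 n1 + l1 n2 + l1 n3).
have [[g1 g2] g3] := (l1_ge0 n1, l1_ge0 n2, l1_ge0 n3).
have N0 : 0 < N by rewrite /N; lra.
exists (8 * N)^-1; first by rewrite invr_gt0 mulr_gt0.
move=> h h0; pose xc := x0 + (h / 2 *: w1 + h / 2 *: w2 + h / 2 *: w3).
have [d1 d2 d3] := dual (h / 2) (h / 2) (h / 2).
exists (coords xc) => p pb.
have H (e y z : R) : y - e < z < y + e -> `|z - y| <= e.
  by move=> /andP[u1 u2]; rewrite ler_norml; apply/andP; split; lra.
have lp : l1 (vec3 p - xc) <= 3 * ((8 * N)^-1 * h).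
  move: pb; rewrite /box /coords /= => -[[]] /=; rewrite !in_itv /=.
  move=> /H h1 /H h2 /H h3.
  have l1E (v : 'rV[R]_3) (e : R) : `|v 0 0| <= e -> `|v 0 1| <= e -> `|v 0 2%:R| <= e ->
      l1 v <= 3 * e by rewrite /l1; lra.
  apply: l1E; rewrite mxE [X in _ + X]mxE.
  - by rewrite vec3_0.
  - by rewrite vec3_1.
  - by rewrite vec3_2.
have E n : l1 n <= N -> `|dot n (vec3 p - xc)| <= 3 / 8 * h.
  move=> nN; apply: le_trans (abs_dot_le_l1 _ _) _.
  apply: le_trans (_ : N * (3 * ((8 * N)^-1 * h)) <= _).
    by apply: ler_pM; rewrite ?l1_ge0.
  by rewrite le_eqVlt; apply/orP; left; apply/eqP; field; rewrite gt_eqF.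
have S n : dot n (vec3 p - x0) = dot n (vec3 p - xc) +
    dot n (h / 2 *: w1 + h / 2 *: w2 + h / 2 *: w3).
  rewrite -dotDr; congr (dot n _); rewrite /xc; set V := _ + _ *: w3.
  by rewrite opprD (addrA (vec3 p)) subrK.
rewrite /coord_box /= !S d1 d2 d3 !in_itv /=.
have E1 := E n1; have E2 := E n2; have E3 := E n3.
rewrite !ler_norml in E1 E2 E3.
have I (t : R) : - (3 / 8 * h) <= t <= 3 / 8 * h -> 0 < t + h / 2 <= h.
  by move=> /andP[t1 t2]; apply/andP; split; lra.
by split; apply: I; [apply: E1|apply: E2|apply: E3]; rewrite /N; lra.
Qed.

Lemma measurable_itv0 (h : R) : measurable (`]0, h]%classic : set (measurableTypeR R)).
Proof. exact: measurable_itv. Qed.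

Lemma measurable_parallelepiped h : measurable (Q h)`'.
Proof. by apply: measurable_coord_box; exact: measurable_itv0. Qed.

Lemma parallelepiped_lower (B : R) : 0 < B -> exists2 k, 0 < k &
  exists2 c, 0 < c & forall a b s, 0 < s -> l1 a <= s * B -> l1 b <= s * B ->
    c / s ^+ 3 <= normc (cint (Q (k / s))`' (fun p => wave a b x0 (vec3 p))).
Proof.
move=> B0; have [e /andP[e0 e14] He] := cos_near0.
pose L := 1 + (l1 w1 + l1 w2 + l1 w3).
have [[g1 g2] g3] := (l1_ge0 w1, l1_ge0 w2, l1_ge0 w3).
have L0 : 0 < L by rewrite /L; lra.
have [r r0 Hr] := parallelepiped_box.
(* For [h = k / s] this makes [s * B * (h * L)] equal to [e], so exponent and phase of the wave both
   stay within [e]. The constant [4 * (r * k) ^+ 3] below is half of the volume of the inscribed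
   cube, up to [s ^+ 3]. *)
pose k := e / (B * L).
have k0 : 0 < k by rewrite divr_gt0 // mulr_gt0.
exists k => //; exists (4 * (r * k) ^+ 3); first by rewrite mulr_gt0 // exprn_gt0 // mulr_gt0.
move=> a b s s0 la lb; set h := k / s.
have h0 : 0 < h by rewrite divr_gt0.
have mQ := measurable_parallelepiped h.
have small (v x : 'rV[R]_3) : l1 v <= s * B -> Q h x -> `|dot v (x - x0)| <= e.
  move=> lv /(parallelepiped_l1 h0) lx; apply: le_trans (abs_dot_le_l1 _ _) _.
  apply: le_trans (_ : s * B * (h * L) <= _).
    apply: ler_pM; rewrite ?l1_ge0 //; apply: le_trans lx _.
    by rewrite ler_pM2l // /L; lra.
  rewrite le_eqVlt; apply/orP; left; apply/eqP; rewrite /h /k.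
  by field; rewrite !gt_eqF.
(* As [e <= 1 / 4], both the exponential and the cosine are at least 3/4, and 9/16 exceeds 1/2. *)
have half x : Q h x -> 1 / 2 <= complex.Re (wave a b x0 x).
  move=> Qx; rewrite /wave /wave_re /=.
  have := small a x la Qx; have := small b x lb Qx; rewrite !dotDr !dotNr.
  move=> /He c34; rewrite ler_norml => /andP[u1 _].
  have := expR_ge1Dx (dot a x + - dot a x0) => e34.
  have : 3 / 4 * (3 / 4) <= expR (dot a x + - dot a x0) * cos (dot b x + - dot b x0).
    by apply: ler_pM => //; lra.
  lra.
have rh0 : 0 < r * h by exact: mulr_gt0.
have [c bQ] := Hr h h0.
have mb : measurable (box c (r * h)) by exact: measurable_box.
have IQ : cintegrable (Q h)`' (fun p => wave a b x0 (vec3 p)).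
  have cw := ccontinuous_wave a b x0.
  have DI := decaying_integral (x0 := x0) mQ (ccontinuous_cmeasurable _ cw) ltr01
    (expR_ge0 (e + h * L)).
  apply: (fun H => (DI H).1) => p Qp; rewrite normc_wave -expRD ler_expR mul1r.
  have := small a _ la Qp; rewrite ler_norml => /andP[_ u2].
  have := parallelepiped_l1 h0 Qp.
  have : h * (l1 w1 + l1 w2 + l1 w3) <= h * L by rewrite ler_pM2l // /L; lra.
  lra.
apply: le_trans (normc_Re _); apply: le_trans (ler_norm _).
rewrite (cint_setD mb mQ bQ IQ) ReD.
have Ib := cintegrableS mb mQ bQ IQ.
have H1 : 4 * (r * k) ^+ 3 / s ^+ 3 <= complex.Re (cint (box c (r * h)) (fun p => wave a b x0 (vec3 p))).
  have -> : 4 * (r * k) ^+ 3 / s ^+ 3 = \int[mu3]_(p in box c (r * h)) (1 / 2).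
    rewrite Rintegral_cst // lebesgue3_box // /h /=.
    by field; rewrite gt_eqF.
  apply: (@le_Rintegral _ _ _ mu3 _ _ (fun p => complex.Re (wave a b x0 (vec3 p)))) => //.
  - apply: measurable_bounded_integrable => //.
      by rewrite lebesgue3_box // ltry.
    by exists (1 / 2); split => // x /ltW cx p _ /=; rewrite ger0_norm.
  - by case: Ib.
  by move=> p /bQ; exact: half.
apply: le_trans H1 _; rewrite lerDl; apply: Rintegral_ge0 => p [Qp _].
by apply: le_trans (half _ Qp); rewrite divr_ge0.
Qed.

End LowerBound.

Section ConeLowerBound.
Context {R : realType}.
Local Notation mu3 := (@lebesgue3 R).
Local Notation "A `'" := (@vec3 R @^-1` A) (at level 2, format "A `'").

(** The integral over the parallelepiped is the product of three factors with the integral over the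
    cone, minus the same product with the integral over the part outside the simplicial cone. The
    latter is of order eta: the factor of [w1] is at most [k * eta], and the decay rate outside is
    independent of eta. *)
Lemma cone_laplace_lower (x0 : 'rV[R]_3) (K : set 'rV[R]_3)
    (a0 w1 w2 w3 n1 n2 n3 : 'rV[R]_3) (eta0 delta : R) (b0 : 'rV[R]_3) (B : R) :
  edge_frame K a0 w1 w2 w3 n1 n2 n3 eta0 delta -> dot b0 w1 = 0 -> 0 < B ->
  exists2 eta1, 0 < eta1 <= eta0 & exists2 c, 0 < c & forall eta s t,
    0 < eta < eta1 -> 0 < s -> 0 <= t <= s * B ->
    c / s ^+ 3 <= normc (cint [set x | K (x - x0)]`'
      (fun p => wave (s *: (a0 - eta *: w1)) (t *: b0) x0 (vec3 p))).
Proof.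
move=> F b0w1 B0.
pose span := ef_span F; pose dual := ef_dual F.
pose B1 := 1 + (l1 a0 + eta0 * l1 w1 + B * l1 b0).
have eta00 := ef_eta0 F; have delta0 := ef_delta F.
have g1 := l1_ge0 a0; have g2 : 0 <= eta0 * l1 w1 by rewrite mulr_ge0 ?l1_ge0 // ltW.
have g3 : 0 <= B * l1 b0 by rewrite mulr_ge0 ?l1_ge0 // ltW.
have B10 : 0 < B1 by rewrite /B1; lra.
have [k k0 [c c0 Hc]] := parallelepiped_lower x0 span dual B10.
(* Chosen so that the outer part costs at most half of [c]. The three factors have product at most 1
   * 2 * 2, whence [c / 8]. *)
pose eta1 := Order.min eta0 (c * delta ^+ 3 / (128 * k)).
exists eta1.
  by rewrite lt_min eta00 divr_gt0 ?mulr_gt0 ?exprn_gt0 //= ge_min lexx.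
exists (c / 8); first by rewrite divr_gt0.
move=> eta s t /andP[e0]; rewrite lt_min => /andP[e1 e2] s0 /andP[t0 ts].
pose a := s *: (a0 - eta *: w1); pose b := t *: b0.
have eta_in : 0 < eta < eta0 by rewrite e0.
have la : l1 a <= s * B1.
  rewrite l1Z gtr0_norm // ler_pM2l //.
  apply: le_trans (l1D _ _) _; rewrite -scaleNr l1Z normrN gtr0_norm //.
  have : eta * l1 w1 <= eta0 * l1 w1 by rewrite ler_wpM2r ?l1_ge0 // ltW.
  rewrite /B1; lra.
have lb : l1 b <= s * B1.
  rewrite l1Z ger0_norm //.
  have : t * l1 b0 <= s * B * l1 b0 by rewrite ler_wpM2r // l1_ge0.
  have : s * (B * l1 b0) <= s * B1 by rewrite ler_pM2l // /B1; lra.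
  lra.
have {Hc}Hc := Hc a b s s0 la lb.
set psi := fun p => wave a b x0 (vec3 p).
have h0 : 0 < k / s by rewrite divr_gt0.
pose KK := [set x | K (x - x0)].
have mK : measurable KK`'.
  apply: open_measurable_vec3; apply: open_comp; last exact: ef_open F.
  by move=> x _; apply: continuousB; [exact: cvg_id|exact: cst_continuous].
pose pos := (`]0, +oo[%classic : set R).
pose TT := coord_box x0 n1 n2 n3 pos pos pos.
have mpos : measurable (pos : set (measurableTypeR R)) by exact: measurable_itv.
have mT : measurable TT`' by exact: measurable_coord_box.
have TK : TT`' `<=` KK`'.
  by move=> p []; rewrite /pos /= !in_itv /= !andbT => *; exact: (ef_sub F).
have mD : measurable (KK `\` TT)`' by exact: measurableD.
have [d d0 Hd] := ef_in F eta_in.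
have [IK _] : cintegrable KK`' psi /\ normc (cint KK`' psi) <= 16 / (s * d) ^+ 3.
  apply: wave_decay => //; first exact: mulr_gt0.
  by move=> x Kx; rewrite /a dotZl -mulrA -mulrN ler_pM2l //; exact: Hd.
have IT := cintegrableS mT mK TK IK.
have [_ HD] : cintegrable (KK `\` TT)`' psi /\
    normc (cint (KK `\` TT)`' psi) <= 16 / (s * delta) ^+ 3.
  apply: wave_decay => //; first exact: mulr_gt0.
  move=> x [Kx nT]; rewrite /a dotZl -mulrA -mulrN ler_pM2l //.
  apply: (ef_out F) => //; rewrite leNgt; apply/negP => n1x; apply: nT.
  have [p2 p3] := ef_pos F Kx.
  by rewrite /TT /coord_box /pos /= !in_itv /= !andbT; split.
have := wave_parallelepiped dual h0 IT.
set u1 := 1 - wave _ _ _ (_ *: w1); set u2 := 1 - wave _ _ _ (_ *: w2).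
set u3 := 1 - wave _ _ _ (_ *: w3).
have [neg2 neg3] := ef_neg F eta_in.
have n2u (w : 'rV[R]_3) : dot (a0 - eta *: w1) w < 0 ->
    normc (1 - wave a b 0 (k / s *: w)) <= 2.
  move=> wn; apply: le_trans (le_normcD _ _) _.
  rewrite normcN normc1 normc_wave subr0 (_ : 2 = 1 + 1) // lerD2l expR_le1.
  by rewrite /a dotZl dotZr pmulr_rle0 // pmulr_rle0 // ltW.
have u2le : normc u2 <= 2 by exact: n2u.
have u3le : normc u3 <= 2 by exact: n2u.
(* Orthogonality of [b0] to [w1] removes the oscillation: only then is this factor small with eta,
   whatever [t] is. *)
have u1E : u1 = (1 - expR (- (k * eta)))%:C.
  rewrite /u1 /wave /wave_re /wave_im !dot0r !oppr0 !addr0.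
  have -> : dot b (k / s *: w1) = 0 by rewrite /b dotZl dotZr b0w1 !mulr0.
  have -> : dot a (k / s *: w1) = - (k * eta).
    rewrite /a dotZl dotZr dotDl dotNl dotZl (ef_a0w1 F) (ef_w1 F).
    by field; rewrite gt_eqF.
  rewrite cos0 sin0 mulr1 mulr0; apply: complex_eq; rewrite ?(ReD, ImD, ReN, ImN) //=.
  by rewrite oppr0 addr0.
have ek := expR_ge1Dx (- (k * eta)).
have ek0 := expR_gt0 (- (k * eta)).
have ek1 : expR (- (k * eta)) <= 1 by rewrite expR_le1 oppr_le0 mulr_ge0 // ltW.
have u1le : normc u1 <= 1 /\ normc u1 <= k * eta.
  by rewrite u1E normc_real ger0_norm ?subr_ge0 //; split; lra.
have -> : cint TT`' psi = cint KK`' psi - cint (KK `\` TT)`' psi.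
  by rewrite (cint_setD mT mK TK IK) addrK.
move=> QE; move: Hc; rewrite -/psi -QE mulrBr => Hc.
have {Hc}Hc := le_trans Hc (le_normcD _ _).
rewrite normcN !normcM in Hc.
set IKn := normc (cint KK`' psi) in Hc *.
have U : normc u1 * normc u2 * normc u3 * IKn <= 4 * IKn.
  rewrite ler_wpM2r ?normc_ge0 //.
  have -> : (4 : R) = 1 * 2 * 2 by ring.
  by do 2![apply: ler_pM; rewrite ?mulr_ge0 ?normc_ge0 //]; case: u1le.
have V : normc u1 * normc u2 * normc u3 * normc (cint (KK `\` TT)`' psi) <=
    k * eta * 2 * 2 * (16 / (s * delta) ^+ 3).
  do 3![apply: ler_pM; rewrite ?mulr_ge0 ?normc_ge0 //]; by case: u1le.
have W : k * eta * 2 * 2 * (16 / (s * delta) ^+ 3) <= c / 2 / s ^+ 3.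
  rewrite exprMn invfM.
  have -> : k * eta * 2 * 2 * (16 * (s ^- 3 * delta ^- 3)) =
            (64 * k * eta / delta ^+ 3) / s ^+ 3 by ring.
  rewrite ler_pM2r ?invr_gt0 ?exprn_gt0 // ler_pdivrMr ?exprn_gt0 //.
  by move: e2; rewrite ltr_pdivlMr ?mulr_gt0 //; lra.
have : c / 8 / s ^+ 3 = (c / s ^+ 3 - c / 2 / s ^+ 3) / 4 by field; rewrite gt_eqF.
lra.
Qed.

End ConeLowerBound.

(** With tau = rho /\ c, the term E . tau equals (E /\ rho) . c, which the first equation supplies,
    and (H /\ rho) . tau equals - (H . c) (rho . rho) because rho . c = 0. The two resulting terms
    in H . c cancel by the condition on rho . rho, so neither field survives. *)
Lemma maxwell_algebra (F : comPzRingType) (i m e : F)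
    (E H G1 G2 dE dH rho c : 'I_3 -> F) :
  i * i = -1 ->
  (forall l, G1 l + i * m * H l =
     E (l + 1) * rho (l + 2%:R) - E (l + 2%:R) * rho (l + 1) + dE l) ->
  (forall l, G2 l - i * e * E l =
     H (l + 1) * rho (l + 2%:R) - H (l + 2%:R) * rho (l + 1) + dH l) ->
  \sum_k rho k * c k = 0 -> \sum_k rho k * rho k = - (m * e) ->
  let tau l := rho (l + 1) * c (l + 2%:R) - rho (l + 2%:R) * c (l + 1) in
  \sum_k G2 k * tau k = i * e * (\sum_k G1 k * c k) + \sum_k dH k * tau k -
    i * e * (\sum_k dE k * c k).
Proof.
move=> ii eq1 eq2 rc rr tau; rewrite /tau {tau}.
have := eq1 0; have := eq1 1; have := eq1 2%:R.
have := eq2 0; have := eq2 1; have := eq2 2%:R.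
move: rc rr; rewrite !sum3E !add0r ord3_11 ord3_12 ord3_21 ord3_22.
move=> rc rr e5 e4 e3 e2 e1 e0.
have {e0}e0 : G1 0 = - (i * m * H 0) + (E 1 * rho 2%:R - E 2%:R * rho 1 + dE 0).
  by rewrite -e0; ring.
have {e1}e1 : G1 1 = - (i * m * H 1) + (E 2%:R * rho 0 - E 0 * rho 2%:R + dE 1).
  by rewrite -e1; ring.
have {e2}e2 : G1 2%:R = - (i * m * H 2%:R) + (E 0 * rho 1 - E 1 * rho 0 + dE 2%:R).
  by rewrite -e2; ring.
have {e3}e3 : G2 0 = i * e * E 0 + (H 1 * rho 2%:R - H 2%:R * rho 1 + dH 0).
  by rewrite -e3; ring.
have {e4}e4 : G2 1 = i * e * E 1 + (H 2%:R * rho 0 - H 0 * rho 2%:R + dH 1).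
  by rewrite -e4; ring.
have {e5}e5 : G2 2%:R = i * e * E 2%:R + (H 0 * rho 1 - H 1 * rho 0 + dH 2%:R).
  by rewrite -e5; ring.
rewrite e0 e1 e2 e3 e4 e5.
apply/eqP; rewrite -subr_eq0; apply/eqP.
pose Hr := H 0 * rho 0 + H 1 * rho 1 + H 2%:R * rho 2%:R.
pose Hc := H 0 * c 0 + H 1 * c 1 + H 2%:R * c 2%:R.
transitivity (Hr * (rho 0 * c 0 + rho 1 * c 1 + rho 2%:R * c 2%:R) -
  Hc * ((rho 0 * rho 0 + rho 1 * rho 1 + rho 2%:R * rho 2%:R) + m * e) +
  (i * i + 1) * (m * e) * Hc).
  by rewrite /Hr /Hc; ring.
by rewrite rc rr ii; ring.
Qed.

Section CrossC.
Context {R : realType}.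
Implicit Types u v w : 'rV[R]_3.

Lemma cross_cross u v w : cross u (cross v w) = dot u w *: v - dot u v *: w.
Proof.
apply/rowP; apply: ord3P; rewrite ?(cross0, cross1, cross2) !dotE !mxE
  ?(cross0, cross1, cross2) ?add0r ?ord3_11 ?ord3_12 ?ord3_21 ?ord3_22; ring.
Qed.

End CrossC.

(** * Asymptotics of the moments *)

Section BigO.
Context {R : realType}.

Definition bigO (g : R -> R) (f : R -> R[i]) :=
  exists2 C, 0 <= C & forall s, 1 <= s -> normc (f s) <= C * g s.

Lemma bigOD g f1 f2 : bigO g f1 -> bigO g f2 -> bigO g (fun s => f1 s + f2 s).
Proof.
move=> [C1 C10 H1] [C2 C20 H2]; exists (C1 + C2) => [|s s1]; first exact: addr_ge0.
apply: le_trans (le_normcD _ _) _; rewrite mulrDl.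
by apply: lerD; [exact: H1|exact: H2].
Qed.

Lemma bigON g f : bigO g f -> bigO g (fun s => - f s).
Proof. by move=> [C C0 H]; exists C => // s s1; rewrite normcN H. Qed.

Lemma bigO_sum g (f : 'I_3 -> R -> R[i]) : (forall k, bigO g (f k)) ->
  bigO g (fun s => \sum_k f k s).
Proof.
move=> H; rewrite (_ : (fun s => _) = fun s => f 0 s + f 1 s + f 2%:R s).
  by apply: bigOD => //; apply: bigOD.
by apply/funext => s; rewrite sum3E.
Qed.

Lemma bigOM g1 g2 f1 f2 : bigO g1 f1 -> bigO g2 f2 ->
  bigO (fun s => g1 s * g2 s) (fun s => f1 s * f2 s).
Proof.
move=> [C1 C10 H1] [C2 C20 H2]; exists (C1 * C2) => [|s s1]; first exact: mulr_ge0.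
by rewrite normcM mulrACA; apply: ler_pM; rewrite ?normc_ge0 ?H1 ?H2.
Qed.

Lemma bigO_cst (c : R[i]) : bigO (fun=> 1) (fun=> c).
Proof. by exists (normc c) => [|s _]; rewrite ?normc_ge0 // mulr1. Qed.

Lemma bigOW g1 g2 f (C : R) : 0 <= C -> (forall s, 1 <= s -> g1 s <= C * g2 s) ->
  bigO g1 f -> bigO g2 f.
Proof.
move=> C0 H [C1 C10 H1]; exists (C1 * C) => [|s s1]; first exact: mulr_ge0.
by apply: le_trans (H1 s s1) _; rewrite -mulrA ler_wpM2l // H.
Qed.

End BigO.

Section Rates.
Context {R : realType} (alpha : R).
Hypothesis alpha01 : 0 < alpha < 1.

Definition decay (s : R) : R := s `^ (- alpha).

Lemma decay_gt0 s : 1 <= s -> 0 < decay s.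
Proof. by move=> s1; rewrite powR_gt0 // (lt_le_trans _ s1). Qed.

Lemma inv_le_decay s : 1 <= s -> s^-1 <= decay s.
Proof.
move=> s1; have s0 : 0 <= s by rewrite (le_trans _ s1).
rewrite -powR_inv1 //; apply: ler_powR => //.
by case/andP: alpha01 => _ /ltW; rewrite lerN2.
Qed.

Lemma le_mul_decay s : 1 <= s -> 1 <= s * decay s.
Proof.
move=> s1; have s0 : 0 < s by rewrite (lt_le_trans _ s1).
by rewrite -ler_pdivrMl // mulr1 inv_le_decay.
Qed.

Lemma exp_le_decay (c : R) : 0 < c -> exists2 C, 0 <= C &
  forall s, 1 <= s -> expR (- (c * s)) <= C * (s ^- 3 * decay s).
Proof.
(* 24 = 4!: the quartic term of the exponential series yields [s ^- 3] and one more inverse power,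
   which is at most [decay s]. *)
move=> c0; exists (24 / c ^+ 4) => [|s s1].
  by rewrite divr_ge0 // exprn_ge0 // ltW.
have s0 : 0 < s by rewrite (lt_le_trans _ s1).
have cs0 : 0 < c * s by rewrite mulr_gt0.
apply: le_trans (_ : 24 / c ^+ 4 * (s ^- 3 * s^-1) <= _); last first.
  rewrite ler_pM2l ?divr_gt0 ?exprn_gt0 // ler_pM2l ?invr_gt0 ?exprn_gt0 //.
  exact: inv_le_decay.
have -> : 24 / c ^+ 4 * (s ^- 3 * s^-1) = ((c * s) ^+ 4 / 24)^-1.
  by field; rewrite !gt_eqF.
rewrite expRN lef_pV2 ?posrE ?expR_gt0 ?divr_gt0 ?exprn_gt0 //.
have := @expR_ge1Dxn R (c * s) 3 (ltW cs0).
rewrite (_ : 4`!%:R = 24) //; first by apply: le_trans; rewrite lerDr.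
Qed.

Lemma decay_to0 (x C : R) : 0 <= x -> (forall s, 1 <= s -> x <= C * decay s) -> x = 0.
Proof.
move=> x0 H; apply/eqP; rewrite eq_le x0 andbT leNgt; apply/negP => {}x0.
have [a0 a1] := andP alpha01.
have C0 : 0 <= `|C| by [].
pose M := 1 + `|C| / x.
have M1 : 1 <= M by rewrite lerDl divr_ge0 // ltW.
have M0 : 0 < M by rewrite (lt_le_trans _ M1).
(* Then [decay s] is the inverse of [M], and [M] was taken larger than [C / x]. *)
pose s := M `^ (alpha^-1).
have s1 : 1 <= s.
  apply: le_trans (_ : 1 `^ alpha^-1 <= _); first by rewrite powR1.
  by apply: ge0_ler_powR; rewrite ?nnegrE ?invr_ge0 //; apply/ltW.
have := H s s1; rewrite /decay powRN /s -powRrM mulVf ?gt_eqF // powRr1; last exact: ltW.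
rewrite ler_pdivlMr // /M mulrDr mulr1 mulrCA mulfV ?gt_eqF // mulr1.
have := ler_norm C; lra.
Qed.

(** After multiplication by s^alpha this is t^alpha <= 1 + t at t = s l. It trades the fractional
    power for an affine factor that the exponential absorbs. *)
Lemma powR_decay (s l : R) : 1 <= s -> 0 <= l -> l `^ alpha <= decay s * (1 + s * l).
Proof.
move=> s1 l0; have s0 : 0 < s by rewrite (lt_le_trans _ s1).
rewrite /decay powRN mulrC ler_pdivlMr ?powR_gt0 // -powRM ?(ltW s0) // mulrC.
have [a0 a1] := andP alpha01.
have sl0 : 0 <= s * l by rewrite mulr_ge0 // ltW.
have [sl1|sl1] := leP (s * l) 1.
  apply: le_trans (_ : 1 <= _); last by rewrite lerDl.
  apply: le_trans (_ : 1 `^ alpha <= _); last by rewrite powR1.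
  by apply: ge0_ler_powR; rewrite ?nnegrE //; apply/ltW.
apply: le_trans (ler1_powR _ _) _; rewrite ?ltW //.
by rewrite ltrDr.
Qed.

End Rates.

Section Estimates.
Context {R : realType}.
Local Notation mu3 := (@lebesgue3 R).
Local Notation "A `'" := (@vec3 R @^-1` A) (at level 2, format "A `'").
Variables (x0 : 'rV[R]_3) (r0 alpha d : R) (KK : set 'rV[R]_3) (a b : 'rV[R]_3).
Variable tt : R -> R.
Hypothesis r00 : 0 < r0.
Hypothesis alpha01 : 0 < alpha < 1.
Hypothesis oK : open KK.
Hypothesis d0 : 0 < d.
Hypothesis HK : forall x, KK x -> dot a (x - x0) <= - (d * l1 (x - x0)).
Local Notation D := (KK `&` eball x0 r0).
Local Notation psi s := (wave (s *: a) (tt s *: b) x0).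
Local Notation cut := (cutoff x0 r0).
Local Notation mom s := (moment x0 r0 D (s *: a) (tt s *: b)).

Lemma open_truncated : open D.
Proof. by apply: openI => //; exact: eball_open. Qed.

Let mD : measurable D`' := measurable_domain open_truncated.
Let mK : measurable KK`' := open_measurable_vec3 oK.
Let DB : D `<=` eball x0 r0. Proof. by move=> x []. Qed.

Lemma psi_decay s x : 0 < s -> KK x ->
  normc (psi s x) <= expR (- (s * d * l1 (x - x0))).
Proof.
move=> s0 Kx; rewrite normc_wave ler_expR dotZl -mulrA -mulrN ler_pM2l //.
exact: HK.
Qed.

Lemma psi_measurable s A : cmeasurable A (fun p => psi s (vec3 p)).
Proof. exact/ccontinuous_cmeasurable/ccontinuous_wave. Qed.

Lemma decaying_integral_ae (A : set (coord3 R)) (f : coord3 R -> R[i]) (C k : R) :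
  measurable A -> cintegrable A f -> 0 < k -> 0 <= C ->
  {ae mu3, forall p, A p -> normc (f p) <= C * expR (- (k * l1 (vec3 p - x0)))} ->
  normc (cint A f) <= C * 16 / k ^+ 3.
Proof.
move=> mA If k0 C0 fC.
have I := exp_l1_integrable x0 mA k0.
have IC : mu3.-integrable A
    (EFin \o (fun p => C * expR (- (k * l1 (vec3 p - x0))))).
  by apply: eq_integrable (integrableZl mA C I).
apply: le_trans (cint_le_ae mA If IC _ fC) _.
  by move=> p _; rewrite mulr_ge0 // expR_ge0.
rewrite RintegralZl //.
have -> : C * 16 / k ^+ 3 = 2 * (C * (8 / k ^+ 3)) by ring.
by rewrite ler_pM2l // ler_wpM2l // Rintegral_exp_l1.
Qed.

Lemma cut_psi_integrable s (f : coord3 R -> R[i]) : cintegrable D`' f ->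
  cintegrable D`' (fun p => f p * ((cut (vec3 p))%:C * psi s (vec3 p))).
Proof.
move=> If; exact: (cintegrable_mulc open_truncated DB If
  (ccontinuous_cut_wave x0 r0 (s *: a) (tt s *: b))).
Qed.

Lemma normc_cut_psi s x : 0 < s -> KK x ->
  normc ((cut x)%:C * psi s x) <= expR (- (s * d * l1 (x - x0))).
Proof.
move=> s0 Kx; rewrite normcM normc_real.
have /andP[c0 c1] := cutoff_le1 x0 r0 x.
rewrite ger0_norm //; apply: le_trans (_ : 1 * normc (psi s x) <= _).
  by rewrite ler_wpM2r // normc_ge0.
by rewrite mul1r psi_decay.
Qed.

Lemma cintegrable1 : cintegrable D`' (fun=> 1).
Proof.
by split; [exact: (integrable_cst_domain r00 open_truncated DB 1)|
  exact: (integrable_cst_domain r00 open_truncated DB 0)].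
Qed.

(** Half of the exponent gives uniform smallness away from the apex, the other half is kept for
    integrability. *)
Lemma far_decay s x : 0 < s -> r0 / 2 <= l1 (x - x0) ->
  expR (- (s * d * l1 (x - x0))) <=
  expR (- (d * r0 / 4 * s)) * expR (- (s * d / 2 * l1 (x - x0))).
Proof.
move=> s0 rl; rewrite -expRD ler_expR.
have : s * d / 2 * (r0 / 2) <= s * d / 2 * l1 (x - x0).
  by rewrite ler_pM2l // divr_gt0 // mulr_gt0.
lra.
Qed.

Lemma near_l1 x : l1 (x - x0) < r0 / 2 -> enorm (x - x0) < r0 / 2.
Proof. by apply: le_lt_trans; exact: enorm_le_l1. Qed.

(** Cut-off and truncation change nothing where [l1 (x - x0) < r0 / 2], so both errors are
    exponentially small in [s]. *)
Lemma truncation_bigO : bigO (fun s => s ^- 3 * decay alpha s)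
  (fun s => cint KK`' (fun p => psi s (vec3 p)) - mom s (fun=> 1)).
Proof.
have c0 : 0 < d * r0 / 4 by rewrite divr_gt0 // mulr_gt0.
have [C C0 HC] := exp_le_decay alpha01 c0.
have k0 : 0 < 256 / d ^+ 3 by apply: divr_gt0; rewrite ?ltr0n ?exprn_gt0.
exists (256 / d ^+ 3 * C) => [|s s1]; first exact: (mulr_ge0 (ltW k0) C0).
have s0 : 0 < s by rewrite (lt_le_trans _ s1).
have sd0 : 0 < s * d by rewrite mulr_gt0.
have sd20 : 0 < s * d / 2 by rewrite divr_gt0.
pose E := expR (- (d * r0 / 4 * s)).
have E0 : 0 <= E by exact: expR_ge0.
have H x : KK x -> dot (s *: a) (x - x0) <= - (s * d * l1 (x - x0)).
  by move=> Kx; rewrite dotZl -mulrA -mulrN ler_pM2l //; exact: HK.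
have [IK _] := @wave_decay _ x0 (s *: a) (tt s *: b) KK _ mK sd0 H.
have DK : D`' `<=` KK`' by move=> p [].
have ID := cintegrableS mD mK DK IK.
have mKD : measurable (KK`' `\` D`') by exact: measurableD.
rewrite (cint_setD mD mK DK IK).
have IC := cut_psi_integrable s cintegrable1.
rewrite addrAC /moment -cintB //.
have B1 : normc (cint D`' (fun p => psi s (vec3 p) -
    1 * ((cut (vec3 p))%:C * psi s (vec3 p)))) <= E * 16 / (s * d / 2) ^+ 3.
  have IB := cintegrableB mD ID IC.
  apply: (fun H => (decaying_integral (x0 := x0) mD (cintegrable_measurable IB) sd20 E0 H).2) => p [Kp _].
  rewrite mul1r -{1}[psi s (vec3 p)]mul1r -mulrBl normcM.
  have [lr|lr] := leP (r0 / 2) (l1 (vec3 p - x0)).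
    apply: le_trans (far_decay s0 lr); apply: le_trans (psi_decay s0 Kp).
    have /andP[c00 c01] := cutoff_le1 x0 r0 (vec3 p).
    have -> : 1 - (cut (vec3 p))%:C = (1 - cut (vec3 p))%:C by rewrite rmorphB rmorph1.
    rewrite normc_real ger0_norm ?subr_ge0 //.
    by rewrite ler_piMl ?normc_ge0 // gerBl.
  have lr' := ltW (near_l1 lr); rewrite cutoff_eq1 // subrr normc0 mul0r.
  by rewrite mulr_ge0 // expR_ge0.
have B2 : normc (cint (KK`' `\` D`') (fun p => psi s (vec3 p))) <=
    E * 16 / (s * d / 2) ^+ 3.
  apply: (fun H => (decaying_integral (x0 := x0) mKD (psi_measurable _ _) sd20 E0 H).2) => p [Kp nDp].
  apply: le_trans (psi_decay s0 Kp) _; apply: far_decay => //.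
  rewrite leNgt; apply/negP => lr; apply: nDp; split => //.
  rewrite /eball /=; apply: lt_trans (near_l1 lr) _.
  by have := r00; lra.
apply: le_trans (le_normcD _ _) _; apply: le_trans (lerD B1 B2) _.
have -> : E * 16 / (s * d / 2) ^+ 3 + E * 16 / (s * d / 2) ^+ 3 =
    256 / d ^+ 3 * (E / s ^+ 3) by field; rewrite !gt_eqF.
rewrite -[leRHS]mulrA (ler_pM2l k0).
apply: le_trans (_ : E * 1 <= _).
  by rewrite ler_wpM2l // invf_le1 ?exprn_gt0 // exprn_ege1.
by rewrite mulr1; exact: HC.
Qed.

Lemma moment_bounded_bigO (f : 'rV[R]_3 -> R[i]) (C : R) :
  cintegrable D`' (fun p => f (vec3 p)) -> 0 <= C ->
  {ae mu3, forall p, D`' p -> normc (f (vec3 p)) <= C} ->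
  bigO (fun s => s ^- 3) (fun s => mom s f).
Proof.
move=> If C0 fC; exists (C * 16 / d ^+ 3) => [|s s1].
  by rewrite divr_ge0 ?exprn_ge0 ?mulr_ge0 // ltW.
have s0 : 0 < s by rewrite (lt_le_trans _ s1).
have sd0 : 0 < s * d by rewrite mulr_gt0.
have -> : C * 16 / d ^+ 3 * s ^- 3 = C * 16 / (s * d) ^+ 3.
  by field; rewrite !gt_eqF.
apply: decaying_integral_ae => //; first exact: cut_psi_integrable.
apply: filterS fC => p fC Dp; rewrite normcM.
apply: ler_pM; rewrite ?normc_ge0 ?fC //.
by apply: normc_cut_psi => //; case: Dp.
Qed.

Lemma moment_hoelder_bigO (f : 'rV[R]_3 -> R[i]) (C : R) :
  cintegrable D`' (fun p => f (vec3 p)) -> 0 <= C ->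
  {ae mu3, forall p, D`' p -> normc (f (vec3 p)) <= C * enorm (vec3 p - x0) `^ alpha} ->
  bigO (fun s => s ^- 3 * decay alpha s) (fun s => mom s f).
Proof.
(* [Cd] is such that [1 + s * L <= Cd * (1 + s * d / 2 * L)], which half of the exponential
   absorbs. *)
move=> If C0 fC; pose Cd := 1 + 2 / d.
have Cd0 : 0 < Cd by rewrite ltr_wpDr // divr_ge0 // ltW.
exists (C * Cd * 128 / d ^+ 3) => [|s s1].
  by rewrite divr_ge0 ?exprn_ge0 ?mulr_ge0 // ltW.
have s0 : 0 < s by rewrite (lt_le_trans _ s1).
have sd0 : 0 < s * d by rewrite mulr_gt0.
have sd20 : 0 < s * d / 2 by rewrite divr_gt0.
have de0 := decay_gt0 alpha s1.
have -> : C * Cd * 128 / d ^+ 3 * (s ^- 3 * decay alpha s) =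
    (C * Cd * decay alpha s) * 16 / (s * d / 2) ^+ 3.
  by field; rewrite !gt_eqF.
apply: decaying_integral_ae => //.
- exact: cut_psi_integrable.
- by rewrite !mulr_ge0 // ltW.
apply: filterS fC => p fC Dp; rewrite normcM.
have [Kp _] := Dp; set L := l1 (vec3 p - x0).
have L0 : 0 <= L by exact: l1_ge0.
have H1 : normc (f (vec3 p)) <= C * (decay alpha s * (1 + s * L)).
  apply: le_trans (fC Dp) _; rewrite ler_wpM2l //.
  apply: le_trans (powR_decay alpha01 s1 L0).
  apply: ge0_ler_powR; rewrite ?nnegrE ?enorm_ge0 ?enorm_le_l1 //.
  by case/andP: alpha01 => /ltW.
have H2 := normc_cut_psi s0 Kp; rewrite -/L in H2.
apply: le_trans (ler_pM (normc_ge0 _) (normc_ge0 _) H1 H2) _.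
have -> : expR (- (s * d * L)) = expR (- (s * d / 2 * L)) * expR (- (s * d / 2 * L)).
  by rewrite -expRD; congr expR; field.
rewrite !mulrA ler_wpM2r ?expR_ge0 //.
have -> : C * decay alpha s * (1 + s * L) * expR (- (s * d / 2 * L)) =
  C * decay alpha s * ((1 + s * L) * expR (- (s * d / 2 * L))) by ring.
have -> : C * Cd * decay alpha s = C * decay alpha s * Cd by ring.
apply: ler_wpM2l; first by rewrite mulr_ge0 // ltW.
rewrite expRN ler_pdivrMr ?expR_gt0 //.
apply: le_trans (_ : Cd * (1 + s * d / 2 * L) <= _); last first.
  by rewrite ler_pM2l // expR_ge1Dx.
have sL : 0 <= s * L by rewrite mulr_ge0 // ltW.
have -> : Cd * (1 + s * d / 2 * L) = (1 + s * L) + (2 / d + d / 2 * (s * L)).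
  by rewrite /Cd; field; rewrite gt_eqF.
rewrite lerDl; apply: addr_ge0; first by rewrite divr_ge0 // ltW.
by apply: mulr_ge0 => //; rewrite divr_ge0 // ltW.
Qed.

Lemma normc_combination (z1 z2 : R[i]) (t1 t2 C1 C2 : R) : `|t1| <= C1 -> `|t2| <= C2 ->
  normc (z1 * t2%:C - z2 * t1%:C) <=
  C2 * (1 * `|complex.Re z1| + 1 * `|complex.Im z1|) +
  C1 * (1 * `|complex.Re z2| + 1 * `|complex.Im z2|).
Proof.
have T (z : R[i]) (t C' : R) : `|t| <= C' ->
    normc (z * t%:C) <= C' * (1 * `|complex.Re z| + 1 * `|complex.Im z|).
  move=> tC; rewrite normcM normc_real !mul1r mulrC.
  by apply: ler_pM => //; [exact: normc_ge0|exact: normc_leD].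
move=> H1 H2; apply: le_trans (le_normcD _ _) _; rewrite normcN.
by apply: lerD; exact: T.
Qed.

(** The cut-off is locally constant within distance [r0 / 2]. Beyond it the wave is uniformly small,
    and the field, which has no pointwise bound, enters through its integral. *)
Lemma defect_bigO (u : cfield R) m1 m2 : Hcurl D u ->
  bigO (fun s => s ^- 3 * decay alpha s)
    (fun s => cutoff_defect x0 r0 D u (s *: a) (tt s *: b) m1 m2).
Proof.
move=> Hu.
have I k := Hcurl_cintegrable r00 open_truncated DB Hu k.
have Bk k : exists2 Ck, 0 <= Ck & forall x, cube x0 r0 x -> `|partial k cut x| <= Ck.
  by apply/continuous_cube_bounded/elementary_continuous/elementary_partial/elementary_cutoff.
have [C1 C10 HC1] := Bk m1; have [C2 C20 HC2] := Bk m2.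
have [N1 N2] := I m1; have [N3 N4] := I m2.
have P1 := integrable_lincomb 1 1 mD (integrable_norm N1) (integrable_norm N2).
have P2 := integrable_lincomb 1 1 mD (integrable_norm N3) (integrable_norm N4).
have P := integrable_lincomb C2 C1 mD P1 P2.
set h := (fun p => C2 * _ + _) in P.
have h0 p : 0 <= h p by rewrite /h /= !mul1r; rewrite !(addr_ge0, mulr_ge0).
have c0 : 0 < d * r0 / 2 by rewrite divr_gt0 // mulr_gt0.
have [C C0 HC] := exp_le_decay alpha01 c0.
pose J := \int[mu3]_(p in D`') h p.
have J0 : 0 <= J by apply: Rintegral_ge0.
exists (2 * J * C) => [|s s1]; first by rewrite !mulr_ge0.
have s0 : 0 < s by rewrite (lt_le_trans _ s1).
pose e := expR (- (d * r0 / 2 * s)).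
have e0 : 0 <= e by exact: expR_ge0.
have Ih : mu3.-integrable D`' (EFin \o (fun p => e * h p)).
  by apply: eq_integrable (integrableZl mD e P).
have E := cutoff_defect_cintegrable r00 open_truncated DB Hu (s *: a) (tt s *: b) m1 m2.
have L := cint_le mD E Ih.
apply: le_trans (L _) _; last first.
  rewrite RintegralZl // -/J.
  have -> : 2 * (e * J) = 2 * J * e by ring.
  by rewrite -[leRHS]mulrA; apply: ler_wpM2l; [rewrite mulr_ge0|exact: HC].
move=> p Dp; have [Kp _] := Dp.
have cp : cube x0 r0 (vec3 p) by exact: (domain_cube DB).
rewrite normcM.
have [lr|lr] := ltP (enorm (vec3 p - x0)) (r0 / 2).
  rewrite !partial_cutoff_eq0 // !mulr0 subrr normc0 mul0r.
  by rewrite mulr_ge0.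
rewrite mulrC; apply: ler_pM; rewrite ?normc_ge0 //.
  apply: le_trans (psi_decay s0 Kp) _; rewrite ler_expR lerN2.
  have -> : d * r0 / 2 * s = s * d * (r0 / 2) by ring.
  by rewrite ler_pM2l ?mulr_gt0 // (le_trans lr) // enorm_le_l1.
exact: (normc_combination _ _ (HC1 _ cp) (HC2 _ cp)).
Qed.

End Estimates.

(** * Separating coefficients and reaching the apex *)

Section Apex.
Context {R : realType}.
Local Notation mu3 := (@lebesgue3 R).
Local Notation "A `'" := (@vec3 R @^-1` A) (at level 2, format "A `'").

(** The second difference over [h], [2 * h], [3 * h] eliminates the part affine in the parameter;
    its coefficient at [X] is nonzero because sqrt(1 + t^2) is not affine. *)
Lemma three_points (X Y Z : R[i]) (e : R) : 0 < e ->
  (forall h, 0 < h < e -> - (Num.sqrt (1 + h ^+ 2))%:C * X + Y + h%:C * Z = 0) ->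
  [/\ X = 0, Y = 0 & Z = 0].
Proof.
move=> e0 H; pose h := e / 4.
have h0 : 0 < h by rewrite divr_gt0.
pose S (k : R) := Num.sqrt (1 + (k * h) ^+ 2).
have SS k : S k ^+ 2 = 1 + (k * h) ^+ 2.
  by rewrite sqr_sqrtr // addr_ge0 // sqr_ge0.
have E k : 0 < k <= 3 -> - (S k)%:C * X + Y + (k * h)%:C * Z = 0.
  move=> /andP[k0 k3]; apply: H; rewrite mulr_gt0 //=.
  have : k * h <= 3 * h by rewrite ler_pM2r.
  by rewrite /h; lra.
have E1 := E 1; have E2 := E 2; have E3 := E 3.
have {}E1 : - (S 1)%:C * X + Y + (1 * h)%:C * Z = 0 by apply: E1; lra.
have {}E2 : - (S 2)%:C * X + Y + (2 * h)%:C * Z = 0 by apply: E2; lra.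
have {}E3 : - (S 3)%:C * X + Y + (3 * h)%:C * Z = 0 by apply: E3; lra.
have c1 : (1 * h)%:C = h%:C :> R[i] by rewrite mul1r.
have c2 : (2 * h)%:C = 2 * h%:C :> R[i] by rewrite !mulr_natl rmorphMn.
have c3 : (3 * h)%:C = 3 * h%:C :> R[i] by rewrite !mulr_natl rmorphMn.
rewrite c1 in E1; rewrite c2 in E2; rewrite c3 in E3.
have cS : (S 1 + S 3 - 2 * S 2)%:C = (S 1)%:C + (S 3)%:C - 2 * (S 2)%:C :> R[i].
  by rewrite rmorphB rmorphD !mulr_natl rmorphMn.
have S1 : 0 <= S 1 by exact: sqrtr_ge0.
have S3 : 0 <= S 3 by exact: sqrtr_ge0.
(* Equality, squared twice, would give (1 + h^2)(1 + 9 h^2) = (1 + 3 h^2)^2, hence h = 0. *)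
have dn : S 1 + S 3 - 2 * S 2 != 0.
  apply/eqP => eq.
  have p13 : S 1 * S 3 = 1 + 3 * h ^+ 2.
    have : (S 1 + S 3) ^+ 2 = (2 * S 2) ^+ 2 by congr (_ ^+ 2); lra.
    by rewrite sqrrD exprMn !SS => h1; lra.
  have : (S 1 * S 3) ^+ 2 = (1 + 3 * h ^+ 2) ^+ 2 by rewrite p13.
  rewrite exprMn !SS => h1.
  have : h ^+ 2 = 0 by lra.
  by move=> /eqP; rewrite sqrf_eq0 gt_eqF.
have X0 : (S 1 + S 3 - 2 * S 2)%:C * X = 0.
  transitivity (- ((- (S 1)%:C * X + Y + h%:C * Z) +
    (- (S 3)%:C * X + Y + 3 * h%:C * Z) -
    2 * (- (S 2)%:C * X + Y + 2 * h%:C * Z))).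
    by rewrite cS; ring.
  by rewrite E1 E2 E3 mulr0 subr0 addr0 oppr0.
have {}X0 : X = 0.
  move/eqP: X0; rewrite mulf_eq0 => /orP[/eqP/complexI /eqP|/eqP//].
  by rewrite (negPf dn).
have Z0 : h%:C * Z = 0.
  transitivity ((- (S 2)%:C * X + Y + 2 * h%:C * Z) -
    (- (S 1)%:C * X + Y + h%:C * Z)).
    by rewrite X0; ring.
  by rewrite E1 E2 subr0.
have {}Z0 : Z = 0.
  move/eqP: Z0; rewrite mulf_eq0 => /orP[/eqP/complexI /eqP|/eqP//].
  by rewrite gt_eqF.
by split => //; rewrite -E1 X0 Z0; ring.
Qed.

Lemma apex_in_closure (K : set 'rV[R]_3) a0 w1 w2 w3 n1 n2 n3 eta0 delta
    (x0 : 'rV[R]_3) (r0 : R) :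
  edge_frame K a0 w1 w2 w3 n1 n2 n3 eta0 delta -> 0 < r0 ->
  closure ([set x | K (x - x0)] `&` eball x0 r0) x0.
Proof.
move=> F r00 B /nbhs_ballP[e /= e0 eB].
pose W := w1 + w2 + w3; pose m := Order.min e r0.
have m0 : 0 < m by rewrite lt_min e0.
have L0 : 0 < l1 W + 1 by rewrite ltr_wpDl // l1_ge0.
pose h := m / 2 / (l1 W + 1).
have h0 : 0 < h by rewrite !divr_gt0.
have hW : l1 (h *: W) < m.
  rewrite l1Z gtr0_norm // /h mulrAC ltr_pdivrMr //.
  have := l1_ge0 W; nra.
have [hm1 hm2] : l1 (h *: W) < e /\ l1 (h *: W) < r0.
  by move: hW; rewrite lt_min => /andP.
exists (x0 + h *: W); split.
  split; last by rewrite /eball /= addrC addKr (le_lt_trans (enorm_le_l1 _)).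
  rewrite /= addrC addKr.
  have [] := ef_dual F h h h; rewrite -!scalerDr -/W => d1 d2 d3.
  by apply: (ef_sub F); rewrite ?d1 ?d2 ?d3.
apply: eB; rewrite mx_norm_ball /ball_ /= opprD addrA subrr sub0r normrN.
rewrite [`|_|]mx_normrE; apply/bigmax_ltP; split => // -[i j] _ /=.
by rewrite ord1; apply: le_lt_trans (abs_coord_le_l1 _ _) _.
Qed.

Lemma hoelder_apex alpha (D : set 'rV[R]_3) (F : cfield R) (x0 : 'rV[R]_3) :
  hoelder_on alpha (closure D) F -> closure D x0 ->
  exists2 C, 0 <= C & forall x k, D x ->
    normc (F x 0 k - F x0 0 k) <= C * enorm (x - x0) `^ alpha.
Proof.
move=> [C HC] cx0; exists `|C| => // x k Dx.
have := HC x x0 (subset_closure Dx) cx0 => H.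
have : normc ((F x - F x0) 0 k) <= cnorm (F x - F x0) by exact: normc_le_cnorm.
rewrite !mxE => /le_trans; apply; apply: le_trans H _.
by rewrite ler_wpM2r ?powR_ge0 // ler_norm.
Qed.

End Apex.

(** * The relation satisfied by the source at the apex *)

Section ApexRelation.
Context {R : realType}.
Local Notation mu3 := (@lebesgue3 R).
Local Notation "A `'" := (@vec3 R @^-1` A) (at level 2, format "A `'").
Variables (x0 : 'rV[R]_3) (r0 alpha : R) (KK : set 'rV[R]_3).
Hypothesis r00 : 0 < r0.
Hypothesis alpha01 : 0 < alpha < 1.
Hypothesis oK : open KK.
Local Notation D := (KK `&` eball x0 r0).
Variables (E H F1 F2 : cfield R) (m e : R).
Hypothesis HE : Hcurl D E.
Hypothesis HH : Hcurl D H.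
Local Notation Gamma := (boundary D `\` boundary (eball x0 r0)).
Hypothesis TE : tangential_trace_zero D Gamma E.
Hypothesis TH : tangential_trace_zero D Gamma H.
Hypothesis me0 : 0 < m * e.
Hypothesis eq1 : ae_in D (fun x => curl D E x - ('i%C * m%:C) *: H x = F1 x).
Hypothesis eq2 : ae_in D (fun x => curl D H x + ('i%C * e%:C) *: E x = F2 x).
Variables (C1 C2 : R).
Hypothesis C10 : 0 <= C1.
Hypothesis C20 : 0 <= C2.
Hypothesis HF1 : forall x k, D x ->
  normc (F1 x 0 k - F1 x0 0 k) <= C1 * enorm (x - x0) `^ alpha.
Hypothesis HF2 : forall x k, D x ->
  normc (F2 x 0 k - F2 x0 0 k) <= C2 * enorm (x - x0) `^ alpha.

Let oD : open D := open_truncated (x0 := x0) (r0 := r0) oK.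
Let DB : D `<=` eball x0 r0. Proof. by move=> x []. Qed.
Let mD : measurable D`' := measurable_domain oD.

Variables (a b : 'rV[R]_3) (d B q c1 : R).
Hypothesis d0 : 0 < d.
Hypothesis HK : forall x, KK x -> dot a (x - x0) <= - (d * l1 (x - x0)).
Hypothesis aa : dot a a = q.
Hypothesis bb : dot b b = 1.
Hypothesis ab : dot a b = 0.
Hypothesis q1 : 1 <= q.
Hypothesis B1 : 1 <= B.
Hypothesis qB : q + m * e <= B.

Definition im_speed (s : R) : R := Num.sqrt (s ^+ 2 * q + m * e).
Local Notation tt := im_speed.
Local Notation psi s := (wave (s *: a) (tt s *: b) x0).
Local Notation mom s := (moment x0 r0 D (s *: a) (tt s *: b)).
Local Notation rho s := (freq (s *: a) (tt s *: b)).
Local Notation cc := (cross a b).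
Local Notation z := (F2 x0 0).

Hypothesis c10 : 0 < c1.
Hypothesis lower : forall s t, 0 < s -> 0 <= t <= s * B ->
  c1 / s ^+ 3 <= normc (cint KK`' (fun p => wave (s *: a) (t *: b) x0 (vec3 p))).

Lemma sqr_im_speed s : tt s ^+ 2 = s ^+ 2 * q + m * e.
Proof.
rewrite sqr_sqrtr // addr_ge0 ?(ltW me0) // mulr_ge0 ?sqr_ge0 //.
exact: le_trans q1.
Qed.

Lemma im_speed_ge0 s : 0 <= tt s. Proof. exact: sqrtr_ge0. Qed.

Lemma im_speed_le s : 1 <= s -> tt s <= s * B.
Proof.
move=> s1; have s0 : 0 < s by rewrite (lt_le_trans _ s1).
have B0 : 0 < B by rewrite (lt_le_trans _ B1).
rewrite -(@ler_pXn2r _ 2) ?nnegrE ?im_speed_ge0 ?mulr_ge0 // ?(ltW s0) ?(ltW B0) //.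
rewrite sqr_im_speed exprMn.
have s21 : 1 <= s ^+ 2 by rewrite exprn_ege1.
have me := me0; have h1 := qB; have h2 := B1.
apply: le_trans (_ : s ^+ 2 * (q + m * e) <= _).
  by rewrite mulrDr lerD2l ler_peMl // ltW.
rewrite ler_pM2l ?exprn_gt0 //; apply: le_trans h1 _.
by rewrite expr2 ler_peMr // ltW.
Qed.

(** The difference times the sum is [m * e], and the sum is at least 1. A bounded error is
    negligible against the leading order [s]. *)
Lemma im_speed_approx s : 1 <= s -> 0 <= tt s - s * Num.sqrt q <= m * e.
Proof.
move=> s1; have s0 : 0 < s by rewrite (lt_le_trans _ s1).
have q0 : 0 <= q by exact: le_trans q1.
have me := me0.
pose y := s * Num.sqrt q.
have y2 : y ^+ 2 = s ^+ 2 * q by rewrite exprMn sqr_sqrtr.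
have sq1 : 1 <= Num.sqrt q by rewrite -sqrtr1 ler_wsqrtr.
have y1 : 1 <= y by rewrite -[leLHS]mulr1 ler_pM.
have t0 := im_speed_ge0 s; have t2 := sqr_im_speed s; rewrite -y2 in t2.
rewrite -/y; have ty : y <= tt s.
  by rewrite -(@ler_pXn2r _ 2) ?nnegrE // ?(le_trans _ y1) // t2 lerDl ltW.
rewrite subr_ge0 ty /=.
have : (tt s - y) * (tt s + y) = m * e by rewrite -subr_sqr t2; ring.
move=> <-; rewrite ler_peMr ?subr_ge0 //.
by rewrite (le_trans y1) // lerDr.
Qed.

Definition tau (s : R) (k : 'I_3) : R[i] :=
  rho s (k + 1) * (cc 0 (k + 2%:R))%:C - rho s (k + 2%:R) * (cc 0 (k + 1))%:C.

(** The triple products a /\ (a /\ b) = - q b and b /\ (a /\ b) = a bring the test direction back to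
    the plane of [a] and [b]. *)
Lemma tauE s k : tau s k = (- (s * q) * b 0 k) +i* (tt s * a 0 k).
Proof.
have T1 := cross_cross a a b; rewrite aa ab scale0r sub0r in T1.
have T2 := cross_cross b a b; rewrite bb scale1r [dot b a]dotC ab scale0r subr0 in T2.
have R1 : cross a cc 0 k = - q * b 0 k by rewrite T1 !mxE mulNr.
have R2 : cross b cc 0 k = a 0 k by rewrite T2.
rewrite /tau /freq.
have S1 : cross a cc 0 k = a 0 (k + 1) * cc 0 (k + 2%:R) - a 0 (k + 2%:R) * cc 0 (k + 1).
  by rewrite mxE.
have S2 : cross b cc 0 k = b 0 (k + 1) * cc 0 (k + 2%:R) - b 0 (k + 2%:R) * cc 0 (k + 1).
  by rewrite mxE.
rewrite R1 in S1; rewrite R2 in S2; move: S1 S2; rewrite !mxE.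
generalize (k + 1) (k + 2%:R) => m1 m2 S1 S2.
apply: complex_eq; rewrite ?(ReD, ImD, ReN, ImN, ReM, ImM) /= !mulr0 ?subr0 ?add0r ?addr0.
  have -> : - (s * q) * b 0 k = s * (- q * b 0 k) by ring.
  by rewrite S1; ring.
by rewrite S2; ring.
Qed.

Lemma rho_cross s : \sum_k rho s k * (cc 0 k)%:C = 0.
Proof.
have H1 := dot_crossl a b; have H2 := dot_crossr a b.
rewrite !dotE in H1 H2.
rewrite sum3E /freq ![(s *: a) 0 _]mxE ![(tt s *: b) 0 _]mxE; move: H1 H2.
generalize (cc 0 0) (cc 0 1) (cc 0 2%:R) => k1 k2 k3 H1 H2.
apply: complex_eq; rewrite ?(ReD, ImD, ReM, ImM) /= !mulr0 ?subr0 ?add0r ?addr0.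
  transitivity (s * (a 0 0 * k1 + a 0 1 * k2 + a 0 2%:R * k3)); first ring.
  by rewrite H1 mulr0.
transitivity (tt s * (b 0 0 * k1 + b 0 1 * k2 + b 0 2%:R * k3)); first ring.
by rewrite H2 mulr0.
Qed.

Lemma rho_rho s : \sum_k rho s k * rho s k = - (m%:C * e%:C).
Proof.
have H1 := aa; have H2 := bb; have H3 := ab; rewrite !dotE in H1 H2 H3.
rewrite sum3E /freq !mxE -rmorphM -rmorphN.
apply: complex_eq; rewrite ?(ReD, ImD, ReM, ImM) /=.
  transitivity (s ^+ 2 * (a 0 0 * a 0 0 + a 0 1 * a 0 1 + a 0 2%:R * a 0 2%:R) -
    tt s ^+ 2 * (b 0 0 * b 0 0 + b 0 1 * b 0 1 + b 0 2%:R * b 0 2%:R)); first ring.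
  by rewrite H1 H2 sqr_im_speed; ring.
transitivity (2 * s * tt s * (a 0 0 * b 0 0 + a 0 1 * b 0 1 + a 0 2%:R * b 0 2%:R)).
  ring.
by rewrite H3 mulr0.
Qed.

(** The left-hand sides of the equations inherit integrability from the fields; [F1] and [F2] are
    then used only through bounds valid almost everywhere. *)
Definition source1 (k : 'I_3) (x : 'rV[R]_3) : R[i] :=
  curl D E x 0 k - 'i%C * m%:C * H x 0 k.
Definition source2 (k : 'I_3) (x : 'rV[R]_3) : R[i] :=
  curl D H x 0 k + 'i%C * e%:C * E x 0 k.

Let IE k := Hcurl_cintegrable r00 oD DB HE k.
Let IH k := Hcurl_cintegrable r00 oD DB HH k.
Let IcE k := curl_cintegrable r00 oD DB HE k.
Let IcH k := curl_cintegrable r00 oD DB HH k.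

Lemma source1_integrable k : cintegrable D`' (fun p => source1 k (vec3 p)).
Proof. exact: (cintegrableB mD (IcE k) (cintegrableZ _ mD (IH k))). Qed.

Lemma source2_integrable k : cintegrable D`' (fun p => source2 k (vec3 p)).
Proof. exact: (cintegrableD mD (IcH k) (cintegrableZ _ mD (IE k))). Qed.

Let I1 : cintegrable D`' (fun=> 1).
Proof. exact: cintegrable1. Qed.

Let Icst c : cintegrable D`' (fun=> c).
Proof.
have := cintegrableZ c mD I1.
by apply: eq_cintegrable => // p _; rewrite mulr1.
Qed.

Let cps s f := @cut_psi_integrable R x0 r0 KK a b tt oK s f.

Lemma momentD s (f g : 'rV[R]_3 -> R[i]) (c : R[i]) :
  cintegrable D`' (fun p => f (vec3 p)) -> cintegrable D`' (fun p => g (vec3 p)) ->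
  mom s (fun x => f x + c * g x) = mom s f + c * mom s g.
Proof.
move=> If Ig; rewrite /moment -cintZ //; last exact: cps.
rewrite -cintD //; [|exact: cps|by apply: cintegrableZ => //; exact: cps].
by apply: eq_cint => p _; rewrite mulrDl -[c * g _ * _]mulrA.
Qed.

Lemma moment_source1 s k : mom s (source1 k) + 'i%C * m%:C * mom s (fun x => H x 0 k) =
  mom s (fun x => curl D E x 0 k).
Proof.
have -> : mom s (source1 k) = mom s (fun x => curl D E x 0 k + (- ('i%C * m%:C)) * H x 0 k).
  by apply: eq_cint => p _; rewrite /source1 mulNr.
by rewrite momentD // mulNr subrK.
Qed.

Lemma moment_source2 s k : mom s (source2 k) - 'i%C * e%:C * mom s (fun x => E x 0 k) =
  mom s (fun x => curl D H x 0 k).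
Proof. by rewrite momentD // addrK. Qed.

Lemma source2_split s k : mom s (source2 k) =
  mom s (fun x => source2 k x - z k) + z k * mom s (fun=> 1).
Proof.
have I2 := cintegrableB mD (source2_integrable k) (Icst (z k)).
rewrite -(@momentD s (fun x => source2 k x - z k) (fun=> 1) _ I2 I1).
by apply: eq_cint => p _; congr (_ * _); rewrite mulr1 subrK.
Qed.

Lemma enorm_powR_le x : D x -> enorm (x - x0) `^ alpha <= r0 `^ alpha.
Proof.
move=> /DB xr; apply: ge0_ler_powR; rewrite ?nnegrE ?enorm_ge0 ?(ltW r00) //.
  by case/andP: alpha01 => /ltW.
exact: ltW.
Qed.

Lemma source1_bigO k : bigO (fun s => s ^- 3) (fun s => mom s (source1 k)).
Proof.
apply: (@moment_bounded_bigO R x0 r0 d KK a b tt oK d0 HK (source1 k)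
  (C1 * r0 `^ alpha + normc (F1 x0 0 k))).
- exact: source1_integrable.
- by rewrite addr_ge0 ?mulr_ge0 ?powR_ge0 ?normc_ge0.
have eq1' : {ae mu3, forall p, D (vec3 p) ->
    curl D E (vec3 p) - ('i%C * m%:C) *: H (vec3 p) = F1 (vec3 p)} := eq1.
apply: filterS eq1' => p Hp Dp; have {}Hp := Hp Dp.
have -> : source1 k (vec3 p) = (F1 (vec3 p) 0 k - F1 x0 0 k) + F1 x0 0 k.
  by rewrite subrK -Hp !mxE.
apply: le_trans (le_normcD _ _) _; rewrite lerD2r.
apply: le_trans (HF1 k Dp) _; rewrite ler_wpM2l //; exact: enorm_powR_le.
Qed.

Lemma source2_bigO k : bigO (fun s => s ^- 3 * decay alpha s)
  (fun s => mom s (fun x => source2 k x - z k)).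
Proof.
apply: (@moment_hoelder_bigO R x0 r0 alpha d KK a b tt alpha01 oK d0 HK
  (fun x => source2 k x - z k) C2) => //.
  exact: (cintegrableB mD (source2_integrable k) (Icst (z k))).
have eq2' : {ae mu3, forall p, D (vec3 p) ->
    curl D H (vec3 p) + ('i%C * e%:C) *: E (vec3 p) = F2 (vec3 p)} := eq2.
apply: filterS eq2' => p Hp Dp; have {}Hp := Hp Dp.
by have := HF2 k Dp; rewrite -[F2 (vec3 p)]Hp !mxE.
Qed.

Lemma tau_bigO k : bigO id (fun s => tau s k).
Proof.
exists (q * `|b 0 k| + B * `|a 0 k|) => [|s s1].
  have h1 : 0 <= q by exact: le_trans q1.
  have h2 : 0 <= B by exact: le_trans B1.
  by rewrite addr_ge0 // mulr_ge0.
have s0 : 0 < s by rewrite (lt_le_trans _ s1).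
have q0 : 0 <= q by exact: le_trans q1.
rewrite tauE; apply: le_trans (normc_leD _) _ => /=.
rewrite !normrM normrN normrM (gtr0_norm s0) (ger0_norm q0) (ger0_norm (im_speed_ge0 s)).
have : tt s * `|a 0 k| <= s * B * `|a 0 k| by rewrite ler_wpM2r // im_speed_le.
by rewrite mulrDl; lra.
Qed.

Definition source_tau (s : R) : R[i] := \sum_k z k * tau s k.

Lemma source_tau_bigO : bigO id source_tau.
Proof.
apply: bigO_sum => k.
have := bigOM (bigO_cst (z k)) (tau_bigO k).
by apply: (bigOW (C := 1)) => // s _; rewrite !mul1r.
Qed.

Local Notation rate := (fun s => s ^- 2 * decay alpha s).

Lemma rate_id (f g : R -> R[i]) : bigO (fun s => s ^- 3 * decay alpha s) f ->
  bigO id g -> bigO rate (fun s => f s * g s).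
Proof.
move=> Hf Hg; apply: (bigOW (C := 1)) (bigOM Hf Hg) => // s s1.
have s0 : 0 < s by rewrite (lt_le_trans _ s1).
by rewrite mul1r le_eqVlt; apply/orP; left; apply/eqP; field; rewrite gt_eqF.
Qed.

Lemma rate_cst (f : R -> R[i]) c : bigO (fun s => s ^- 3) f ->
  bigO rate (fun s => f s * c).
Proof.
move=> Hf; apply: (bigOW (C := 1)) (bigOM Hf (bigO_cst c)) => // s s1.
have s0 : 0 < s by rewrite (lt_le_trans _ s1).
rewrite mul1r mulr1 -(ler_pM2l (exprn_gt0 2 s0)) mulrA mulfV ?mul1r; last first.
  by rewrite gt_eqF // exprn_gt0.
have -> : s ^+ 2 * s ^- 3 = s^-1 by field; rewrite gt_eqF.
exact: (inv_le_decay alpha01).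
Qed.

(** After elimination of the fields every remaining term is either a quantity of order s^(-3-alpha)
    times one of order at most s, or a moment of order s^(-3) times a constant. *)
Lemma source_tau_laplace_bigO :
  bigO rate (fun s => source_tau s * cint KK`' (fun p => psi s (vec3 p))).
Proof.
have TO := @truncation_bigO R x0 r0 alpha d KK a b tt r00 alpha01 oK d0 HK.
have dEO k := @defect_bigO R x0 r0 alpha d KK a b tt r00 alpha01 oK d0 HK _ (k + 1) (k + 2%:R) HE.
have dHO k := @defect_bigO R x0 r0 alpha d KK a b tt r00 alpha01 oK d0 HK _ (k + 1) (k + 2%:R) HH.
pose dE k s := cutoff_defect x0 r0 D E (s *: a) (tt s *: b) (k + 1) (k + 2%:R).
pose dH k s := cutoff_defect x0 r0 D H (s *: a) (tt s *: b) (k + 1) (k + 2%:R).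
(* Lets [rate_id] treat the defects of [E], written with a trivial factor 1. *)
have id1 : bigO id (fun=> 1 : R[i]).
  by apply: (bigOW (C := 1)) (bigO_cst 1) => // s s1; rewrite mul1r.
have key s : source_tau s * cint KK`' (fun p => psi s (vec3 p)) =
    (cint KK`' (fun p => psi s (vec3 p)) - mom s (fun=> 1)) * source_tau s +
    \sum_k mom s (source1 k) * ('i%C * e%:C * (cc 0 k)%:C) + \sum_k dH k s * tau s k +
    - (\sum_k (dE k s * 1) * ('i%C * e%:C * (cc 0 k)%:C)) +
    - (\sum_k mom s (fun x => source2 k x - z k) * tau s k).
  have := @maxwell_algebra R[i] 'i%C m%:C e%:C
    (fun k => mom s (fun x => E x 0 k)) (fun k => mom s (fun x => H x 0 k))
    (fun k => mom s (source1 k)) (fun k => mom s (source2 k))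
    (dE^~ s) (dH^~ s) (rho s) (fun k => (cc 0 k)%:C).
  have ii : 'i%C * 'i%C = -1 :> R[i] by rewrite -expr2 sqr_i.
  move=> /(_ ii) alg.
  have A1 k : mom s (source1 k) + 'i%C * m%:C * mom s (fun x => H x 0 k) =
     mom s (fun x => E x 0 (k + 1)) * rho s (k + 2%:R) -
     mom s (fun x => E x 0 (k + 2%:R)) * rho s (k + 1) + dE k s.
    by rewrite moment_source1; exact: (trace_moment r00 oD DB HE TE).
  have A2 k : mom s (source2 k) - 'i%C * e%:C * mom s (fun x => E x 0 k) =
     mom s (fun x => H x 0 (k + 1)) * rho s (k + 2%:R) -
     mom s (fun x => H x 0 (k + 2%:R)) * rho s (k + 1) + dH k s.
    by rewrite moment_source2; exact: (trace_moment r00 oD DB HH TH).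
  have {}alg : \sum_k mom s (source2 k) * tau s k =
      'i%C * e%:C * (\sum_k mom s (source1 k) * (cc 0 k)%:C) + \sum_k dH k s * tau s k -
      'i%C * e%:C * (\sum_k dE k s * (cc 0 k)%:C) :=
    alg A1 A2 (rho_cross s) (rho_rho s).
  have S2 : \sum_k mom s (source2 k) * tau s k =
      \sum_k mom s (fun x => source2 k x - z k) * tau s k + mom s (fun=> 1) * source_tau s.
    rewrite /source_tau mulr_sumr -big_split; apply: eq_bigr => k _ /=.
    by rewrite source2_split mulrDl; congr (_ + _); rewrite mulrCA mulrA.
  have S1 : 'i%C * e%:C * (\sum_k mom s (source1 k) * (cc 0 k)%:C) =
      \sum_k mom s (source1 k) * ('i%C * e%:C * (cc 0 k)%:C).
    by rewrite mulr_sumr; apply: eq_bigr => k _; rewrite mulrCA.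
  have S3 : 'i%C * e%:C * (\sum_k dE k s * (cc 0 k)%:C) =
      \sum_k (dE k s * 1) * ('i%C * e%:C * (cc 0 k)%:C).
    by rewrite mulr_sumr; apply: eq_bigr => k _; rewrite mulr1 mulrCA.
  rewrite S1 S3 S2 in alg.
  have {}alg : mom s (fun=> 1) * source_tau s =
    \sum_k mom s (source1 k) * ('i%C * e%:C * (cc 0 k)%:C) + \sum_k dH k s * tau s k -
    \sum_k (dE k s * 1) * ('i%C * e%:C * (cc 0 k)%:C) -
    \sum_k mom s (fun x => source2 k x - z k) * tau s k.
    by rewrite -alg addrC addKr.
  rewrite mulrBl [cint _ _ * source_tau s]mulrC alg; set X1 := source_tau s * _.
  generalize X1 (\sum_k mom s (source1 k) * ('i%C * e%:C * (cc 0 k)%:C))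
    (\sum_k dH k s * tau s k) (\sum_k (dE k s * 1) * ('i%C * e%:C * (cc 0 k)%:C))
    (\sum_k mom s (fun x => source2 k x - z k) * tau s k) => y1 y2 y3 y4 y5.
  ring.
have -> : (fun s => source_tau s * cint KK`' (fun p => psi s (vec3 p))) = (fun s =>
    (cint KK`' (fun p => psi s (vec3 p)) - mom s (fun=> 1)) * source_tau s +
    \sum_k mom s (source1 k) * ('i%C * e%:C * (cc 0 k)%:C) + \sum_k dH k s * tau s k +
    - (\sum_k (dE k s * 1) * ('i%C * e%:C * (cc 0 k)%:C)) +
    - (\sum_k mom s (fun x => source2 k x - z k) * tau s k)).
  by apply/funext => s; exact: key.
apply: bigOD; [apply: bigOD; [apply: bigOD; [apply: bigOD|]|]|].
- exact: rate_id TO source_tau_bigO.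
- by apply: bigO_sum => k; apply: rate_cst; exact: source1_bigO.
- by apply: bigO_sum => k; apply: rate_id; [exact: dHO|exact: tau_bigO].
- apply: bigON; apply: bigO_sum => k.
  have := bigOM (rate_id (dEO k) id1) (bigO_cst ('i%C * e%:C * (cc 0 k)%:C)).
  by apply: (bigOW (C := 1)) => // s s1; rewrite mul1r mulr1.
- apply: bigON; apply: bigO_sum => k; apply: rate_id; [exact: source2_bigO|exact: tau_bigO].
Qed.

(** [source_tau s] is [s * Num.sqrt q] times the left-hand side, up to a bounded error. Dividing the
    previous estimate by the lower bound makes it O(s^(1-alpha)), so the left-hand side, free of
    [s], is O(s^(-alpha)). *)
Lemma apex_relation :
  - (Num.sqrt q)%:C * (\sum_k z k * (b 0 k)%:C) + 'i%C * (\sum_k z k * (a 0 k)%:C) = 0.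
Proof.
set Lb := \sum_k z k * (b 0 k)%:C; set La := \sum_k z k * (a 0 k)%:C.
have q0 : 0 < q by rewrite (lt_le_trans _ q1).
have sq0 : 0 < Num.sqrt q by rewrite sqrtr_gt0.
have sq2 : Num.sqrt q * Num.sqrt q = q by rewrite -expr2 sqr_sqrtr // ltW.
have source_tauE s : source_tau s = - (s * q)%:C * Lb + 'i%C * (tt s)%:C * La.
  rewrite /source_tau /Lb /La !mulr_sumr -big_split; apply: eq_bigr => k _ /=.
  rewrite tauE; have -> : (- (s * q) * b 0 k) +i* (tt s * a 0 k) =
    - (s * q)%:C * (b 0 k)%:C + 'i%C * (tt s)%:C * (a 0 k)%:C.
    by apply: complex_eq; rewrite ?(ReD, ImD, ReN, ImN, ReM, ImM) /=; ring.
  by rewrite mulrDr ![z k * _]mulrCA -!mulrA ![z k * _]mulrC; ring.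
set W := _ + _.
have [C C0 HC] := source_tau_laplace_bigO.
suff : normc W = 0 by exact: eq0_normc.
apply: (@decay_to0 _ alpha alpha01 _ (C / c1 + m * e * normc La)).
  exact: normc_ge0.
move=> s s1; have s0 : 0 < s by rewrite (lt_le_trans _ s1).
have de0 := decay_gt0 alpha s1.
have sd1 := le_mul_decay alpha01 s1.
have low : c1 / s ^+ 3 <= normc (cint KK`' (fun p => psi s (vec3 p))).
  by apply: lower => //; rewrite im_speed_ge0 im_speed_le.
have L1 : normc (source_tau s) <= C / c1 * (s * decay alpha s).
  have h1 : normc (source_tau s) * (c1 / s ^+ 3) <= C * (s ^- 2 * decay alpha s).
    apply: le_trans (HC s s1); rewrite normcM.
    by apply: ler_wpM2l => //; exact: normc_ge0.
  have -> : C / c1 * (s * decay alpha s) =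
      C * (s ^- 2 * decay alpha s) / (c1 / s ^+ 3).
    by field; rewrite !gt_eqF.
  by rewrite ler_pdivlMr // divr_gt0 // exprn_gt0.
have /andP[t0 t1] := im_speed_approx s1.
have WE : (s * Num.sqrt q)%:C * W =
    source_tau s - 'i%C * (tt s - s * Num.sqrt q)%:C * La.
  have qC : (s * q)%:C = s%:C * ((Num.sqrt q)%:C * (Num.sqrt q)%:C) :> R[i].
    by rewrite -!rmorphM sq2.
  have sC : (s * Num.sqrt q)%:C = s%:C * (Num.sqrt q)%:C :> R[i] by rewrite rmorphM.
  have tC : (tt s - s * Num.sqrt q)%:C =
      (tt s)%:C - s%:C * (Num.sqrt q)%:C :> R[i] by rewrite rmorphB rmorphM.
  rewrite source_tauE /W qC tC sC.
  generalize (s%:C : R[i]) ((Num.sqrt q)%:C : R[i]) ((tt s)%:C : R[i]) ('i%C : R[i]) Lb La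
    => y1 y2 y3 y4 y5 y6; ring.
have sq1 : 1 <= Num.sqrt q by rewrite -sqrtr1 ler_wsqrtr.
have h2 : s * normc W <= normc ((s * Num.sqrt q)%:C * W).
  rewrite normcM normc_real ger0_norm ?mulr_ge0 ?(ltW s0) ?(ltW sq0) //.
  by rewrite ler_wpM2r ?normc_ge0 // ler_peMr // ltW.
have h3 : normc ((s * Num.sqrt q)%:C * W) <=
    C / c1 * (s * decay alpha s) + m * e * normc La.
  rewrite WE; apply: le_trans (le_normcD _ _) _; apply: lerD => //.
  rewrite normcN !normcM normc_real (ger0_norm t0).
  have -> : normc ('i%C : R[i]) = 1 by rewrite /= expr0n expr1n add0r sqrtr1.
  by rewrite mul1r ler_wpM2r // normc_ge0.
have h4 : m * e * normc La <= m * e * normc La * (s * decay alpha s).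
  by rewrite ler_peMr // mulr_ge0 ?normc_ge0 // ltW.
have : s * normc W <= s * ((C / c1 + m * e * normc La) * decay alpha s) by lra.
by rewrite ler_pM2l.
Qed.

End ApexRelation.

(** * Vanishing of the sources *)

Section Final.
Context {R : realType}.

Lemma cdotD (z : 'rV[R[i]]_3) (u v : 'rV[R]_3) : cdot z (u + v) = cdot z u + cdot z v.
Proof.
rewrite /cdot -big_split; apply: eq_bigr => k _ /=.
by rewrite mxE rmorphD mulrDr.
Qed.

Lemma cdotZ (z : 'rV[R[i]]_3) (r : R) (u : 'rV[R]_3) : cdot z (r *: u) = r%:C * cdot z u.
Proof.
rewrite /cdot mulr_sumr; apply: eq_bigr => k _.
by rewrite mxE rmorphM mulrCA.
Qed.

(** Only the product [m * e] is assumed positive, because exchanging the two fields makes both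
    constants negative. *)
Lemma source_apex_eq0 (n : nat) (w : 'I_n -> 'rV[R]_3) (x0 : 'rV[R]_3) (r0 alpha : R)
    (F1 F2 E H : cfield R) (m e : R) :
  let D := truncated_cone w x0 r0 in
  let Gamma := boundary D `\` boundary (eball x0 r0) in
  0 < m * e -> convex_polyhedral_cone w x0 -> 0 < r0 -> 0 < alpha < 1 ->
  hoelder_on alpha (closure D) F1 -> hoelder_on alpha (closure D) F2 ->
  Hcurl D E -> Hcurl D H ->
  ae_in D (fun x => curl D E x - ('i%C * m%:C) *: H x = F1 x) ->
  ae_in D (fun x => curl D H x + ('i%C * e%:C) *: E x = F2 x) ->
  tangential_trace_zero D Gamma E -> tangential_trace_zero D Gamma H ->
  F2 x0 = 0.
Proof.
move=> D Gamma me0 cp r00 alpha01 hF1 hF2 HE HH eq1 eq2 TE TH.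
have [a0 [w1 [w2 [w3 [n1 [n2 [n3 [eta0 [delta F]]]]]]]]] := edge_frame_exists cp.
pose KK := [set x | cone0 w (x - x0)].
have DE : D = KK `&` eball x0 r0.
  by apply/seteqP; split=> x [/open_coneE Kx xr]; split => //; apply/open_coneE.
have oK : open KK.
  apply: open_comp; last exact: ef_open F.
  by move=> x _; apply: continuousB; [exact: cvg_id|exact: cst_continuous].
have cx0 : closure D x0 by rewrite DE; exact: apex_in_closure F r00.
have [C1 C10 HC1] := hoelder_apex hF1 cx0.
have [C2 C20 HC2] := hoelder_apex hF2 cx0.
pose b := cross w1 a0.
have aw := ef_a0w1 F; have aa := ef_a0 F; have ww := ef_w1 F.
have bw : dot b w1 = 0 by rewrite dotC dot_crossl.
have ba : dot b a0 = 0 by rewrite dotC dot_crossr.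
have bb : dot b b = 1 by rewrite dot_cross aa ww dotC aw; ring.
(* Dominates [q + m * e] for every tilt below [eta0] at once, so [cone_laplace_lower] gives [c] and
   [eta1] uniformly in eta. *)
pose B := 1 + (1 + eta0 ^+ 2) + m * e.
have eta00 := ef_eta0 F; have eta02 := sqr_ge0 eta0.
have B1 : 1 <= B by rewrite /B; lra.
have [eta1 /andP[eta10 eta1le] [c c0 Hc]] :=
  cone_laplace_lower x0 F bw (lt_le_trans ltr01 B1).
rewrite /Gamma DE in TE TH; rewrite DE in HE HH eq1 eq2 HC1 HC2.
pose I : R[i] := 'i%C.
have rel (eta : R) : 0 < eta < eta1 ->
    - (Num.sqrt (1 + eta ^+ 2))%:C * cdot (F2 x0) b +
    I * cdot (F2 x0) (a0 - eta *: w1) = 0.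
  move=> /andP[e0 e1].
  have eta_in : 0 < eta < eta0 by rewrite e0 (lt_le_trans e1).
  have [d d0 Hd] := ef_in F eta_in.
  apply: (@apex_relation R x0 r0 alpha KK r00 alpha01 oK E H F1 F2 m e HE HH TE TH me0
    eq1 eq2 C1 C2 C10 C20 HC1 HC2 (a0 - eta *: w1) b d B (1 + eta ^+ 2) c) => //.
  - by move=> x Kx; exact: Hd.
  - by rewrite !(dotDl, dotDr, dotNl, dotNr, dotZl, dotZr) aa ww aw [dot w1 a0]dotC aw; ring.
  - by rewrite dotDl dotNl dotZl ![dot _ b]dotC ba bw; ring.
  - by rewrite lerDl sqr_ge0.
  - rewrite /B lerD2r; have : eta ^+ 2 <= eta0 ^+ 2.
      by rewrite ler_pXn2r ?nnegrE //; [case/andP: eta_in => _ /ltW|exact: ltW|exact: ltW].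
    lra.
  - by move=> s t s0 ts; apply: Hc => //; rewrite e0.
have [Lb La Lw] : [/\ cdot (F2 x0) b = 0, I * cdot (F2 x0) a0 = 0 &
    - I * cdot (F2 x0) w1 = 0].
  apply: (three_points eta10) => eta /rel <-.
  have -> : cdot (F2 x0) (a0 - eta *: w1) = cdot (F2 x0) a0 - (eta : R)%:C * cdot (F2 x0) w1.
    by rewrite cdotD -scaleNr cdotZ -mulNr; congr (_ + _ * _); exact: rmorphN.
  have alg (y1 y2 y3 y4 y5 y6 : R[i]) :
      - y5 * y1 + y6 * y2 + y4 * (- y6 * y3) = - y5 * y1 + y6 * (y2 - y4 * y3) by ring.
  exact: alg.
have i0 : I != 0 by rewrite /I eq_complex /= oner_eq0 andbF.
have {}La : cdot (F2 x0) a0 = 0.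
  by move/eqP: La; rewrite mulf_eq0 (negPf i0) => /eqP.
have {}Lw : cdot (F2 x0) w1 = 0.
  by move/eqP: Lw; rewrite mulf_eq0 oppr_eq0 (negPf i0) => /eqP.
apply/rowP => k; rewrite mxE.
have -> : F2 x0 0 k = cdot (F2 x0) (delta_mx 0 k).
  rewrite /cdot (bigD1 k) //= big1 ?addr0 => [|j /negPf jk].
    by rewrite !mxE !eqxx mulr1.
  by rewrite !mxE jk mulr0.
rewrite (orthonormal_frame (delta_mx 0 k) aa ww aw) !cdotD !cdotZ -/b La Lb Lw.
by rewrite !mulr0 !addr0.
Qed.

End Final.

Theorem theorem1p1 (R : realType) (omega eps0 mu0 : R) (n : nat)
    (w : 'I_n -> 'rV[R]_3) (x0 : 'rV[R]_3) (r0 alpha : R)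
    (F1 F2 : cfield R) :
  let D := truncated_cone w x0 r0 in
  let Gamma := boundary D `\` boundary (eball x0 r0) in
  0 < omega -> 0 < eps0 -> 0 < mu0 ->
  convex_polyhedral_cone w x0 ->
  0 < r0 -> 0 < alpha < 1 ->
  hoelder_on alpha (closure D) F1 -> hoelder_on alpha (closure D) F2 ->
  (exists E H : cfield R,
    [/\ Hcurl D E /\ Hcurl D H,
        ae_in D (fun x => curl D E x - ('i%C * (omega * mu0)%:C) *: H x = F1 x),
        ae_in D (fun x => curl D H x + ('i%C * (omega * eps0)%:C) *: E x = F2 x),
        tangential_trace_zero D Gamma E &
        tangential_trace_zero D Gamma H]) ->
  F1 x0 = 0 /\ F2 x0 = 0.
Proof.
move=> D Gamma om ep mu cp r00 al hF1 hF2 [E [H [[HE HH] eq1 eq2 TE TH]]].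
have m0 : 0 < omega * mu0 by exact: mulr_gt0.
have e0 : 0 < omega * eps0 by exact: mulr_gt0.
split; last first.
  exact: (source_apex_eq0 (mulr_gt0 m0 e0) cp r00 al hF1 hF2 HE HH eq1 eq2 TE TH).
(* Read with the fields exchanged, the second equation becomes a first one with constant
   [- (omega * eps0)], and the first a second one with [- (omega * mu0)]. *)
have me0 : 0 < - (omega * eps0) * - (omega * mu0) by rewrite mulrNN mulr_gt0.
have C (r : R) : 'i%C * (- r)%:C = - ('i%C * r%:C) :> R[i] by rewrite rmorphN mulrN.
apply: (source_apex_eq0 me0 cp r00 al hF2 hF1 HH HE _ _ TH TE).
- by apply: filterS (eq2 : {ae @lebesgue3 R, forall p, D (vec3 p) -> _}) => p Hp Dp; rewrite C scaleNr opprK; exact: Hp.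
- by apply: filterS (eq1 : {ae @lebesgue3 R, forall p, D (vec3 p) -> _}) => p Hp Dp; rewrite C scaleNr; exact: Hp.
Qed.
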